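(* Let $d\ge 2$ and let $g(\boldsymbol{x})$ be a real-valued general conjugate form of degree $d$ in $\boldsymbol{x}\in\mathbb{C}^n$. Consider the problem $(G_S)$: $\max\{g(\boldsymbol{x}):\boldsymbol{x}\in\mathbf{S}^n\}$, and let $\gamma\in\left(0,\frac{2n}{\ln(2n)}\right)$ be any given number. (i) If $d$ is even, then $(G_S)$ admits a polynomial-time randomized algorithm with relative approximation ratio $\frac{d!}{(2d)^d}\left(\frac{\gamma\ln(2n)}{2n}\right)^{\frac{d-2}{2}}$, i.e., a feasible solution $\boldsymbol{z}\in\mathbf{S}^n$ can be generated in polynomial time such that $$g(\boldsymbol{z})-v_{\min}(G_S)\ge\frac{d!}{(2d)^d}\left(\frac{\gamma\ln(2n)}{2n}\right)^{\frac{d-2}{2}}\left(v_{\max}(G_S)-v_{\min}(G_S)\right).$$ (ii) If $d$ is odd, then $(G_S)$ admits a polynomial-time randomized algorithm with approximation ratio $\frac{d!}{(\sqrt2\,d)^d}\left(\frac{\gamma\ln(2n)}{2n}\right)^{\frac{d-2}{2}}$.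
   Context: $\mathbf{S}^n=\{\boldsymbol{x}\in\mathbb{C}^n:\|\boldsymbol{x}\|_2=1\}$ is the complex unit sphere. A general conjugate form of degree $d$ in $\boldsymbol{x}\in\mathbb{C}^n$ is a function $$g(\boldsymbol{x})=\sum_{k=0}^d\ \sum_{1\le i_1\le\dots\le i_k\le n}\ \sum_{1\le j_1\le\dots\le j_{d-k}\le n}a_{i_1\dots i_k,j_1\dots j_{d-k}}\,\overline{x_{i_1}\cdots x_{i_k}}\,x_{j_1}\cdots x_{j_{d-k}}$$ with complex coefficients; it is real-valued if $g(\boldsymbol{x})\in\mathbb{R}$ for all $\boldsymbol{x}\in\mathbb{C}^n$. For a maximization problem $(P):\max_{\boldsymbol{x}\in X}p(\boldsymbol{x})$, $v_{\max}(P)$ is its optimal value and $v_{\min}(P)$ is the optimal value of $\min_{\boldsymbol{x}\in X}p(\boldsymbol{x})$. $(P)$ admits a polynomial-time approximation algorithm with approximation ratio $\rho\in(0,1]$ if $v_{\max}(P)\ge0$ and a feasible $\boldsymbol{z}\in X$ can be found in polynomial time with $p(\boldsymbol{z})\ge\rho\,v_{\max}(P)$; with relative approximation ratio $\rho\in(0,1]$ if a feasible $\boldsymbol{z}\in X$ can be found in polynomial time with $p(\boldsymbol{z})-v_{\min}(P)\ge\rho\,(v_{\max}(P)-v_{\min}(P))$. For a randomized algorithm this means: for any given $\epsilon>0$, such a $\boldsymbol{z}$ is generated in polynomial time with probability at least $1-\epsilon$. The input is the coefficients of $g$; the degree $d$ (and the parameter $\gamma$) are regarded as fixed in ''polynomial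 time''. *)

(* Defs.v *)
From mathcomp Require Import all_boot all_order all_algebra.
From mathcomp Require Import complex.
From mathcomp Require Import boolp classical_sets reals exp.

Set Implicit Arguments.
Unset Strict Implicit.
Unset Printing Implicit Defensive.

Import Order.TTheory GRing.Theory Num.Theory.
Local Open Scope classical_set_scope.
Local Open Scope ring_scope.
Local Open Scope complex_scope.

(* [a k i j] is the coefficient of the monomial whose conjugated variables are
   indexed by the tuple [i] (of length [k]) and whose other variables are
   indexed by [j] (of length [d - k]).  Only nondecreasing tuples count: the
   entries of [a] at other tuples are never read. *)
Definition coefs (R : realType) (n d : nat) : Type :=
  forall k : 'I_d.+1, k.-tuple 'I_n -> (d - k).-tuple 'I_n -> R[i].

Definition nondecr (n : nat) (s : seq 'I_n) : bool :=
  sorted (fun p q : 'I_n => (p <= q)%N) s.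

Definition conj_form (R : realType) (n d : nat) (a : coefs R n d)
    (x : 'cV[R[i]]_n) : R[i] :=
  \sum_(k < d.+1)
    \sum_(i : k.-tuple 'I_n | nondecr i)
      \sum_(j : (d - k).-tuple 'I_n | nondecr j)
        a k i j * Num.conj (\prod_(t <- i) x t 0) * \prod_(t <- j) x t 0.

Definition real_valued (R : realType) (n d : nat) (a : coefs R n d) : Prop :=
  forall x : 'cV[R[i]]_n, conj_form a x \is Num.real.

(* The form as a real function; meant for real-valued forms only. *)
Definition real_form (R : realType) (n d : nat) (a : coefs R n d)
    (x : 'cV[R[i]]_n) : R :=
  complex.Re (conj_form a x).

Definition l2norm (R : realType) (n : nat) (x : 'cV[R[i]]_n) : R :=
  Num.sqrt (\sum_(t < n) (complex.Re (x t 0) ^+ 2 + complex.Im (x t 0) ^+ 2)).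

Definition csphere (R : realType) (n : nat) : set 'cV[R[i]]_n :=
  [set x | l2norm x = 1].
Arguments csphere R n : clear implicits.

Definition vmax (R : realType) (T : Type) (X : set T) (p : T -> R) : R :=
  sup [set p x | x in X].

Definition vmin (R : realType) (T : Type) (X : set T) (p : T -> R) : R :=
  inf [set p x | x in X].

Definition approx_sol (R : realType) (T : Type) (rho : R) (X : set T)
    (p : T -> R) (z : T) : Prop :=
  X z /\ p z >= rho * vmax X p.

Definition rel_approx_sol (R : realType) (T : Type) (rho : R) (X : set T)
    (p : T -> R) (z : T) : Prop :=
  X z /\ p z - vmin X p >= rho * (vmax X p - vmin X p).

(* Exact real arithmetic (field operations, square root, comparison) at unit
   cost, and fair coin tosses.  Programs contain integer constants only.
   Memory consists of natural-number variables, used for control and for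
   addressing, and of real arrays indexed by natural numbers.  There is no
   rounding of reals to integers, and natural numbers have addition and
   truncated subtraction but no unit-cost multiplication, since those
   operations would make unit cost unrealistically powerful. *)

Inductive nexp : Type :=
| NConst of nat
| NVar of nat
| NAdd of nexp & nexp
| NSub of nexp & nexp.

Inductive rexp : Type :=
| RConst of nat
| RGet of nat & nexp
| RAdd of rexp & rexp
| RSub of rexp & rexp
| RMul of rexp & rexp
| RDiv of rexp & rexp
| RSqrt of rexp.

Inductive test : Type :=
| NLe of nexp & nexp
| RLe of rexp & rexp.

Inductive cmd : Type :=
| Skip
| NSet of nat & nexp
| RSet of nat & nexp & rexp
| Flip of nat
| Seq of cmd & cmd
| If of test & cmd & cmd
| While of test & cmd.

Record state (R : realType) : Type := State {
  nvar : nat -> nat;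
  rarr : nat -> nat -> R;
  coins : seq bool
}.

Fixpoint neval (R : realType) (s : state R) (e : nexp) : nat :=
  match e with
  | NConst c => c
  | NVar x => nvar s x
  | NAdd e1 e2 => (neval s e1 + neval s e2)%N
  | NSub e1 e2 => (neval s e1 - neval s e2)%N
  end.

(* Division by zero and square roots of negative numbers return zero. *)
Fixpoint reval (R : realType) (s : state R) (e : rexp) : R :=
  match e with
  | RConst c => c%:R
  | RGet b i => rarr s b (neval s i)
  | RAdd e1 e2 => reval s e1 + reval s e2
  | RSub e1 e2 => reval s e1 - reval s e2
  | RMul e1 e2 => reval s e1 * reval s e2
  | RDiv e1 e2 => reval s e1 / reval s e2
  | RSqrt e1 => Num.sqrt (reval s e1)
  end.

Definition teval (R : realType) (s : state R) (t : test) : bool :=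
  match t with
  | NLe e1 e2 => (neval s e1 <= neval s e2)%N
  | RLe e1 e2 => reval s e1 <= reval s e2
  end.

Definition set_nvar (R : realType) (s : state R) (x v : nat) : state R :=
  State (fun y => if y == x then v else nvar s y) (rarr s) (coins s).

Definition set_rarr (R : realType) (s : state R) (b i : nat) (v : R)
    : state R :=
  State (nvar s)
    (fun b' i' => if (b' == b) && (i' == i) then v else rarr s b' i') (coins s).

Definition flip (R : realType) (s : state R) (x : nat) : state R :=
  let s' := set_nvar s x (head false (coins s) : nat) in
  State (nvar s') (rarr s') (behead (coins s)).

(* A configuration is the stack of commands still to be run, and a state. *)
Definition config (R : realType) : Type := (seq cmd * state R)%type.

Definition step (R : realType) (cf : config R) : config R :=
  let: (k, s) := cf in
  match k with
  | [::] => ([::], s)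
  | Skip :: k' => (k', s)
  | NSet x e :: k' => (k', set_nvar s x (neval s e))
  | RSet b i e :: k' => (k', set_rarr s b (neval s i) (reval s e))
  | Flip x :: k' => (k', flip s x)
  | Seq c1 c2 :: k' => ([:: c1, c2 & k'], s)
  | If t c1 c2 :: k' => ((if teval s t then c1 else c2) :: k', s)
  | While t c :: k' =>
      if teval s t then ([:: c, While t c & k'], s) else (k', s)
  end.

Definition run (R : realType) (c : cmd) (T : nat) (s : state R) : config R :=
  iter T (@step R) ([:: c], s).

Definition halted (R : realType) (cf : config R) : bool := nilp cf.1.

(* The word [s], read as a number in base [n]. *)
Definition radix (n : nat) (s : seq 'I_n) : nat :=
  foldl (fun (m : nat) (t : 'I_n) => m * n + t)%N 0%N s.

(* Variable 0 holds the dimension.  The real and imaginary parts of [a k i j]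
   are stored in the arrays [2k] and [2k+1], at the address [radix (i ++ j)],
   for nondecreasing [i] and [j]; everything else is zero.  Distinct pairs
   [(i, j)] of the given lengths have distinct addresses, so that at most one
   term of the sum is not zero. *)
Definition input_arr (R : realType) (n d : nat) (a : coefs R n d)
    (b m : nat) : R :=
  \sum_(k < d.+1 | k == b./2 :> nat)
    \sum_(i : k.-tuple 'I_n | nondecr i)
      \sum_(j : (d - k).-tuple 'I_n | nondecr j && (radix (i ++ j) == m))
        (if odd b then complex.Im (a k i j) else complex.Re (a k i j)).

Definition input (R : realType) (n d : nat) (a : coefs R n d) (w : seq bool)
    : state R :=
  State (fun x => if x == 0%N then n else 0%N) (input_arr a) w.

(* The output vector is read in arrays 0 and 1 (real and imaginary parts). *)
Definition output (R : realType) (n : nat) (cf : config R) : 'cV[R[i]]_n :=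
  \col_(t < n) Complex (rarr cf.2 0 t) (rarr cf.2 1 t).

Definition coin_prob (R : realType) (T : nat) (E : T.-tuple bool -> Prop) : R :=
  #|[pred w : T.-tuple bool | `[< E w >]]|%:R / 2 ^+ T.

(* One program and one polynomial for all instances of degree [d] with dimension
   in [dom].  As [d] is fixed, polynomial in [n] is the same as polynomial in
   the number of coefficients.  A run of [T] steps tosses at most [T] coins, so
   tapes of length [T] suffice. *)
Definition rand_poly_time (R : realType) (d : nat) (dom : nat -> Prop)
    (good : forall n : nat, coefs R n d -> 'cV[R[i]]_n -> Prop) : Prop :=
  forall eps : R, 0 < eps ->
  exists (c : cmd) (P : {poly nat}),
  forall (n : nat) (a : coefs R n d), dom n -> real_valued a ->
    let T := P.[n] in
    (forall w : T.-tuple bool, halted (run c T (input a w))) /\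
    1 - eps <= coin_prob R
      (fun w : T.-tuple bool => good n a (output n (run c T (input a w)))).

Definition GS_admits_approx (R : realType) (d : nat) (dom : nat -> Prop)
    (rho : nat -> R) : Prop :=
  [/\ forall n : nat, dom n -> 0 < rho n <= 1,
      forall (n : nat) (a : coefs R n d), dom n -> real_valued a ->
        0 <= vmax (csphere R n) (real_form a)
    & rand_poly_time dom
        (fun n (a : coefs R n d) z =>
           approx_sol (rho n) (csphere R n) (real_form a) z)].

Definition GS_admits_rel_approx (R : realType) (d : nat) (dom : nat -> Prop)
    (rho : nat -> R) : Prop :=
  (forall n : nat, dom n -> 0 < rho n <= 1) /\
  rand_poly_time dom
    (fun n (a : coefs R n d) z =>
       rel_approx_sol (rho n) (csphere R n) (real_form a) z).

(* Main.v *)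
Require Import Defs.
From mathcomp Require Import all_boot all_order all_algebra.
From mathcomp Require Import fingroup perm.
From mathcomp Require Import complex.
From mathcomp Require Import boolp classical_sets reals exp.
From mathcomp Require Import zify ring lra.

Set Implicit Arguments.
Unset Strict Implicit.
Unset Printing Implicit Defensive.

Import Order.TTheory GRing.Theory Num.Theory.
Local Open Scope ring_scope.

(** Writing the variables as real and imaginary parts turns the conjugate form
    into a real form [p] of degree [d] on the unit sphere of R^N, with N = 2n.
    For even [d] the search works with q = p - p(e) |x|^d for a fixed unit vector
    [e], for odd [d] with q = p.  It is enough to produce a polynomial number
    of unit vectors [u] such that max |q u| over them is at least a fixed fraction
    of |q y| for every unit vector [y], and to return the one with the largest
    value of [q].

    The iterated central difference of [q] along x_1, ..., x_d is 2^d d! times its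
    symmetric multilinear form G ([sign_polarization], [dform_pol_lin],
    [dform_pol_diag]); it is computed from 2^d values of [q] alone.  Starting from
    G(y, ..., y) = q(y), replace d - 2 of the arguments by vectors of a polynomial
    family of test vectors.  One replacement costs a factor beta, where every
    vector [a] has a test vector [x] with |<a, x>| >= beta |a|
    ([substitute_test_vecs]).  Such a family with beta^2 = gamma ln(N) / (2N) is
    explicit: some window of b = O(gamma ln N) cyclically consecutive coordinates
    carries at least a fraction b/N of |a|^2, and inside the window a vector is well
    approximated in direction by an integer vector of 1-norm at most 4b, that is,
    by a word of length 5b over three letters.  There are only 3^(5b) = N^O(gamma)
    such words ([word_net], [test_family_quality], [test_family_size]).  In
    the two arguments that are left, G is a symmetric matrix; the power method, started
    from every basis vector and run for N rounds, finds a pair of unit vectors on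
    which it takes at least half of its norm ([power_method]).

    So |G(x_1, ..., x_d)| >= beta^(d-2) |q y| / 2 for some unit vectors that the
    search meets, and since the iterated difference is a sum of 2^d values of [q]
    at signed sums of the x_i, which have norm at most [d], one normalised signed
    sum [u] satisfies |q u| >= d! d^(-d) beta^(d-2) |q y| / 2 ([search_point]).
    For odd [d] this is exactly the ratio claimed, because -u is a candidate
    too.  For even [d] the shift makes max q >= 0 >= min q, and a large |q u| of
    either sign is as good as a large value relative to the minimum; this loses a
    factor 2, which the difference between (sqrt 2)^d and 2^d absorbs.

    The algorithm is deterministic, so it succeeds with probability 1.  It is
    written with counting loops whose bounds n, 2n and 243 (2n)^E stay fixed, which
    makes termination and the polynomial running time a matter of syntax
    ([runs_compile]) and leaves a functional denotation to reason about. *)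

(** * Loop programs: denotation and running time *)

(** The only loops are the counting loops [PFor x b p], in which [x] takes the values
    below that of the variable [b]. *)
Inductive prog : Type :=
| PSkip
| PN of nat & nexp
| PR of nat & nexp & rexp
| PSeq of prog & prog
| PIf of test & prog & prog
| PFor of nat & nat & prog.

Fixpoint compile (p : prog) : cmd :=
  match p with
  | PSkip => Skip
  | PN x e => NSet x e
  | PR b i e => RSet b i e
  | PSeq p1 p2 => Seq (compile p1) (compile p2)
  | PIf t p1 p2 => If t (compile p1) (compile p2)
  | PFor x b p1 =>
      Seq (NSet x (NConst 0))
          (While (NLe (NAdd (NVar x) (NConst 1)) (NVar b))
                 (Seq (compile p1) (NSet x (NAdd (NVar x) (NConst 1)))))
  end.

Section Semantics.
Variable R : realType.
Implicit Types (s : state R) (p : prog).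

(** In a loop the counter is already advanced at the end of each round, as in the
    compiled while loop, so that both leave the same state. *)
Fixpoint den p s : state R :=
  match p with
  | PSkip => s
  | PN x e => set_nvar s x (neval s e)
  | PR b i e => set_rarr s b (neval s i) (reval s e)
  | PSeq p1 p2 => den p2 (den p1 s)
  | PIf t p1 p2 => if teval s t then den p1 s else den p2 s
  | PFor x b p1 =>
      iteri (nvar s b) (fun i s' => set_nvar (den p1 s') x i.+1)
            (set_nvar s x 0)
  end.

Fixpoint nwrites p : seq nat :=
  match p with
  | PSkip => [::]
  | PN x _ => [:: x]
  | PR _ _ _ => [::]
  | PSeq p1 p2 => nwrites p1 ++ nwrites p2
  | PIf _ p1 p2 => nwrites p1 ++ nwrites p2
  | PFor x _ p1 => x :: nwrites p1
  end.

Fixpoint rwrites p : seq nat :=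
  match p with
  | PSkip => [::]
  | PN _ _ => [::]
  | PR b _ _ => [:: b]
  | PSeq p1 p2 => rwrites p1 ++ rwrites p2
  | PIf _ p1 p2 => rwrites p1 ++ rwrites p2
  | PFor _ _ p1 => rwrites p1
  end.

Lemma den_nvar p s x : x \notin nwrites p -> nvar (den p s) x = nvar s x.
Proof.
elim: p s => [|y e|b i e|p1 IH1 p2 IH2|t p1 IH1 p2 IH2|y b p1 IH1] s //=.
- by rewrite inE => /negbTE->.
- by rewrite mem_cat negb_or => /andP[h1 h2]; rewrite IH2 // IH1.
- by rewrite mem_cat negb_or => /andP[h1 h2]; case: ifP => _; [exact: IH1|exact: IH2].
- rewrite inE negb_or => /andP[/negbTE xy h].
  by elim: (nvar s b) => [|m IHm] /=; rewrite xy // IH1.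
Qed.

Lemma den_rarr p s b : b \notin rwrites p -> rarr (den p s) b = rarr s b.
Proof.
elim: p s => [|y e|c i e|p1 IH1 p2 IH2|t p1 IH1 p2 IH2|y c p1 IH1] s //=.
- by rewrite inE => /negbTE h; apply/funext => j; rewrite h.
- by rewrite mem_cat negb_or => /andP[h1 h2]; rewrite IH2 // IH1.
- by rewrite mem_cat negb_or => /andP[h1 h2]; case: ifP => _; [exact: IH1|exact: IH2].
- by move=> h; elim: (nvar s c) => [|m IHm] //=; rewrite IH1.
Qed.

(** Loop bounds lie in [K], and no variable of [K] is written: every loop then
    runs a number of times that is known from the initial state. *)
Fixpoint bounded (K : pred nat) p : bool :=
  match p with
  | PSkip => true
  | PN x _ => ~~ K x
  | PR _ _ _ => true
  | PSeq p1 p2 => bounded K p1 && bounded K p2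
  | PIf _ p1 p2 => bounded K p1 && bounded K p2
  | PFor x b p1 => [&& K b, ~~ K x, x \notin nwrites p1 & bounded K p1]
  end.

(** [e b] is an upper bound, as a polynomial in the dimension, for the loop bound
    stored in [b].  Each round of a loop takes three steps besides its body: the
    test, the sequencing and the increment. *)
Fixpoint cost (e : nat -> {poly nat}) p : {poly nat} :=
  match p with
  | PSkip => 1
  | PN _ _ => 1
  | PR _ _ _ => 1
  | PSeq p1 p2 => 1 + cost e p1 + cost e p2
  | PIf _ p1 p2 => 1 + cost e p1 + cost e p2
  | PFor _ b p1 => 3%:P + e b * (3%:P + cost e p1)
  end.

Lemma bounded_nwrites K p x : bounded K p -> K x -> x \notin nwrites p.
Proof.
move=> + Kx; elim: p => [|y e|b i e|p1 IH1 p2 IH2|t p1 IH1 p2 IH2|y b p1 IH1] //=.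
- by rewrite inE; apply: contra => /eqP<-.
- by case/andP=> h1 h2; rewrite mem_cat negb_or IH1 ?IH2.
- by case/andP=> h1 h2; rewrite mem_cat negb_or IH1 ?IH2.
- case/and4P=> _ h _ /IH1 h1; rewrite inE negb_or h1 andbT.
  by apply: contra h => /eqP<-.
Qed.

Lemma bounded_for K x b p : bounded K (PFor x b p) ->
  x \notin nwrites p /\ bounded K p.
Proof. by case/and4P. Qed.

(** The stack [k] of pending commands is arbitrary, which is what makes runs
    compose. *)
Definition runs (c : cmd) s s' (T : nat) :=
  exists2 t, (t <= T)%N & forall k, iter t (@step R) (c :: k, s) = (k, s').

Lemma runs_seq c1 c2 s1 s2 s3 T1 T2 :
  runs c1 s1 s2 T1 -> runs c2 s2 s3 T2 -> runs (Seq c1 c2) s1 s3 (1 + T1 + T2).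
Proof.
move=> [t1 l1 h1] [t2 l2 h2]; exists (t2 + (t1 + 1))%N; first by lia.
by move=> k; rewrite iterD iterD /= h1 h2.
Qed.

Lemma runs_step c s s' : (forall k, step (c :: k, s) = (k, s')) -> runs c s s' 1.
Proof. by move=> h; exists 1%N. Qed.

(** The bounds of the loops cannot change while the program runs, so the number of
    rounds is known on entry; the compiled while loop then performs the iteration
    of the denotation round by round. *)
Lemma runs_compile (K : pred nat) (e : nat -> {poly nat}) (n : nat) p s :
    bounded K p -> (forall b, K b -> (nvar s b <= (e b).[n])%N) ->
  runs (compile p) s (den p s) (cost e p).[n].
Proof.
elim: p s => [|y ex|b i ex|p1 IH1 p2 IH2|t p1 IH1 p2 IH2|y b p1 IH1] s /=.
- by move=> _ _; rewrite hornerC; exact: runs_step.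
- by move=> _ _; rewrite hornerC; exact: runs_step.
- by move=> _ _; rewrite hornerC; exact: runs_step.
- case/andP=> w1 w2 hb; rewrite !hornerD hornerC.
  apply: runs_seq (IH1 _ w1 hb) (IH2 _ w2 _) => c Kc.
  by rewrite den_nvar ?hb // (bounded_nwrites w1).
- case/andP=> w1 w2 hb; rewrite !hornerD hornerC.
  case: ifP => ht.
    have [t1 l1 h1] := IH1 _ w1 hb.
    exists (t1 + 1)%N; first by rewrite /GRing.add /=; lia.
    by move=> k; rewrite iterD /= ht.
  have [t1 l1 h1] := IH2 _ w2 hb.
  exists (t1 + 1)%N; first by rewrite /GRing.add /=; lia.
  by move=> k; rewrite iterD /= ht.
case/and4P=> Kb nKy nw w1 hb.
have by_ : (b == y) = false by apply: contraNF nKy => /eqP<-.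
set f := (fun i s' => _); set c := (cost e p1).[n].
have nb1 : b \notin nwrites p1 by apply: bounded_nwrites w1 Kb.
have stay m x : K x -> nvar (iteri m f (set_nvar s y 0)) x = nvar s x.
  move=> Kx; have xy : (x == y) = false by apply: contraNF nKy => /eqP<-.
  by elim: m => [|m IHm] /=; rewrite xy // den_nvar // (bounded_nwrites w1).
have cnt m : nvar (iteri m f (set_nvar s y 0)) y = m.
  by case: m => [|m] /=; rewrite eqxx.
set W := While _ _.
(* The number [r] of remaining rounds is the induction variable. *)
have loop r m : (m + r)%N = nvar s b ->
    runs W (iteri m f (set_nvar s y 0)) (iteri (nvar s b) f (set_nvar s y 0))
      (1 + r * (3 + c)).
  elim: r m => [|r IHr] m hm.
    exists 1%N; first by lia.
    move=> k /=; rewrite cnt stay // -hm addn0.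
    by rewrite addn1 ltnn.
  have [|t1 l1 h1] := IH1 (iteri m f (set_nvar s y 0)) w1.
    by move=> x Kx; rewrite stay ?hb.
  have [|t2 l2 h2] := IHr m.+1; first by lia.
  exists (t2 + (1 + (t1 + 2)))%N; first by rewrite -/c in l1; lia.
  move=> k; rewrite iterD (iterD 1) (iterD t1) /= cnt stay //.
  have -> : (m + 1 <= nvar s b)%N by lia.
  by rewrite h1 /= den_nvar // cnt -h2 /= addn1.
have r1 : runs (NSet y (NConst 0)) s (set_nvar s y 0) 1 by exact: runs_step.
have [|t l h] := runs_seq r1 (loop (nvar s b) 0%N _); first by rewrite add0n.
exists t => //; apply: leq_trans l _.
rewrite !hornerE -/c; have := hb _ Kb; set B := (e b).[n] => hB.
have : (nvar s b * (3 + c) <= B * (3 + c))%N by rewrite leq_mul2r hB orbT.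
rewrite /GRing.add /GRing.mul /=; lia.
Qed.

Lemma den_seq p1 p2 s : den (PSeq p1 p2) s = den p2 (den p1 s).
Proof. by []. Qed.

Lemma den_if t p1 p2 s : den (PIf t p1 p2) s = if teval s t then den p1 s else den p2 s.
Proof. by []. Qed.

Lemma den_skip s : den PSkip s = s.
Proof. by []. Qed.

(** All loops below are analysed through this rule; [I i] is what holds on entry to
    round [i]. *)
Lemma for_ind (I : nat -> state R -> Prop) x b p s :
    I 0%N (set_nvar s x 0) ->
    (forall i s', (i < nvar s b)%N -> nvar s' x = i -> I i s' ->
       I i.+1 (set_nvar (den p s') x i.+1)) ->
  I (nvar s b) (den (PFor x b p) s).
Proof.
move=> I0 IS /=; set m := nvar s b in IS *.
have : (m <= m)%N by [].
elim: {1 3 4}m => [//|k IHk] hk /=; apply: IS => //; last by apply: IHk; lia.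
by case: {IHk hk}k => [|k] /=; rewrite eqxx.
Qed.

Lemma den_rarr_all (P : pred nat) p s b :
  all P (rwrites p) -> ~~ P b -> rarr (den p s) b = rarr s b.
Proof. by move=> /allP h Pb; apply: den_rarr; apply: contra Pb => /h. Qed.

Lemma den_nvar_all (P : pred nat) p s x :
  all P (nwrites p) -> ~~ P x -> nvar (den p s) x = nvar s x.
Proof. by move=> /allP h Px; apply: den_nvar; apply: contra Px => /h. Qed.

Lemma run_halt c s s' T : runs c s s' T -> run c T s = ([::], s').
Proof.
move=> [t l h]; rewrite /run -(subnK l) iterD h.
by elim: (T - t)%N => //= m ->.
Qed.

End Semantics.

(** * Polarization *)

Lemma big_tuple_cons (S : nmodType) (T : finType) (m : nat)
    (F : m.+1.-tuple T -> S) :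
  \sum_(w : m.+1.-tuple T) F w = \sum_(x : T) \sum_(w : m.-tuple T) F [tuple of x :: w].
Proof.
rewrite pair_big /=.
rewrite (reindex (fun p : T * m.-tuple T => [tuple of p.1 :: p.2])) //=.
exists (fun w : m.+1.-tuple T => (thead w, [tuple of behead w])); first move=> [x w] _ /=.
  by congr (_, _); apply: val_inj.
by move=> w _; apply: val_inj => /=; case/tupleP: w => x w; rewrite theadE.
Qed.

Lemma big_tuple0 (S : nmodType) (T : finType) (F : 0.-tuple T -> S) :
  \sum_(w : 0.-tuple T) F w = F [tuple].
Proof.
by rewrite (big_pred1 [tuple]) // => w /=; rewrite [w]tuple0; apply/eqP.
Qed.

Lemma big_tuple_ffun (S : nmodType) (T : finType) (m : nat) (F : m.-tuple T -> S) :
  \sum_(w : m.-tuple T) F w = \sum_(f : {ffun 'I_m -> T}) F [tuple f i | i < m].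
Proof.
apply: reindex.
exists (fun w : m.-tuple T => [ffun i => tnth w i]).
  by move=> f _; apply/ffunP => i; rewrite ffunE tnth_mktuple.
by move=> w _; apply: eq_from_tnth => i; rewrite tnth_mktuple ffunE.
Qed.

(** Expand the product over [t] of the sums over [i] as a sum over the maps [f]
    from factors to arguments.  Summing over the signs kills every [f] that
    misses an argument, because the sign of that argument then occurs only once;
    what remains are the bijections. *)
Lemma sign_polarization (C : comPzRingType) (d : nat) (u : 'I_d -> 'I_d -> C) :
  \sum_(xi : {ffun 'I_d -> bool})
     (\prod_(i < d) (-1) ^+ xi i) * \prod_(t < d) \sum_(i < d) (-1) ^+ xi i * u t i
  = 2 ^+ d * \sum_(s : 'S_d) \prod_(t < d) u t (s t).
Proof.
pose g (f : {ffun 'I_d -> 'I_d}) (i : 'I_d) (b : bool) : C :=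
  (-1) ^+ b * \prod_(t < d | f t == i) (-1) ^+ b.
transitivity (\sum_(f : {ffun 'I_d -> 'I_d})
    (\prod_(i < d) \sum_(b : bool) g f i b) * \prod_(t < d) u t (f t)).
  under eq_bigr => xi _ do rewrite (bigA_distr_bigA (fun t i => (-1) ^+ xi i * u t i)) mulr_sumr.
  rewrite exchange_big /=; apply: eq_bigr => f _.
  rewrite (bigA_distr_bigA (g f)) mulr_suml; apply: eq_bigr => xi _.
  rewrite big_split /= mulrA; congr (_ * _).
  rewrite /g big_split /=; congr (_ * _).
  rewrite (partition_big f xpredT) //=; apply: eq_bigr => i _.
  by apply: eq_bigr => t /eqP ->.
rewrite (bigID (fun f : {ffun 'I_d -> 'I_d} => injectiveb f)) /= [X in _ + X]big1 ?addr0; last first.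
  move=> f /injectivePn ninj.
  have [i hi] : exists i, forall t, f t != i.
    apply: contrapT => h.
    have surj i : exists t, f t = i.
      apply: contrapT => hi; apply: h; exists i => t.
      by apply/eqP => e; apply: hi; exists t.
    case: ninj => x [y xy fxy].
    have : #|[set f t | t in [set~ x]]| = d.
      rewrite -[RHS]card_ord -cardsT; apply: eq_card => i; rewrite inE; apply/imsetP.
      have [t <-] := surj i; have [->|tx] := eqVneq t x.
        by exists y; rewrite // !inE eq_sym.
      by exists t; rewrite // !inE.
    have := leq_imset_card f (mem [set~ x]); rewrite cardsC1 card_ord => + e.
    by have := ltn_ord x; rewrite e; lia.
  have none (b : bool) : \prod_(t < d | f t == i) (-1) ^+ b = 1 :> C.
    by apply: big_pred0 => t; apply/negbTE.
  by rewrite (bigD1 i) //= big_bool /g !none !mulr1 /= expr1 expr0 (addNr (1 : C)) !mul0r.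
rewrite mulr_sumr (reindex (fun s : 'S_d => pval s)) /=; last first.
  exists (fun f => insubd (1%g : 'S_d) f); first by move=> s _; rewrite valKd.
  by move=> f hf; rewrite [pval _](insubdK (1%g : 'S_d)).
apply: eq_big => [s|s _]; first by rewrite (valP s).
congr (_ * _); last by apply: eq_bigr => t _; rewrite pvalE.
rewrite -[d in RHS]card_ord -prodr_const; apply: eq_bigr => i _.
have one (b : bool) : \prod_(t < d | pval s t == i) (-1) ^+ b = (-1) ^+ b :> C.
  by apply: (big_pred1 (s^-1 i)%g) => t; rewrite pvalE (canF_eq (permK s)).
by rewrite big_bool /g !one expr1 expr0 mulrNN mulr1.
Qed.

Section Polarization.
Variables (R : realType) (V : lmodType R).
Implicit Types (q : V -> R) (x y z : V) (xs ys : seq V).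

(** The iterated central difference of [q] at [z] along the vectors of [xs]. *)
Fixpoint pol q xs z : R :=
  if xs is x :: xs' then pol q xs' (z + x) - pol q xs' (z - x) else q z.

Fixpoint signed_sums xs z : seq V :=
  if xs is x :: xs' then signed_sums xs' (z + x) ++ signed_sums xs' (z - x)
  else [:: z].

(** Forms of degree [d], presented as real parts of sums of products of [d] linear
    functionals: polarization expands such products, and a conjugate form is given
    as such a sum from the start. *)
Definition dform (d : nat) q : Prop :=
  exists (I : finType) (c : I -> R[i]) (f : I -> nat -> V -> R[i]),
    (forall i t a x y, f i t (a *: x + y) = a%:C%C * f i t x + f i t y) /\
    forall x, q x = complex.Re (\sum_i c i * \prod_(t < d) f i t x).

Lemma pol_signs q xs z :
  pol q xs z = \sum_(w : (size xs).-tuple bool)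
    (\prod_(i < size xs) (-1) ^+ tnth w i) *
    q (z + \sum_(i < size xs) (-1) ^+ tnth w i *: nth 0 xs i).
Proof.
elim: xs z => [|x xs IH] z /=.
  by rewrite big_tuple0 !big_ord0 addr0 mul1r.
rewrite big_tuple_cons big_bool /= addrC !IH -sumrN; congr (_ + _).
  apply: eq_bigr => w _; rewrite !big_ord_recl !tnth0 expr0 scale1r mul1r -addrA.
  congr (_ * q (z + (x + _))).
    by apply: eq_bigr => i _; rewrite tnthS.
  by apply: eq_bigr => i _; rewrite tnthS.
apply: eq_bigr => w _; rewrite !big_ord_recl !tnth0 expr1 scaleN1r mulN1r mulNr -addrA.
congr (- (_ * q (z + (- x + _)))).
  by apply: eq_bigr => i _; rewrite tnthS.
by apply: eq_bigr => i _; rewrite tnthS.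
Qed.

Lemma pol_swap q xs x y z : pol q (xs ++ [:: x; y]) z = pol q (xs ++ [:: y; x]) z.
Proof.
elim: xs z => [|a xs IH] z /=; last by rewrite !IH.
rewrite (addrAC z y x) (addrAC z y (- x)) (addrAC z (- y) x) (addrAC z (- y) (- x)).
have exch (a b c e : R) : a - b - (c - e) = a - c - (b - e) by lra.
exact: exch.
Qed.

Lemma ReZ (a : R) (w : R[i]) : complex.Re (a%:C%C * w) = a * complex.Re w.
Proof. by case: w => u v /=; ring. Qed.

Lemma ReD (v w : R[i]) : complex.Re (v + w) = complex.Re v + complex.Re w.
Proof. by case: v; case: w. Qed.

Lemma Re_sum (I : finType) (F : I -> R[i]) :
  complex.Re (\sum_i F i) = \sum_i complex.Re (F i).
Proof. exact: raddf_sum. Qed.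

(** The difference is a combination of permanents, in which every argument occurs
    exactly once in each product; multilinearity and the value on the diagonal can
    be read off. *)
Lemma pol_permanent (d : nat) (I : finType) (c : I -> R[i]) (f : I -> nat -> V -> R[i]) q xs :
    (forall i t a x y, f i t (a *: x + y) = a%:C%C * f i t x + f i t y) ->
    (forall x, q x = complex.Re (\sum_i c i * \prod_(t < d) f i t x)) ->
    size xs = d ->
  pol q xs 0 = 2 ^+ d * complex.Re (\sum_i c i * \sum_(s : 'S_d) \prod_(t < d) f i t (nth 0 xs (s t))).
Proof.
move=> flin qE sz; rewrite pol_signs sz big_tuple_ffun.
have f0 i t : f i t 0 = 0 by have := flin i t (-1) 0 0; rewrite scaler0 add0r rmorphN1 mulN1r addNr.
have fsum i t (J : finType) (a : J -> R) (y : J -> V) :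
    f i t (\sum_j a j *: y j) = \sum_j (a j)%:C%C * f i t (y j).
  by elim/big_rec2: _ => [|j u v _ <-]; [exact: f0 | rewrite flin].
rewrite -ReZ mulr_sumr.
have -> : (2 ^+ d)%:C%C = 2 ^+ d :> R[i] by rewrite rmorphXn rmorph_nat.
under [in RHS]eq_bigr => i _ do rewrite mulrCA -(sign_polarization (fun t j : 'I_d => f i t (nth 0 xs j))) mulr_sumr.
rewrite exchange_big /= Re_sum; apply: eq_bigr => xi _.
rewrite add0r qE -ReZ mulr_sumr rmorph_prod; congr complex.Re; apply: eq_bigr => i _.
rewrite mulrCA; congr (_ * (_ * _)).
  by apply: eq_bigr => j _; rewrite tnth_mktuple rmorphXn rmorphN1.
apply: eq_bigr => t _; rewrite fsum; apply: eq_bigr => j _.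
by rewrite tnth_mktuple rmorphXn rmorphN1.
Qed.

Lemma dform_pol_lin d q xs ys a x y : dform d q -> (size xs + size ys).+1 = d ->
  pol q (xs ++ (a *: x + y) :: ys) 0 = a * pol q (xs ++ x :: ys) 0 + pol q (xs ++ y :: ys) 0.
Proof.
move=> [I [c [f [flin qE]]]] sz.
have szz z : size (xs ++ z :: ys) = d by rewrite size_cat /= addnS.
rewrite !(pol_permanent flin qE) //.
rewrite mulrCA -mulrDr -(ReZ a) -ReD mulr_sumr -big_split /=.
congr (_ * complex.Re _); apply: eq_bigr => i _.
rewrite mulrCA -mulrDr; congr (_ * _).
rewrite mulr_sumr -big_split /=; apply: eq_bigr => s _.
have hk : (size xs < d)%N by lia.
pose k := Ordinal hk; pose t0 := (s^-1 k)%g.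
have st0 : s t0 = k by rewrite permKV.
have key z : \prod_(t < d) f i t (nth 0 (xs ++ z :: ys) (s t)) =
    f i t0 z * \prod_(t < d | t != t0) f i t (nth 0 (xs ++ 0 :: ys) (s t)).
  rewrite (bigD1 t0) //= st0 nth_cat ltnn subnn /=; congr (_ * _).
  apply: eq_bigr => t tt; congr f; rewrite !nth_cat; case: ltnP => // hl.
  have : s t != k by apply: contra tt => /eqP e; apply/eqP; rewrite /t0 -e permK.
  rewrite -val_eqE /= => hne; case E: (s t - size xs)%N => [|m] //=.
  by move: hne hl E; move: (nat_of_ord (s t)) => m; lia.
by rewrite !key flin mulrDl mulrA.
Qed.

Lemma dform_pol_diag d q x : dform d q -> pol q (nseq d x) 0 = 2 ^+ d * d`!%:R * q x.
Proof.
move=> [I [c [f [flin qE]]]].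
rewrite (pol_permanent flin qE) ?size_nseq // qE -mulrA; congr (_ * _).
rewrite -ReZ mulr_sumr; congr complex.Re; apply: eq_bigr => i _.
rewrite mulrCA; congr (_ * _); rewrite rmorph_nat.
under eq_bigr => s _ do under eq_bigr => t _ do rewrite nth_nseq ltn_ord.
by rewrite sumr_const -(card_Sn d) mulr_natl; congr (_ *+ _); apply: eq_card.
Qed.

Lemma dformZ d q a x : dform d q -> q (a *: x) = a ^+ d * q x.
Proof.
move=> [I [c [f [flin qE]]]]; rewrite !qE -ReZ mulr_sumr; congr complex.Re.
apply: eq_bigr => i _; rewrite mulrCA; congr (_ * _).
rewrite rmorphXn -[d in _ ^+ d]card_ord -prodr_const -big_split /=.
apply: eq_bigr => t _.
have f0 : f i t 0 = 0 by have := flin i t (-1) 0 0; rewrite scaler0 add0r rmorphN1 mulN1r addNr.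
by rewrite -[a *: x]addr0 flin f0 addr0.
Qed.

Lemma dform_sub d q1 q2 : dform d q1 -> dform d q2 -> dform d (fun x => q1 x - q2 x).
Proof.
move=> [I1 [c1 [f1 [l1 e1]]]] [I2 [c2 [f2 [l2 e2]]]].
exists (I1 + I2)%type, (fun i => match i with inl i => c1 i | inr i => - c2 i end),
  (fun i => match i with inl i => f1 i | inr i => f2 i end); split.
  by case=> i.
move=> x; rewrite big_sumType /= ReD e1 e2; congr (_ + _).
by rewrite -mulN1r -ReZ rmorphN1 mulN1r -sumrN; congr complex.Re; apply: eq_bigr => i _; rewrite mulNr.
Qed.

Lemma dform_scale d q a : dform d q -> dform d (fun x => a * q x).
Proof.
move=> [I [c [f [l e]]]]; exists I, (fun i => a%:C%C * c i), f; split=> // x.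
by rewrite e -ReZ mulr_sumr; congr complex.Re; apply: eq_bigr => i _; rewrite mulrA.
Qed.

(** A large iterated difference needs a large value of [q] at one of its [2 ^ d]
    signed sums; used in contrapositive form. *)
Lemma pol_lt q xs z b : (forall y, y \in signed_sums xs z -> `|q y| < b) ->
  `|pol q xs z| < 2 ^+ size xs * b.
Proof.
elim: xs z => [|x xs IH] z h /=; first by rewrite mul1r h // inE.
apply: le_lt_trans (ler_normB _ _) _.
rewrite exprS -mulrA mulr_natl mulr2n ltrD //; apply: IH => y hy; apply: h.
  by rewrite /= mem_cat hy.
by rewrite /= mem_cat hy orbT.
Qed.

Lemma signed_sumsN xs z y : (y \in signed_sums xs z) = (- y \in signed_sums xs (- z)).
Proof.
elim: xs z => [|x xs IH] z /=; first by rewrite !inE eqr_opp.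
by rewrite !mem_cat !IH opprD opprB (addrC x) orbC.
Qed.

End Polarization.

(** * Euclidean vectors *)

Section Euclid.
Variables (R : realType) (N : nat).
Local Notation V := 'rV[R]_N.
Implicit Types (x y z v : V) (f : V -> R).

Definition dot x y : R := \sum_(t < N) x 0 t * y 0 t.
Definition nrm x : R := Num.sqrt (dot x x).
Definition unit x : V := (nrm x)^-1 *: x.
Definition evec (t : 'I_N) : V := delta_mx 0 t.

Definition lin f : Prop := forall a x y, f (a *: x + y) = a * f x + f y.

Lemma dotC x y : dot x y = dot y x.
Proof. by apply: eq_bigr => t _; rewrite mulrC. Qed.

Lemma dot_lin y : lin (fun x => dot x y).
Proof.
move=> a x z; rewrite /dot mulr_sumr -big_split /=.
by apply: eq_bigr => t _; rewrite !mxE; ring.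
Qed.

Lemma lin0 f : lin f -> f 0 = 0.
Proof. by move=> h; have := h (-1) 0 0; rewrite scaler0 add0r mulN1r addNr. Qed.

Lemma linZ f a x : lin f -> f (a *: x) = a * f x.
Proof. by move=> h; rewrite -[a *: x]addr0 h lin0 // addr0. Qed.

Lemma linD f x y : lin f -> f (x + y) = f x + f y.
Proof. by move=> h; rewrite -[x]scale1r h mul1r scale1r. Qed.

Lemma lin_sum f (J : finType) (a : J -> R) (y : J -> V) : lin f ->
  f (\sum_j a j *: y j) = \sum_j a j * f (y j).
Proof. by move=> h; elim/big_rec2: _ => [|j u v _ <-]; [exact: lin0|rewrite h]. Qed.

Lemma evec_sum x : x = \sum_t x 0 t *: evec t.
Proof. by rewrite [LHS]row_sum_delta. Qed.

Lemma lin_dot f x : lin f -> f x = dot x (\row_t f (evec t)).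
Proof.
move=> h; rewrite {1}[x]evec_sum lin_sum //; apply: eq_bigr => t _.
by rewrite mxE.
Qed.

Lemma dot_evec x t : dot x (evec t) = x 0 t.
Proof.
rewrite /dot (bigD1 t) //= big1 ?addr0 => [|j jt].
  by rewrite mxE !eqxx mulr1.
by rewrite mxE (negbTE jt) andbF mulr0.
Qed.

Lemma dot_ge0 x : 0 <= dot x x.
Proof. by apply: sumr_ge0 => t _; rewrite -expr2 sqr_ge0. Qed.

Lemma nrm_ge0 x : 0 <= nrm x.
Proof. exact: sqrtr_ge0. Qed.

Lemma nrm_sqr x : nrm x ^+ 2 = dot x x.
Proof. by rewrite sqr_sqrtr // dot_ge0. Qed.

Lemma nrm0_eq0 x : nrm x = 0 -> x = 0.
Proof.
move=> h; apply/rowP => t; rewrite mxE.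
have : dot x x = 0 by rewrite -nrm_sqr h expr0n.
move/eqP; rewrite psumr_eq0 => [/allP /(_ t)|j _]; last by rewrite -expr2 sqr_ge0.
by rewrite mem_index_enum => /(_ isT) /=; rewrite mulf_eq0 orbb => /eqP.
Qed.

Lemma nrm0 : nrm 0 = 0.
Proof. by rewrite /nrm (lin0 (dot_lin 0)) sqrtr0. Qed.

Lemma dotZZ a x : dot (a *: x) (a *: x) = a ^+ 2 * dot x x.
Proof. by rewrite (linZ _ _ (dot_lin _)) dotC (linZ _ _ (dot_lin _)) mulrA expr2. Qed.

Lemma nrmZ a x : nrm (a *: x) = `|a| * nrm x.
Proof. by rewrite /nrm dotZZ sqrtrM ?sqr_ge0 // sqrtr_sqr. Qed.

Lemma nrmN x : nrm (- x) = nrm x.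
Proof. by rewrite -scaleN1r nrmZ normrN1 mul1r. Qed.

Lemma nrm_unit x : x != 0 -> nrm (unit x) = 1.
Proof.
move=> x0; rewrite nrmZ ger0_norm ?invr_ge0 ?nrm_ge0 // mulVf //.
by apply: contra x0 => /eqP /nrm0_eq0 ->.
Qed.

Lemma nrm_unit_le x : nrm (unit x) <= 1.
Proof.
have [->|x0] := eqVneq x 0; last by rewrite nrm_unit.
by rewrite /unit scaler0 nrm0 ler01.
Qed.

Lemma unitK x : nrm x *: unit x = x.
Proof.
have [->|x0] := eqVneq x 0; first by rewrite /unit !scaler0.
rewrite /unit scalerA mulfV ?scale1r //.
by apply: contra x0 => /eqP /nrm0_eq0 ->.
Qed.

Lemma nrm_evec t : nrm (evec t) = 1.
Proof. by rewrite /nrm dot_evec mxE !eqxx sqrtr1. Qed.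

Lemma cauchy_schwarz x y : `|dot x y| <= nrm x * nrm y.
Proof.
have lD := dot_lin.
have [->|y0] := eqVneq y 0.
  by rewrite dotC (lin0 (lD x)) normr0 nrm0 mulr0.
have ny : 0 < nrm y.
  by rewrite lt_def nrm_ge0 andbT; apply: contra y0 => /eqP /nrm0_eq0 ->.
rewrite -(ler_pXn2r (n := 2)) ?nnegrE ?mulr_ge0 ?nrm_ge0 //.
rewrite real_normK ?num_real // exprMn !nrm_sqr.
have := dot_ge0 (dot y y *: x + (- dot x y) *: y).
set w := _ + _.
rewrite {1}/w lD (linZ _ _ (lD w)) (dotC x) (dotC y) !lD !(linZ _ _ (lD _)) {w}.
rewrite (dotC y x); set a := dot x x; set b := dot x y; set c := dot y y.
have c0 : 0 < c by rewrite /c -nrm_sqr exprn_gt0.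
have -> : c * (c * a + - b * b) + - b * (c * b + - b * c) = c * (a * c - b ^+ 2) by ring.
by rewrite pmulr_rge0 // subr_ge0.
Qed.

Lemma nrm_add x y : nrm (x + y) <= nrm x + nrm y.
Proof.
rewrite -(ler_pXn2r (n := 2)) ?nnegrE ?addr_ge0 ?nrm_ge0 // nrm_sqr sqrrD !nrm_sqr.
rewrite (linD _ _ (dot_lin _)) !(dotC _ (x + y)) !(linD _ _ (dot_lin _)) (dotC y x).
have := cauchy_schwarz x y; rewrite ler_norml => /andP[_ h].
rewrite mulr2n; lra.
Qed.

Lemma nrm_sum (J : finType) (P : pred J) (F : J -> V) :
  nrm (\sum_(j | P j) F j) <= \sum_(j | P j) nrm (F j).
Proof.
elim/big_rec2: _ => [|j u v _ h]; first by rewrite nrm0.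
by apply: le_trans (nrm_add _ _) _; rewrite lerD2l.
Qed.

Lemma lin_norm_ge f y : lin f -> nrm y = 1 ->
  `|f y| <= nrm (\row_t f (evec t)).
Proof. by move=> lf y1; rewrite lin_dot //; have := cauchy_schwarz y (\row_t f (evec t)); rewrite y1 mul1r. Qed.

End Euclid.

(** * The power method *)

Section Power.
Variables (R : realType) (N : nat).
Local Notation V := 'rV[R]_N.
Variable M : V -> V.
Hypothesis Mlin : forall a x y, M (a *: x + y) = a *: M x + M y.
Hypothesis Msym : forall x y, dot (M x) y = dot x (M y).

(** Normalising in every round changes only the lengths of the iterates of [M];
    [power_unitE] makes this precise, also when an iterate vanishes. *)
Definition power_unit (t : 'I_N) (k : nat) : V :=
  iter k (fun v => unit (M v)) (evec R t).

Let M0 : M 0 = 0.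
Proof. by have := Mlin (-1) 0 0; rewrite scaler0 add0r scaleN1r addNr. Qed.

Let MZ a x : M (a *: x) = a *: M x.
Proof. by rewrite -[a *: x]addr0 Mlin M0 addr0. Qed.

Let iterM0 k : iter k M 0 = 0.
Proof. by elim: k => //= k ->; rewrite M0. Qed.

(** Self-adjointness makes the norms of the iterates log-convex, so that the
    first growth factor is a lower bound for all later ones. *)
Lemma power_growth y k : nrm y = 1 ->
  nrm (M y) * nrm (iter k M y) <= nrm (iter k.+1 M y).
Proof.
move=> y1; elim: k => [|k IH]; first by rewrite /= y1 mulr1.
have [z0|nz] := eqVneq (iter k M y) 0.
  by rewrite !iterS z0 !M0 nrm0 mulr0.
have nk : 0 < nrm (iter k M y).
  by rewrite lt_def nrm_ge0 andbT; apply: contra nz => /eqP /nrm0_eq0 ->.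
have h : nrm (iter k.+1 M y) ^+ 2 <= nrm (iter k M y) * nrm (iter k.+2 M y).
  rewrite nrm_sqr {1}[iter k.+1 M y]iterS Msym.
  exact: le_trans (ler_norm _) (cauchy_schwarz _ _).
rewrite -(ler_pM2l nk); apply: le_trans h.
by rewrite mulrCA mulrA expr2 ler_wpM2r ?nrm_ge0.
Qed.

Lemma power_lower y k : nrm y = 1 -> nrm (M y) ^+ k <= nrm (iter k M y).
Proof.
move=> y1; elim: k => [|k IH]; first by rewrite expr0 /= y1.
apply: le_trans (power_growth k y1).
by rewrite exprS ler_wpM2l ?nrm_ge0.
Qed.

Lemma iter_lin k a x y : iter k M (a *: x + y) = a *: iter k M x + iter k M y.
Proof. by elim: k => //= k ->; rewrite Mlin. Qed.

Lemma power_unitE t k : iter k M (evec R t) = nrm (iter k M (evec R t)) *: power_unit t k.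
Proof.
elim: k => [|k IH]; first by rewrite /= nrm_evec scale1r.
have E : iter k.+1 M (evec R t) = nrm (iter k M (evec R t)) *: M (power_unit t k).
  by rewrite iterS {1}IH MZ.
have -> : power_unit t k.+1 = unit (M (power_unit t k)) by [].
rewrite E nrmZ ger0_norm ?nrm_ge0 // -scalerA; congr (_ *: _).
by rewrite unitK.
Qed.

(** Started from all basis vectors, the power method must see a growth factor of
    at least half the norm of [M y]: otherwise the [N]-th iterate of each basis
    vector is too small by a factor [2 ^ N], and the one of [y] is a combination
    of only [N] of them, with coefficients at most 1. *)
Lemma power_method y : nrm y = 1 ->
  exists t k, (k < N)%N /\ nrm (M y) / 2 <= nrm (M (power_unit t k)).
Proof.
move=> y1; apply: contrapT => no.
have {no}small t k : (k < N)%N -> nrm (M (power_unit t k)) < nrm (M y) / 2.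
  by move=> hk; rewrite ltNge; apply/negP => h; apply: no; exists t, k.
have N0 : (0 < N)%N.
  case: (posnP N) => // n0; have := y1; rewrite (_ : y = 0) ?nrm0; last first.
    by apply/rowP => t; have := ltn_ord t; lia.
  by move/eqP; rewrite eq_sym oner_eq0.
set mu := nrm (M y) in small.
have mu0 : 0 < mu.
  have := small (Ordinal N0) 0%N N0; have := nrm_ge0 (M (power_unit (Ordinal N0) 0)); lra.
have up t k : (k <= N)%N -> nrm (iter k M (evec R t)) <= (mu / 2) ^+ k.
  elim: k => [|k IH] hk; first by rewrite expr0 /= nrm_evec.
  rewrite iterS power_unitE MZ nrmZ ger0_norm ?nrm_ge0 // exprSr.
  by rewrite ler_pM ?nrm_ge0 ?IH ?ltW ?small //; lia.
have := power_lower N y1; rewrite -/mu.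
have -> : iter N M y = \sum_t y 0 t *: iter N M (evec R t).
  rewrite {1}[y]evec_sum; elim/big_rec2: _ => [|t u v _ <-]; last by rewrite iter_lin.
  exact: iterM0.
apply/negP; rewrite -ltNge; apply: le_lt_trans (nrm_sum _ _) _.
have abs1 t : `|y 0 t| <= 1.
  by have := cauchy_schwarz y (evec R t); rewrite dot_evec y1 nrm_evec mulr1.
apply: le_lt_trans (_ : \sum_(t < N) (mu / 2) ^+ N < _).
  apply: ler_sum => t _; rewrite nrmZ -[leRHS]mul1r.
  by rewrite ler_pM ?normr_ge0 ?nrm_ge0 ?up.
rewrite sumr_const card_ord -[_ *+ N]mulr_natl expr_div_n mulrCA gtr_pMr ?exprn_gt0 //.
rewrite ltr_pdivrMr ?exprn_gt0 // mul1r -natrX ltr_nat.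
exact: ltn_expl.
Qed.

End Power.

(** * A polynomial family of test vectors *)

Section Words.
Variables (R : realType) (N : nat).
Local Notation V := 'rV[R]_N.

Definition ev (p : nat) : V := \row_t ((t : nat) == p)%:R.

Definition read_letter (c : nat * nat * V) : nat * nat * V :=
  let: (m, p, x) := c in
  ((m %/ 3)%N,
   if (m %% 3 == 0)%N then (p.+1 %% N)%N else p,
   if (m %% 3 == 0)%N then x
   else if (m %% 3 == 1)%N then x + ev p else x - ev p).

(** The vector spelled by the first [F] base-3 digits of [m], from position [p]
    on: digit 0 moves to the next coordinate (cyclically), 1 and 2 add 1 and -1
    to the current one. *)
Definition word_vec (F p m : nat) : V := (iter F read_letter (m, p, 0)).2.

Lemma read_zeros F p x : (iter F read_letter (0%N, p, x)).2 = x.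
Proof. by elim: F p => // F IH p; rewrite iterSr [read_letter _]/= IH. Qed.

(** The digits of [c] are [`|c|] copies of 1 or of 2, written in front of those of
    [m]. *)
Lemma read_run (c : int) (m p : nat) : exists2 m' : nat,
    (m' < 3 ^ `|c|%N * m.+1)%N &
    forall x, iter `|c|%N read_letter (m', p, x) = (m, p, x + c%:~R *: ev p).
Proof.
pose e : nat := if (0 <= c)%R then 1 else 2.
pose s : R := if (0 <= c)%R then 1 else -1.
have -> : c%:~R = `|c|%N%:R * s :> R.
  rewrite /s; case: ifP => hc; first by rewrite mulr1 -[in LHS](gez0_abs hc).
  by rewrite mulrN1 -[c in LHS]opprK -[- c]ltz0_abs ?rmorphN //; lia.
elim: `|c|%N => [|k [m' lt IH]].
  by exists m; [rewrite mul1n | move=> x; rewrite mul0r scale0r addr0].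
exists (m' * 3 + e)%N; first by rewrite expnS -mulnA /e; case: ifP => _; lia.
move=> x; rewrite iterSr /=.
have he : (e < 3)%N by rewrite /e; case: ifP.
rewrite divnMDl // divn_small // addn0 modnMDl modn_small //.
have -> : (e == 0)%N = false by rewrite /e; case: ifP.
rewrite IH; congr (_, _, _); rewrite -natr1 mulrDl mul1r scalerDl.
rewrite /e /s; case: (0 <= c)%R => /=; rewrite ?scale1r ?scaleN1r -?addrA; congr (_ + _).
  by rewrite addrC.
by rewrite addrC.
Qed.

(** One letter per unit of [c] and one move after each coordinate; once the digits
    are used up, [m] is 0 and the remaining rounds only move. *)
Lemma read_word (c : seq int) p F : (p < N)%N ->
    (\sum_(k <- c) (`|k|%N + 1) <= F)%N ->
  exists2 m : nat, (m < 3 ^ \sum_(k <- c) (`|k|%N + 1))%N &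
    forall x, (iter F read_letter (m, p, x)).2 =
      x + \sum_(j < size c) (nth 0 c j)%:~R *: ev ((p + j) %% N)%N.
Proof.
elim: c p F => [|k c IH] p F hp.
  rewrite big_nil => _; exists 0%N => // x.
  by rewrite big_ord0 addr0 read_zeros.
rewrite big_cons => hF.
have N0 : (0 < N)%N by lia.
have [|m lt hm] := IH (p.+1 %% N)%N (F - (`|k|%N + 1))%N (ltn_pmod _ N0); first by lia.
have [m' lt' hm'] := read_run k (m * 3) p.
exists m'.
  apply: leq_trans lt' _; rewrite -addnA expnD leq_mul2l expn_eq0 /=.
  by rewrite expnD expn1; lia.
move=> x.
have -> : F = (F - (`|k|%N + 1) + (`|k|%N + 1))%N by lia.
rewrite iterD [in X in iter _ _ X]addnC iterD hm' /= mulnK // modnMl /= hm.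
rewrite big_ord_recl /= addn0 (modn_small hp) -addrA; congr (_ + (_ + _)).
apply: eq_bigr => j _ /=; rewrite /bump /= modnDml; congr (_ *: ev (_ %% _)%N); lia.
Qed.

End Words.

Section Rounding.
Variables (R : realType) (b : nat).
Hypothesis b_gt0 : (0 < b)%N.
Implicit Type a : 'rV[R]_b.

Lemma sum_abs_le a : \sum_j `|a 0 j| <= Num.sqrt b%:R * nrm a.
Proof.
have := cauchy_schwarz (const_mx 1 : 'rV[R]_b) (\row_j `|a 0 j|).
have -> : nrm (const_mx 1 : 'rV[R]_b) = Num.sqrt b%:R.
  rewrite /nrm /dot; under eq_bigr => j _ do rewrite !mxE mulr1.
  by rewrite sumr_const card_ord.
have -> : nrm (\row_j `|a 0 j|) = nrm a.
  rewrite /nrm /dot; congr Num.sqrt; apply: eq_bigr => j _.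
  by rewrite !mxE -expr2 real_normK ?num_real // expr2.
apply: le_trans; apply: le_trans (ler_norm _); rewrite /dot le_eqVlt; apply/orP; left.
by apply/eqP/eq_bigr => j _; rewrite !mxE mul1r.
Qed.

(** Scale [a] to length [4 sqrt b] and round each entry toward 0: the rounding
    error has length at most [sqrt b], which costs a quarter of the inner
    product. *)
Lemma integer_direction a : a != 0 -> exists c : 'I_b -> int,
  [/\ (\sum_j `|c j|%N <= 4 * b)%N,
      nrm (\row_j (c j)%:~R : 'rV[R]_b) > 0 &
      3 / 4 * nrm a * nrm (\row_j (c j)%:~R : 'rV[R]_b)
        <= dot a (\row_j (c j)%:~R)].
Proof.
move=> a0; set T := nrm a.
have T0 : 0 < T by rewrite lt_def nrm_ge0 andbT; apply: contra a0 => /eqP /nrm0_eq0 ->.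
set r := Num.sqrt (b%:R : R).
have r0 : 0 < r by rewrite sqrtr_gt0 ltr0n.
have rr : r * r = b%:R by rewrite -expr2 sqr_sqrtr ?ler0n.
pose w := 4 * r / T.
have w0 : 0 < w by rewrite divr_gt0 ?mulr_gt0.
have wT : w * T = 4 * r by rewrite /w mulfVK // gt_eqF.
pose k j := Num.trunc (w * `|a 0 j|).
have wa j : 0 <= w * `|a 0 j| by rewrite mulr_ge0 // ltW.
have k1 j : (k j)%:R <= w * `|a 0 j| by rewrite truncn_le.
have k2 j : w * `|a 0 j| - 1 <= (k j)%:R by have := truncnS_gt (w * `|a 0 j|); rewrite -natr1 -/(k j); lra.
pose c j : int := if (0 <= a 0 j) then (k j)%:Z else - (k j)%:Z.
have cabs j : `|c j|%N = k j by rewrite /c; case: ifP; lia.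
have cR j : (c j)%:~R = (if 0 <= a 0 j then 1 else -1) * (k j)%:R :> R.
  by rewrite /c; case: ifP => _; rewrite ?mul1r ?mulN1r ?rmorphN.
have S1 := sum_abs_le a; rewrite -/r -/T in S1.
have dge : 3 * r * T <= dot a (\row_j (c j)%:~R).
  have -> : dot a (\row_j (c j)%:~R) = \sum_j `|a 0 j| * (k j)%:R.
    apply: eq_bigr => j _; rewrite mxE cR mulrA; congr (_ * _).
    case: ifP => hj; first by rewrite mulr1 ger0_norm.
    by rewrite mulrN1 ltr0_norm // ltNge hj.
  apply: le_trans (_ : \sum_j `|a 0 j| * (w * `|a 0 j| - 1) <= _); last first.
    by apply: ler_sum => j _; rewrite ler_wpM2l.
  have -> : \sum_j `|a 0 j| * (w * `|a 0 j| - 1) = w * T ^+ 2 - \sum_j `|a 0 j|.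
    rewrite nrm_sqr /dot mulr_sumr -sumrB; apply: eq_bigr => j _.
    by rewrite -expr2 -(real_normK (num_real (a 0 j))); ring.
  by rewrite expr2 mulrA wT; lra.
have cle : nrm (\row_j (c j)%:~R : 'rV[R]_b) <= 4 * r.
  have r40 : 0 <= 4 * r by rewrite mulr_ge0 // ltW.
  rewrite -(ler_pXn2r (n := 2)) ?nnegrE ?nrm_ge0 // nrm_sqr.
  rewrite -wT exprMn nrm_sqr /dot mulr_sumr; apply: ler_sum => j _.
  rewrite mxE -expr2 -(real_normK (num_real (_%:~R))) cR normrM.
  have -> : `|if 0 <= a 0 j then 1 else -1 : R| = 1 by case: ifP; rewrite ?normrN1 ?normr1.
  rewrite mul1r normr_nat -expr2 -[a 0 j ^+ 2](real_normK (num_real _)) -exprMn.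
  by rewrite ler_pXn2r ?nnegrE ?ler0n.
exists c; split.
- rewrite -(ler_nat R) natr_sum (eq_bigr (fun j => (k j)%:R)); last by move=> j _; rewrite cabs.
  apply: le_trans (_ : \sum_j w * `|a 0 j| <= _); first exact: ler_sum.
  rewrite -mulr_sumr natrM -rr; apply: le_trans (_ : w * (r * T) <= _).
    by rewrite ler_wpM2l // ltW.
  by rewrite mulrCA wT; lra.
- rewrite lt_def nrm_ge0 andbT; apply/negP => /eqP /nrm0_eq0 c0.
  move: dge; rewrite c0 dotC (lin0 (dot_lin a)) leNgt.
  by rewrite mulr_gt0 ?mulr_gt0.
- apply: le_trans dge.
  have : T * nrm (\row_j (c j)%:~R : 'rV[R]_b) <= T * (4 * r) by rewrite ler_wpM2l // ltW.
  lra.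
Qed.

End Rounding.

Section Net.
Variables (R : realType) (N : nat).
Local Notation V := 'rV[R]_N.

Lemma cyclic_shift_sum (F : nat -> R) j :
  \sum_(p < N) F ((p + j) %% N)%N = \sum_(p < N) F p.
Proof.
elim: j => [|j IH].
  by apply: eq_bigr => p _; rewrite addn0 modn_small.
rewrite -[RHS]IH [RHS](reindex_inj (@ordS_inj N)) /=.
by apply: eq_bigr => p _; rewrite modnDml addSnnS.
Qed.

(** Average over the starting point: each coordinate lies in exactly [b] of the [N]
    cyclic windows of length [b]. *)
Lemma heavy_window (a : V) b : (0 < N)%N -> exists2 p, (p < N)%N &
  b%:R / N%:R * nrm a ^+ 2 <=
    \sum_(j < b) \sum_(t < N | t == ((p + j) %% N)%N :> nat) a 0 t ^+ 2.
Proof.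
move=> N0; apply: contrapT => no.
pose F p := \sum_(t < N | t == p :> nat) a 0 t ^+ 2.
have {no}small p : (p < N)%N -> \sum_(j < b) F ((p + j) %% N)%N < b%:R / N%:R * nrm a ^+ 2.
  by move=> hp; rewrite ltNge; apply/negP => h; apply: no; exists p.
have : \sum_(p < N) \sum_(j < b) F ((p + j) %% N)%N < \sum_(p < N) (b%:R / N%:R * nrm a ^+ 2).
  apply: ltr_sum => [|p _]; last exact: small.
  by apply/hasP; exists (Ordinal N0) => //; rewrite mem_index_enum.
rewrite exchange_big /= sumr_const card_ord -[_ *+ N]mulr_natl.
under eq_bigr => j _ do rewrite cyclic_shift_sum.
rewrite sumr_const card_ord -[_ *+ b]mulr_natl.
have -> : \sum_(p < N) F p = nrm a ^+ 2.
  rewrite nrm_sqr; apply: eq_bigr => p _; rewrite /F -expr2.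
  by rewrite (big_pred1 p) // => t; rewrite /= -val_eqE.
have -> : N%:R * (b%:R / N%:R * nrm a ^+ 2) = b%:R * nrm a ^+ 2.
  by field; rewrite pnatr_eq0 -lt0n.
by rewrite ltxx.
Qed.

(** Round [a] inside its heaviest window.  The rounding loses a factor 3/4 and the
    restriction to the window a factor [sqrt (b / N)]; the word consists of at most
    [4 b] unit steps and [b] moves. *)
Lemma word_net (a : V) b B : (0 < b <= N)%N -> (3 ^ (5 * b) <= B)%N ->
  exists p m, [/\ (p < N)%N, (m < B)%N &
    3 / 4 * Num.sqrt (b%:R / N%:R) * nrm a <= `|dot a (unit (word_vec R N B p m))|].
Proof.
case/andP=> b0 bN hB; have N0 : (0 < N)%N by lia.
have [->|a0] := eqVneq a 0.
  exists 0%N, 0%N; split => //; first by apply: leq_trans hB; rewrite expn_gt0.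
  by rewrite nrm0 mulr0 normr_ge0.
have [p hp hw] := heavy_window a b N0.
pose pos (j : 'I_b) : 'I_N := Ordinal (ltn_pmod (p + j) N0).
have pos_inj : injective pos.
  move=> i j /(congr1 val) /= /eqP; rewrite eqn_modDl !modn_small ?(leq_trans (ltn_ord _)) //.
  by move=> /eqP h; apply: val_inj.
pose win : 'rV[R]_b := \row_j a 0 (pos j).
have nw : b%:R / N%:R * nrm a ^+ 2 <= nrm win ^+ 2.
  apply: le_trans hw _; rewrite nrm_sqr; apply: ler_sum => j _.
  by rewrite (big_pred1 (pos j)) ?mxE ?expr2 // => t; rewrite /= -val_eqE.
have na : 0 < nrm a by rewrite lt_def nrm_ge0 andbT; apply: contra a0 => /eqP /nrm0_eq0 ->.
have win0 : win != 0.
  apply/negP => /eqP w0; move: nw; rewrite w0 nrm0 expr0n /= leNgt.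
  by rewrite mulr_gt0 ?exprn_gt0 // divr_gt0 ?ltr0n.
have [c [c1 c2 c3]] := integer_direction b0 win0.
pose cs := [seq c j | j : 'I_b].
have szc : size cs = b by rewrite size_image card_ord.
have sumc : (\sum_(k <- cs) (`|k|%N + 1) <= 5 * b)%N.
  have -> : (\sum_(k <- cs) (`|k|%N + 1) = \sum_(j < b) (`|c j|%N + 1))%N.
    by rewrite big_image; apply: eq_bigl.
  rewrite big_split /= sum1_card card_ord (mulnDl 4 1) mul1n.
  by rewrite leq_add2r.
have hF : (\sum_(k <- cs) (`|k|%N + 1) <= B)%N.
  apply: leq_trans sumc _; apply: leq_trans hB; apply: ltnW; exact: ltn_expl.
have [m lt hm] := read_word R hp hF.
exists p, m; split => //.
  by apply: leq_trans lt _; apply: leq_trans hB; rewrite leq_exp2l.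
have Ex : word_vec R N B p m = \sum_(j < b) (c j)%:~R *: evec R (pos j).
  rewrite /word_vec hm add0r szc; apply: eq_bigr => j _; congr (_ *: _).
    congr intr; rewrite (nth_map j) ?size_enum_ord //; congr c.
    by apply: val_inj; rewrite /= nth_enum_ord.
  by apply/rowP => t; rewrite !mxE eqxx /= -val_eqE.
rewrite Ex; set x := \sum_(j < b) _; set cr := \row_j (c j)%:~R in c2 c3.
have dx y : dot x y = \sum_j (c j)%:~R * y 0 (pos j).
  rewrite (lin_sum _ _ (dot_lin y)).
  by apply: eq_bigr => j _; rewrite dotC dot_evec.
have xpos j : x 0 (pos j) = (c j)%:~R.
  rewrite summxE (bigD1 j) //= big1 ?addr0 => [|i ij]; rewrite !mxE eqxx /=.
    by rewrite eqxx mulr1.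
  by rewrite (inj_eq pos_inj) eq_sym (negbTE ij) mulr0.
have nx : nrm x = nrm cr.
  congr Num.sqrt; rewrite dx; apply: eq_bigr => j _.
  by rewrite xpos mxE.
have da : dot a x = dot win cr.
  by rewrite dotC dx; apply: eq_bigr => j _; rewrite !mxE mulrC.
rewrite dotC (linZ _ _ (dot_lin a)) dotC da nx normrM.
rewrite ger0_norm ?invr_ge0 ?nrm_ge0 // [leRHS]mulrC ler_pdivlMr //.
apply: le_trans (ler_norm _); apply: le_trans c3.
rewrite ler_wpM2r ?nrm_ge0 // -mulrA; apply: ler_wpM2l; first lra.
rewrite -(ler_pXn2r (n := 2)) ?nnegrE ?mulr_ge0 ?sqrtr_ge0 ?nrm_ge0 // exprMn.
by rewrite sqr_sqrtr // divr_ge0 ?ler0n.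
Qed.

End Net.

(** * From a form to a good point *)

Section Search.
Variables (R : realType) (N d : nat).
Local Notation V := 'rV[R]_N.
Variable q : V -> R.
Hypothesis q_form : dform d.+2 q.
Implicit Types (xs : seq V) (x y v : V).

(** The multilinear form with [d] arguments fixed is a symmetric bilinear form in
    the other two; this is its matrix, applied to [v]. *)
Definition hess xs v : V := \row_t pol q (xs ++ [:: v; evec R t]) 0.

Lemma hess_lin xs a x y : size xs = d ->
  hess xs (a *: x + y) = a *: hess xs x + hess xs y.
Proof.
move=> sz; apply/rowP => t; rewrite !mxE.
by rewrite (dform_pol_lin _ _ _ q_form) //= sz addn1.
Qed.

Lemma hess_dot xs x y : size xs = d -> dot (hess xs x) y = pol q (xs ++ [:: x; y]) 0.
Proof.
move=> sz; pose f z := pol q (xs ++ [:: x; z]) 0.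
have lf : lin f.
  move=> a z1 z2; rewrite /f -!(cat_rcons x) (dform_pol_lin _ _ _ q_form) //=.
  by rewrite size_rcons sz addn0.
by rewrite -/(f y) (lin_dot y lf) dotC.
Qed.

Lemma hess_sym xs x y : size xs = d -> dot (hess xs x) y = dot x (hess xs y).
Proof. by move=> sz; rewrite hess_dot // pol_swap -hess_dot // dotC. Qed.

Lemma signed_sums_nrm xs z y : all (fun x => nrm x <= 1) xs ->
  y \in signed_sums xs z -> nrm y <= nrm z + (size xs)%:R.
Proof.
elim: xs z => [|x xs IH] z /=; first by rewrite inE => _ /eqP ->; rewrite addr0.
case/andP=> hx hxs; rewrite mem_cat => /orP[] h; apply: le_trans (IH _ hxs h) _.
  have := nrm_add z x; rewrite -[(size xs).+1%:R]natr1; lra.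
have := nrm_add z (- x); rewrite nrmN -[(size xs).+1%:R]natr1; lra.
Qed.

Variables (B : nat) (beta : R).
Hypothesis beta_gt0 : 0 < beta.

Definition test_vec (pm : nat * nat) : V := unit (word_vec R N B pm.1 pm.2).

Hypothesis net : forall a : V, exists p m, [/\ (p < N)%N, (m < B)%N &
  beta * nrm a <= `|dot a (test_vec (p, m))|].

Definition in_range (pm : nat * nat) := (pm.1 < N)%N && (pm.2 < B)%N.

(** One test vector at a time replaces a copy of [y]; each replacement costs a
    factor [beta]. *)
Lemma substitute_test_vecs y j : nrm y = 1 -> (j <= d)%N ->
  exists pms : seq (nat * nat), [/\ size pms = j, all in_range pms &
    beta ^+ j * `|pol q (nseq d.+2 y) 0| <=
      `|pol q (map test_vec pms ++ nseq (d.+2 - j) y) 0|].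
Proof.
move=> y1; elim: j => [|j IH] hj.
  by exists [::]; split; rewrite // mul1r.
have [|pms [sz rg h]] := IH; first by lia.
pose xs := map test_vec pms.
pose f z := pol q (xs ++ z :: nseq (d.+1 - j) y) 0.
have lf : lin f.
  move=> a z1 z2; rewrite /f (dform_pol_lin _ _ _ q_form) //.
  by rewrite size_map size_nseq sz; lia.
have [p [m [hp hm hpm]]] := net (\row_t f (evec R t)).
exists (rcons pms (p, m)); split.
- by rewrite size_rcons sz.
- by rewrite all_rcons rg andbT /in_range hp hm.
rewrite map_rcons cat_rcons subSS -/xs.
have -> : pol q (xs ++ test_vec (p, m) :: nseq (d.+1 - j) y) 0 = f (test_vec (p, m)) by [].
rewrite (lin_dot (test_vec (p, m)) lf) dotC; apply: le_trans hpm.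
rewrite exprS -mulrA ler_wpM2l ?(ltW beta_gt0) //; apply: le_trans h _.
rewrite -/xs.
have -> : nseq (d.+2 - j) y = y :: nseq (d.+1 - j) y by rewrite subSn //; lia.
exact: (lin_norm_ge lf y1).
Qed.

Definition power_vec xs t k : V := power_unit (hess xs) t k.

(** The test vectors and the pair found by the power method make the iterated
    difference large, hence [q] is large at one of its signed sums.  Such a sum of
    [d + 2] vectors of norm at most 1 has norm at most [d + 2], which is what
    normalising it costs, to the power [d + 2]. *)
Lemma search_point y : nrm y = 1 -> q y != 0 ->
  exists pms (t : 'I_N) k z,
    [/\ size pms = d, all in_range pms, (k < N)%N, z != 0 &
     let xs := map test_vec pms in
     z \in signed_sums (xs ++ [:: power_vec xs t k; unit (hess xs (power_vec xs t k))]) 0] /\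
    (d.+2)`!%:R / (d.+2)%:R ^+ d.+2 * (beta ^+ d / 2) * `|q y| <= `|q (unit z)|.
Proof.
move=> y1 qy.
have [pms [sz rg h]] := substitute_test_vecs y1 (leqnn d).
set xs := map test_vec pms in h.
have sx : size xs = d by rewrite size_map.
have [t [k [hk hp]]] := power_method (fun a x y => hess_lin a x y sx)
  (fun x y => hess_sym x y sx) y1.
set v := power_unit _ t k in hp.
have hy : `|pol q (xs ++ nseq (d.+2 - d) y) 0| <= nrm (hess xs y).
  have -> : (d.+2 - d)%N = 2%N by lia.
  by rewrite -hess_dot //; have := cauchy_schwarz (hess xs y) y; rewrite y1 mulr1.
have hw : pol q (xs ++ [:: v; unit (hess xs v)]) 0 = nrm (hess xs v).
  rewrite -hess_dot // dotC (linZ _ _ (dot_lin _)) -nrm_sqr.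
  have [->|n0] := eqVneq (nrm (hess xs v)) 0; first by rewrite expr0n mulr0.
  by rewrite expr2 mulrA mulVf ?mul1r.
have D0 : 0 < (d.+2)%:R ^+ d.+2 :> R by rewrite exprn_gt0 ?ltr0n.
pose L := (d.+2)`!%:R * (beta ^+ d / 2) * `|q y|.
have L0 : 0 < L.
  by rewrite !mulr_gt0 ?exprn_gt0 ?normr_gt0 // ?ltr0n ?fact_gt0 // invr_gt0.
have [z hz qz] : exists2 z, z \in signed_sums (xs ++ [:: v; unit (hess xs v)]) 0 & L <= `|q z|.
  apply: contrapT => no.
  have := @pol_lt _ _ q (xs ++ [:: v; unit (hess xs v)]) 0 L.
  rewrite hw size_cat sx addn2 ger0_norm ?nrm_ge0 // ltNge.
  suff -> : 2 ^+ d.+2 * L <= nrm (hess xs v).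
    move=> H; suff: ~~ true by [].
    by apply: H => z hz; rewrite ltNge; apply/negP => hl; apply: no; exists z.
  apply: le_trans hp; apply: le_trans (_ : (beta ^+ d * `|pol q (nseq d.+2 y) 0|) / 2 <= _).
    rewrite (dform_pol_diag _ q_form) normrM [`|_ * _%:R|]ger0_norm; last first.
      by rewrite mulr_ge0 ?exprn_ge0 ?ler0n.
    rewrite /L; move: (2 ^+ d.+2) (_ `!%:R) (beta ^+ d) `|q y| => u1 u2 u3 u4.
    by rewrite le_eqVlt; apply/orP; left; apply/eqP; ring.
  by rewrite ler_pM2r ?invr_gt0 //; apply: le_trans h hy.
have z0 : z != 0.
  apply/negP => /eqP z0; move: qz; rewrite z0 leNgt.
  have -> : q 0 = 0 by have := dformZ 0 0 q_form; rewrite scaler0 expr0n mul0r.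
  by rewrite normr0 L0.
exists pms, t, k, z; split; first by split.
have nz : nrm z <= (d.+2)%:R.
  have := signed_sums_nrm _ hz; rewrite nrm0 add0r size_cat sx addn2; apply.
  rewrite all_cat /= nrm_unit_le andbT; apply/andP; split.
    by apply/allP => _ /mapP [pm _ ->]; exact: nrm_unit_le.
  rewrite /v; case: (k) => [|k'] /=; last by rewrite nrm_unit_le.
  by rewrite nrm_evec lexx.
have -> : (d.+2)`!%:R / (d.+2)%:R ^+ d.+2 * (beta ^+ d / 2) * `|q y| = L / (d.+2)%:R ^+ d.+2.
  by rewrite /L; ring.
rewrite ler_pdivrMr //; apply: le_trans qz _.
rewrite -{1}[z]unitK (dformZ _ _ q_form) normrM mulrC ler_wpM2l //.
by rewrite ger0_norm ?exprn_ge0 ?nrm_ge0 // lerXn2r ?nnegrE ?nrm_ge0 ?ler0n.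
Qed.

End Search.

(** * The size of the test family *)

(** With [N = 2 n], a window of length [gamma ln N + 1] has [3 ^ (5 b)] words, at most
    [243 N ^ (5 gamma ln 3)], and [ln 3 <= 2]. *)
Lemma test_family_size (R : realType) (gamma : R) (n b E : nat) :
  let N := (2 * n)%N in
  0 < gamma -> (0 < n)%N -> 10 * gamma <= E%:R ->
  b%:R <= gamma * ln N%:R + 1 ->
  (3 ^ (5 * b) <= 243 * N ^ E)%N.
Proof.
move=> N g0 n0 hE hb.
have N2 : 2 <= N%:R :> R by rewrite ler_nat /N; lia.
have lN : 0 < ln (N%:R : R) by rewrite ln_gt0 //; lra.
case: b hb => [|b] hb; first by rewrite muln_gt0 expn_gt0; lia.
have hb' : b%:R <= gamma * ln N%:R by move: hb; rewrite -natr1; lra.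
rewrite mulnS expnD leq_mul2l /=.
rewrite -(ler_nat R) !natrX -ler_ln ?posrE ?exprn_gt0 ?ltr0n //; last by rewrite /N; lia.
rewrite !lnXn ?ltr0n //; last by rewrite /N; lia.
have l3 : ln (3 : R) <= 2 by have := @le_ln1Dx R 2; rewrite (_ : 1 + 2 = 3); [apply; lra | lra].
rewrite -[leLHS]mulr_natl -[leRHS]mulr_natl.
apply: le_trans (_ : 10 * gamma * ln N%:R <= _); last by rewrite ler_wpM2r // ltW.
rewrite natrM; apply: le_trans (_ : 5 * b%:R * 2 <= _).
  by rewrite ler_wpM2l // mulr_ge0.
lra.
Qed.

(** The window length [trunc (gamma ln N) + 1] (or all of [N] if that is
    shorter) is what the ratio asks for, up to the factor 2 that the constant in
    the ratio leaves. *)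
Lemma test_family_quality (R : realType) (gamma : R) (n E : nat) :
  let N := (2 * n)%N in let B := (243 * N ^ E)%N in
  0 < gamma -> (0 < n)%N -> 10 * gamma <= E%:R -> gamma * ln (N%:R : R) / N%:R < 1 ->
  forall a : 'rV[R]_(n + n), exists p m, [/\ (p < n + n)%N, (m < B)%N &
    Num.sqrt (gamma * ln N%:R / N%:R / 2) * nrm a
      <= `|dot a (test_vec R (n + n) B (p, m))|].
Proof.
move=> N B g0 n0 hE hr a.
have NN : (n + n = N)%N by rewrite /N; lia.
have N2 : 2 <= N%:R :> R by rewrite ler_nat /N; lia.
have lN : 0 < ln (N%:R : R) by rewrite ln_gt0 //; lra.
have gl : 0 <= gamma * ln (N%:R : R) by rewrite mulr_ge0 // ltW.
pose b0 := (Num.trunc (gamma * ln (N%:R : R))).+1.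
pose b := minn b0 N.
have hb0 : b0%:R <= gamma * ln (N%:R : R) + 1.
  by rewrite /b0 -natr1; have := truncn_le (gamma * ln (N%:R : R)); rewrite gl => h; lra.
have hb : b%:R <= gamma * ln (N%:R : R) + 1.
  by apply: le_trans hb0; rewrite ler_nat geq_minl.
have b_rg : (0 < b <= n + n)%N by rewrite NN /b geq_minr andbT leq_min /N; lia.
have [p [m [hp hm h]]] := word_net a b_rg (test_family_size g0 n0 hE hb).
exists p, m; split => //; apply: le_trans h.
rewrite ler_wpM2r ?nrm_ge0 // NN.
rewrite -(ler_pXn2r (n := 2)) ?nnegrE ?mulr_ge0 ?sqrtr_ge0 //; last by lra.
have Np : 0 < N%:R :> R by lra.
have bN0 : 0 <= b%:R / N%:R :> R by rewrite divr_ge0 // ler0n.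
rewrite exprMn !sqr_sqrtr //; last by rewrite !mulr_ge0 ?invr_ge0 // ltW.
have [e|e] : b = b0 \/ b = N by rewrite /b /minn; case: ifP; [left|right].
  have hb1 : gamma * ln (N%:R : R) / N%:R <= b%:R / N%:R.
    by rewrite ler_pM2r ?invr_gt0 // e ltW // truncnS_gt.
  by nra.
have -> : b%:R / N%:R = 1 :> R by rewrite e divff // gt_eqF.
by nra.
Qed.

(** * The program *)

Definition vn := 0%N.
Definition vN := 1%N.
Definition vB := 2%N.
Definition vt := 3%N.
Definition vaddr := 4%N.
Definition vdig (t : nat) := (5 + t)%N.

(** Only [vn], [vN] and [vB], which hold n, 2n and the number of test words, serve
    as loop bounds. *)
Definition bound_var : pred nat := fun x => (x <= 2)%N.

Definition cell (a i : nat) : rexp := RGet a (NConst i).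

Definition vloop (b a : nat) (e : rexp) : prog := PFor vt b (PR a (NVar vt) e).

Section Programs.
Variable d : nat.

(** The arrays below [arr0] hold the coefficients.  Above them come the scalars
    [aS], the registers of the evaluation, and the vectors; every part of the
    program writes to an interval of arrays, apart from the vectors [aX] of the
    arguments. *)
Definition arr0 := d.+1.*2.
Definition aS := arr0.
Definition aP := arr0.+1.
Definition aQ := arr0.+2.
Definition aU := arr0.+3.
Definition aBest := arr0.+4.
Definition aZ (j : nat) := (arr0 + 5 + j)%N.
Definition aW := (arr0 + 6 + d)%N.
Definition aX (j : nat) := (arr0 + 7 + d + j)%N.

Definition vpos := (5 + d)%N.
Definition vm := (6 + d)%N.
Definition vq := (7 + d)%N.
Definition vc := (8 + d)%N.
Definition vc2 := (9 + d)%N.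
Definition vi := (10 + d)%N.
Definition vk := (11 + d)%N.
Definition vj := (12 + d)%N.
Definition vP (j : nat) := (13 + d + 2 * j)%N.
Definition vM (j : nat) := (14 + d + 2 * j)%N.

Definition sPol := 0%N.
Definition sVal := 1%N.
Definition sSqr := 2%N.
Definition sBest := 3%N.
Definition sShift := 4%N.

Definition sc (i : nat) := cell aS i.
Definition set_sc (i : nat) (e : rexp) := PR aS (NConst i) e.

(** The registers [aP] and [aQ] at index [t] hold the real and imaginary parts of
    the product of the first [t] factors of a monomial; the addresses of the
    coefficients of all monomials are visited in increasing order. *)
Fixpoint eval_monomials (k z r t : nat) : prog :=
  if r is r'.+1 then
    let x := RGet z (NVar (vdig t)) in
    let y := RGet z (NAdd (NVar vn) (NVar (vdig t))) in
    let P := cell aP t in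
    let Q := cell aQ t in
    PFor (vdig t) vn
      (PSeq (PR aP (NConst t.+1)
               (if (t < k)%N then RAdd (RMul P x) (RMul Q y)
                else RSub (RMul P x) (RMul Q y)))
      (PSeq (PR aQ (NConst t.+1)
               (if (t < k)%N then RSub (RMul Q x) (RMul P y)
                else RAdd (RMul Q x) (RMul P y)))
            (eval_monomials k z r' t.+1)))
  else
    PSeq (set_sc sVal (RAdd (sc sVal)
            (RSub (RMul (RGet k.*2 (NVar vaddr)) (cell aP t))
                  (RMul (RGet k.*2.+1 (NVar vaddr)) (cell aQ t)))))
         (PN vaddr (NAdd (NVar vaddr) (NConst 1))).

Definition eval_block (k z : nat) : prog :=
  PSeq (PR aP (NConst 0) (RConst 1))
  (PSeq (PR aQ (NConst 0) (RConst 0))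
  (PSeq (PN vaddr (NConst 0)) (eval_monomials k z d 0))).

Fixpoint eval_form (K z : nat) : prog :=
  if K is K'.+1 then PSeq (eval_form K' z) (eval_block K' z)
  else set_sc sVal (RConst 0).

Definition sqr_norm (z : nat) : prog :=
  PSeq (set_sc sSqr (RConst 0))
       (PFor vt vN (set_sc sSqr (RAdd (sc sSqr)
          (RMul (RGet z (NVar vt)) (RGet z (NVar vt)))))).

Fixpoint rpow (e : rexp) (h : nat) : rexp :=
  if h is h'.+1 then RMul e (rpow e h') else RConst 1.

Definition eval_shifted (z : nat) : prog :=
  PSeq (eval_form d.+1 z)
  (PSeq (sqr_norm z)
        (set_sc sVal (RSub (sc sVal) (RMul (sc sShift) (rpow (sc sSqr) d./2))))).

Definition normalise (b : nat) : prog :=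
  PSeq (sqr_norm b)
  (PSeq (set_sc sSqr (RSqrt (sc sSqr)))
        (vloop vN b (RDiv (RGet b (NVar vt)) (sc sSqr)))).

Definition copy (bound a b : nat) : prog := vloop bound a (RGet b (NVar vt)).

(** A signed sum [z] contributes [q z] to the iterated difference, with the sign
    [neg], and is a candidate for the output after normalisation. *)
Definition leaf (z : nat) (neg : bool) : prog :=
  PSeq (eval_shifted z)
  (PSeq (set_sc sPol (if neg then RSub (sc sPol) (sc sVal) else RAdd (sc sPol) (sc sVal)))
  (PSeq (sqr_norm z)
  (PIf (RLe (sc sSqr) (RConst 0)) PSkip
    (PSeq (copy vN aU z)
    (PSeq (normalise aU)
    (PSeq (eval_shifted aU)
    (PIf (RLe (sc sVal) (sc sBest)) PSkip
      (PSeq (set_sc sBest (sc sVal)) (copy vN aBest aU))))))))).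

(** [aZ j] is the signed sum of the first [j] arguments; the recursion is unrolled
    into [2 ^ r] leaves. *)
Fixpoint polar_from (r j : nat) (neg : bool) : prog :=
  if r is r'.+1 then
    PSeq (vloop vN (aZ j.+1) (RAdd (RGet (aZ j) (NVar vt)) (RGet (aX j) (NVar vt))))
    (PSeq (polar_from r' j.+1 neg)
    (PSeq (vloop vN (aZ j.+1) (RSub (RGet (aZ j) (NVar vt)) (RGet (aX j) (NVar vt))))
          (polar_from r' j.+1 (~~ neg))))
  else leaf (aZ j) neg.

Definition polar : prog :=
  PSeq (set_sc sPol (RConst 0))
  (PSeq (vloop vN (aZ 0) (RConst 0)) (polar_from d 0 false)).

(** There is no division of naturals: [vm] is divided by 3 by repeated subtraction,
    in as many rounds as are always enough. *)
Definition letter (x : nat) : prog :=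
  PSeq (PN vq (NConst 0))
  (PSeq (PFor vc2 vB
    (PIf (NLe (NConst 3) (NVar vm))
       (PSeq (PN vm (NSub (NVar vm) (NConst 3))) (PN vq (NAdd (NVar vq) (NConst 1))))
       PSkip))
  (PSeq (PIf (NLe (NConst 1) (NVar vm))
       (PIf (NLe (NConst 2) (NVar vm))
          (PR x (NVar vpos) (RSub (RGet x (NVar vpos)) (RConst 1)))
          (PR x (NVar vpos) (RAdd (RGet x (NVar vpos)) (RConst 1))))
       (PSeq (PN vpos (NAdd (NVar vpos) (NConst 1)))
             (PIf (NLe (NVar vN) (NVar vpos)) (PN vpos (NConst 0)) PSkip)))
    (PN vm (NVar vq)))).

Definition decode (j : nat) : prog :=
  PSeq (vloop vN (aX j) (RConst 0))
  (PSeq (PN vpos (NVar (vP j)))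
  (PSeq (PN vm (NVar (vM j)))
  (PSeq (PFor vc vB (letter (aX j))) (normalise (aX j))))).

Definition basis_vec (a x : nat) : prog :=
  PSeq (vloop vN a (RConst 0)) (PR a (NVar x) (RConst 1)).

(** The entries of the matrix are iterated differences along basis vectors, so the
    program needs nothing but values of the form. *)
Definition hess_apply : prog :=
  PSeq (PFor vj vN
    (PSeq (basis_vec (aX d.-1) vj)
    (PSeq polar (PR aW (NVar vj) (sc sPol)))))
  (normalise aW).

(** The call of [polar] in each round is there for its candidates. *)
Definition power : prog :=
  PFor vi vN
    (PSeq (basis_vec (aX d.-2) vi)
          (PFor vk vN
             (PSeq hess_apply
             (PSeq (copy vN (aX d.-1) aW)
             (PSeq polar (copy vN (aX d.-2) aW)))))).

Fixpoint search (r j : nat) : prog :=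
  if r is r'.+1 then
    PFor (vP j) vN (PFor (vM j) vB (PSeq (decode j) (search r' j.+1)))
  else power.

(** The first candidate is a basis vector.  For even degree its value becomes the
    shift, so that the shifted form vanishes there and max >= 0 >= min for it. *)
Definition initial : prog :=
  PSeq (PR aBest (NConst 0) (RConst 1))
  (PSeq (eval_shifted aBest)
  (PSeq (if odd d then PSkip else set_sc sShift (sc sVal))
  (PSeq (eval_shifted aBest) (set_sc sBest (sc sVal))))).

Definition write_output : prog :=
  PSeq (copy vn 0 aBest)
       (vloop vn 1 (RGet aBest (NAdd (NVar vn) (NVar vt)))).

Definition main : prog :=
  PSeq initial (PSeq (search d.-2 0) write_output).

(** Multiplication by [2 n] is repeated addition. *)
Fixpoint grow (E : nat) : prog :=
  if E is E'.+1 then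
    PSeq (grow E')
    (PSeq (PN vaddr (NConst 0))
    (PSeq (PFor vt vN (PN vaddr (NAdd (NVar vaddr) (NVar vB))))
          (PN vB (NVar vaddr))))
  else PN vB (NConst 243).

End Programs.

(** * Variables and arrays written *)

Lemma notin_all (x : nat) (s : seq nat) : (x \notin s) = all (fun y => y != x) s.
Proof. by elim: s => //= y s <-; rewrite in_cons negb_or eq_sym. Qed.

Section Bounded.
Variable d : nat.

Lemma eval_monomials_nwrites k z r t :
  all (fun x => (x == vaddr) || (vdig t <= x)%N && (x < vdig (t + r))%N) (nwrites (eval_monomials d k z r t)).
Proof.
elim: r t => [|r IH] t //=.
apply/andP; split; first by rewrite /vdig; lia.
by apply: sub_all (IH t.+1) => x; rewrite /vdig /vaddr; lia.
Qed.

Lemma eval_monomials_bounded k z r t : bounded bound_var (eval_monomials d k z r t).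
Proof.
elim: r t => [|r IH] t //=; rewrite IH andbT /bound_var /vn /vdig /=.
apply/negP => /(allP (eval_monomials_nwrites k z r t.+1)); rewrite /vdig /vaddr; lia.
Qed.

Lemma eval_form_bounded K z : bounded bound_var (eval_form d K z).
Proof. by elim: K => //= K ->; exact: eval_monomials_bounded. Qed.

Lemma eval_form_nwrites K z :
  all (fun x => 3 <= x < 5 + d)%N (nwrites (eval_form d K z)).
Proof.
elim: K => //= K IH; rewrite all_cat IH /=.
apply: sub_all (eval_monomials_nwrites K z d 0) => x; rewrite /vaddr /vdig; lia.
Qed.

Lemma eval_monomials_rwrites k z r t :
  all (fun b => arr0 d <= b < arr0 d + 3)%N (rwrites (eval_monomials d k z r t)).
Proof. by elim: r t => [|r IHr] t /=; rewrite ?IHr /aS /aP /aQ; lia. Qed.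

Lemma eval_form_rwrites K z :
  all (fun b => arr0 d <= b < arr0 d + 3)%N (rwrites (eval_form d K z)).
Proof.
elim: K => [|K IH] /=; first by rewrite /aS; lia.
rewrite all_cat IH /=.
by rewrite eval_monomials_rwrites /aP /aQ; lia.
Qed.

Lemma eval_shifted_bounded z : bounded bound_var (eval_shifted d z).
Proof.
rewrite /eval_shifted; have := eval_form_bounded d.+1 z.
by move: (eval_form _ _ _) => p /= ->.
Qed.

Lemma eval_shifted_nwrites z : all (fun x => 3 <= x < 5 + d)%N (nwrites (eval_shifted d z)).
Proof.
rewrite /eval_shifted; have := eval_form_nwrites d.+1 z.
by move: (eval_form _ _ _) => p /= h; rewrite all_cat h /= /vt; lia.
Qed.

Lemma eval_shifted_rwrites z : all (fun b => arr0 d <= b < arr0 d + 3)%N (rwrites (eval_shifted d z)).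
Proof.
rewrite /eval_shifted; have := eval_form_rwrites d.+1 z.
by move: (eval_form _ _ _) => p /= h; rewrite all_cat h /= /aS; lia.
Qed.

Lemma leaf_bounded z neg : bounded bound_var (leaf d z neg).
Proof.
rewrite /leaf; have := eval_shifted_bounded z; have := eval_shifted_bounded (aU d).
by move: (eval_shifted d z) (eval_shifted d _) => p1 p2 /= -> ->.
Qed.

Lemma leaf_nwrites z neg : all (fun x => 3 <= x < 5 + d)%N (nwrites (leaf d z neg)).
Proof.
rewrite /leaf; have := eval_shifted_nwrites z; have := eval_shifted_nwrites (aU d).
move: (eval_shifted d z) (eval_shifted d _) => p1 p2 /= h1 h2.
by rewrite !(all_cat, h1, h2) /= !(all_cat, h1, h2) /= /vt; lia.
Qed.

Lemma leaf_rwrites z neg : all (fun b => arr0 d <= b < arr0 d + 5)%N (rwrites (leaf d z neg)).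
Proof.
have H x : all (fun b => arr0 d <= b < arr0 d + 5)%N (rwrites (eval_shifted d x)).
  by apply: sub_all (eval_shifted_rwrites x) => b; lia.
rewrite /leaf; have := H z; have := H (aU d).
move: (eval_shifted d z) (eval_shifted d _) => p1 p2 /= h1 h2.
by rewrite !(all_cat, h1, h2) /= !(all_cat, h1, h2) /= /aS /aU /aBest; lia.
Qed.

Lemma polar_from_bounded r j neg : bounded bound_var (polar_from d r j neg).
Proof.
elim: r j neg => [|r IH] j neg; first exact: leaf_bounded.
by rewrite /= !IH.
Qed.

Lemma polar_bounded : bounded bound_var (polar d).
Proof. exact: polar_from_bounded. Qed.

Lemma polar_nwrites : all (fun x => 3 <= x < 5 + d)%N (nwrites (polar d)).
Proof.
suff H r j neg : all (fun x => 3 <= x < 5 + d)%N (nwrites (polar_from d r j neg)).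
  by rewrite /polar; have := H d 0%N false; move: (polar_from _ _ _ _) => p /= ->.
elim: r j neg => [|r IH] j neg; first exact: leaf_nwrites.
by rewrite /= !(all_cat, IH) /= !(all_cat, IH).
Qed.

Lemma polar_from_rwrites r j neg : (j + r <= d)%N ->
  all (fun b => (arr0 d <= b < arr0 d + 5) || (aZ d j < b <= aZ d d))%N
      (rwrites (polar_from d r j neg)).
Proof.
elim: r j neg => [|r IH] j neg hj.
  by apply: sub_all (leaf_rwrites _ _) => b /= ->.
have H b0 : all (fun b => (arr0 d <= b < arr0 d + 5) || (aZ d j < b <= aZ d d))%N
      (rwrites (polar_from d r j.+1 b0)).
  apply: sub_all (IH _ b0 _) => [b|]; last by lia.
  by rewrite /aZ; lia.
by rewrite /= !(all_cat, H) /= !(all_cat, H) /aZ /=; lia.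
Qed.

Lemma polar_rwrites : all (fun b => arr0 d <= b < aW d)%N (rwrites (polar d)).
Proof.
rewrite /polar; have := polar_from_rwrites false (leqnn d : 0 + d <= d)%N.
move: (polar_from _ _ _ _) => p h.
rewrite /= (sub_all _ h) /aS /aZ /aW => [|b /=]; last by rewrite /aZ; lia.
by lia.
Qed.

Lemma decode_bounded j : bounded bound_var (decode d j).
Proof. by rewrite /= !inE /bound_var /vc2 /vc /vq /vm /vpos /vB /=; lia. Qed.

Lemma decode_nwrites j : all (fun x => 3 <= x < 10 + d)%N (nwrites (decode d j)).
Proof. by rewrite /= /vc2 /vc /vq /vm /vpos /vt; lia. Qed.

Lemma decode_rwrites j : all (fun b => (b == aS d) || (b == aX d j)) (rwrites (decode d j)).
Proof. by rewrite /= !eqxx ?orbT. Qed.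

Lemma hess_apply_bounded : bounded bound_var (hess_apply d).
Proof.
rewrite /hess_apply; have := polar_bounded; have := polar_nwrites.
move: (polar d) => p h1 /= ->; rewrite /bound_var /vj /= !andbT cats0 inE negb_or /vt.
apply/andP; split; first by lia.
by apply/negP => /(allP h1); lia.
Qed.

Lemma hess_apply_nwrites : all (fun x => (3 <= x < 5 + d) || (x == vj d))%N (nwrites (hess_apply d)).
Proof.
set P := (fun x => _); rewrite /hess_apply.
have : all P (nwrites (polar d)) by apply: sub_all polar_nwrites => x; rewrite /P; lia.
move: (polar d) => p h; rewrite /= !all_cat h /= /P /vt /vj; lia.
Qed.

Lemma hess_apply_rwrites :
  all (fun b => (arr0 d <= b <= aW d) || (b == aX d d.-1))%N (rwrites (hess_apply d)).
Proof.
set P := (fun x => _); rewrite /hess_apply.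
have : all P (rwrites (polar d)) by apply: sub_all polar_rwrites => x; rewrite /P; lia.
move: (polar d) => p h; rewrite /= !all_cat h /= /P /aW /aS; lia.
Qed.

Lemma power_bounded : bounded bound_var (power d).
Proof.
rewrite /power; have := hess_apply_bounded; have := hess_apply_nwrites.
have := polar_bounded; have := polar_nwrites.
move: (polar d) (hess_apply d) => p1 p2 h1 b1 h2 b2 /=; rewrite b1 b2 /=.
have k1 : vk d \notin nwrites p1 by apply/negP => /(allP h1); rewrite /vk; lia.
have k2 : vk d \notin nwrites p2 by apply/negP => /(allP h2); rewrite /vk /vj; lia.
have i1 : vi d \notin nwrites p1 by apply/negP => /(allP h1); rewrite /vi; lia.
have i2 : vi d \notin nwrites p2 by apply/negP => /(allP h2); rewrite /vi /vj; lia.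
rewrite !notin_all in k1 k2 i1 i2 *.
rewrite /= !(all_cat, k1, k2, i1, i2) /= !(all_cat, k1, k2, i1, i2) /= /bound_var /vk /vi /vt; lia.
Qed.

Lemma power_nwrites : all (fun x => 3 <= x < 13 + d)%N (nwrites (power d)).
Proof.
set P := (fun x => _); rewrite /power.
have : all P (nwrites (polar d)) by apply: sub_all polar_nwrites => x; rewrite /P; lia.
have : all P (nwrites (hess_apply d)).
  by apply: sub_all hess_apply_nwrites => x; rewrite /P /vj; lia.
move: (polar d) (hess_apply d) => p1 p2 h1 h2 /=.
rewrite !all_cat /= !all_cat h1 h2 /= /P /vi /vk /vt; lia.
Qed.

Lemma power_rwrites : all (fun b => (arr0 d <= b <= aW d) || (aX d d.-2 <= b))%N (rwrites (power d)).
Proof.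
set P := (fun x => _); rewrite /power.
have : all P (rwrites (polar d)) by apply: sub_all polar_rwrites => x; rewrite /P; lia.
have : all P (rwrites (hess_apply d)).
  by apply: sub_all hess_apply_rwrites => x; rewrite /P /aX; lia.
move: (polar d) (hess_apply d) => p1 p2 h1 h2 /=.
rewrite !all_cat /= !all_cat h1 h2 /= /P /aX; lia.
Qed.

Lemma searchS r j : search d r.+1 j =
  PFor (vP d j) vN (PFor (vM d j) vB (PSeq (decode d j) (search d r j.+1))).
Proof. by []. Qed.

Lemma search_nwrites r j : all (fun x => (3 <= x < 13 + d) || (vP d j <= x))%N (nwrites (search d r j)).
Proof.
elim: r j => [|r IH] j.
  by apply: sub_all power_nwrites => x; lia.
set P := (fun x => _); rewrite searchS.
have : all P (nwrites (decode d j)) by apply: sub_all (decode_nwrites j) => x; rewrite /P; lia.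
have : all P (nwrites (search d r j.+1)) by apply: sub_all (IH j.+1) => x; rewrite /P /vP; lia.
move: (decode d j) (search d r j.+1) => p1 p2 h1 h2 /=.
rewrite !all_cat h1 h2 /= /P /vM /vP; lia.
Qed.

Lemma search_rwrites r j : (j + r <= d.-2)%N ->
  all (fun b => (arr0 d <= b <= aW d) || (aX d j <= b))%N (rwrites (search d r j)).
Proof.
elim: r j => [|r IH] j hj.
  by apply: sub_all power_rwrites => x; rewrite /aX; lia.
set P := (fun x => _); rewrite searchS.
have : all P (rwrites (decode d j)).
  by apply: sub_all (decode_rwrites j) => x; rewrite /P /aS /aW; lia.
have : all P (rwrites (search d r j.+1)).
  by apply: sub_all (IH j.+1 _) => [x|]; rewrite /P /aX; lia.
move: (decode d j) (search d r j.+1) => p1 p2 h1 h2 /=.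
by rewrite !all_cat h1 h2.
Qed.

Lemma search_bounded r j : bounded bound_var (search d r j).
Proof.
elim: r j => [|r IH] j; first exact: power_bounded.
rewrite searchS; have := search_nwrites r j.+1; have := decode_nwrites j.
have := IH j.+1; have := decode_bounded j.
move: (decode d j) (search d r j.+1) => p1 p2 b1 b2 h1 h2 /=; rewrite b1 b2 /=.
have P1 : vP d j \notin nwrites p1 by apply/negP => /(allP h1); rewrite /vP; lia.
have P2 : vP d j \notin nwrites p2 by apply/negP => /(allP h2); rewrite /vP; lia.
have M1 : vM d j \notin nwrites p1 by apply/negP => /(allP h1); rewrite /vM; lia.
have M2 : vM d j \notin nwrites p2 by apply/negP => /(allP h2); rewrite /vP /vM; lia.
rewrite !notin_all in P1 P2 M1 M2 *.
rewrite /= !(all_cat, P1, P2, M1, M2) /= /bound_var /vM /vP; lia.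
Qed.

Lemma main_bounded : bounded bound_var (main d).
Proof.
rewrite /main; have := search_bounded d.-2 0; move: (search _ _ _) => p b.
move: b; rewrite /initial; have := eval_shifted_bounded (aBest d).
by move: (eval_shifted _ _) => p1 /= -> ->; case: ifP.
Qed.

Lemma grow_bounded E : bounded (pred1 vN) (grow E).
Proof. by elim: E => //= E ->. Qed.

End Bounded.

(** * Evaluating the form *)

Section FormValue.
Variables (R : realType) (n d : nat).

Definition crd (z : nat -> R) (l : nat) : R[i] := Complex (z l) (z (n + l)%N).

Definition fac (k t : nat) (w : R[i]) : R[i] := if (t < k)%N then Num.conj w else w.

(** The sum over the last [r] of [d] digits of all monomials with address between
    [c] and [c + n ^ r], where [w] is the product of the first factors. *)
Fixpoint monomial_sum (A A' z : nat -> R) (k r t : nat) (w : R[i]) (c : nat) : R :=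
  if r is r'.+1 then
    \sum_(l < n) monomial_sum A A' z k r' t.+1 (w * fac k t (crd z l)) (c + l * n ^ r')%N
  else A c * complex.Re w - A' c * complex.Im w.

Definition form_value (A : nat -> nat -> R) (z : nat -> R) : R :=
  \sum_(k < d.+1) monomial_sum (A k.*2) (A k.*2.+1) z k d 0 1 0.

End FormValue.

Section EvalSpec.
Variables (R : realType) (n d : nat).
Implicit Type s : state R.

Lemma rarr_set s b i v b' i' : rarr (set_rarr s b i v) b' i' =
  if (b' == b) && (i' == i) then v else rarr s b' i'.
Proof. by []. Qed.

Lemma rarr_set_neq s b i v b' : b' != b -> rarr (set_rarr s b i v) b' = rarr s b'.
Proof. by move=> h; apply/funext => j; rewrite rarr_set (negbTE h). Qed.

Lemma rarr_set_eq s b i v : rarr (set_rarr s b i v) b i = v.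
Proof. by rewrite rarr_set !eqxx. Qed.

Lemma fac_mul k t (a b x y : R) : Complex a b * fac k t (Complex x y) =
  if (t < k)%N then Complex (a * x + b * y) (b * x - a * y)
  else Complex (a * x - b * y) (b * x + a * y).
Proof.
rewrite /fac; case: ifP => _; last by congr Complex; rewrite addrC.
by congr Complex; rewrite ?mulrN ?opprK // addrC.
Qed.

Lemma aPS : (aP d == aS d) = false. Proof. by rewrite /aP /aS; lia. Qed.
Lemma aQS : (aQ d == aS d) = false. Proof. by rewrite /aQ /aS; lia. Qed.
Lemma aQP : (aQ d == aP d) = false. Proof. by rewrite /aQ /aP; lia. Qed.

(** Invariant of the loop over one digit: the monomials of the first [i] values of
    the digit have been added, and [vaddr] has advanced by [n ^ r] for each. *)
Lemma eval_monomials_spec k z r t s :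
    nvar s vn = n -> (k <= d)%N -> (arr0 d + 3 <= z)%N ->
  let s' := den (eval_monomials d k z r t) s in
  [/\ rarr s' (aS d) sVal = rarr s (aS d) sVal +
        monomial_sum n (rarr s k.*2) (rarr s k.*2.+1) (rarr s z) k r t
          (Complex (rarr s (aP d) t) (rarr s (aQ d) t)) (nvar s vaddr),
      nvar s' vaddr = (nvar s vaddr + n ^ r)%N,
      forall i, i != sVal -> rarr s' (aS d) i = rarr s (aS d) i,
      forall i, (i <= t)%N -> rarr s' (aP d) i = rarr s (aP d) i &
      forall i, (i <= t)%N -> rarr s' (aQ d) i = rarr s (aQ d) i].
Proof.
move=> hn hk hz; elim: r t s hn => [|r IH] t s hn.
  split; rewrite /= ?eqxx //= => i hi; first by rewrite (negbTE hi).
    by rewrite aPS.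
  by rewrite aQS.
have nw1 : vn \notin nwrites (eval_monomials d k z r.+1 t).
  by apply/negP => /(allP (eval_monomials_nwrites d k z r.+1 t)); rewrite /vn /vdig.
pose off s1 s2 := forall b, ((b < arr0 d) || (arr0 d + 3 <= b))%N -> rarr s1 b = rarr s2 b.
pose w := Complex (rarr s (aP d) t) (rarr s (aQ d) t).
pose I i s1 := [/\ nvar s1 vn = n, off s1 s,
  rarr s1 (aS d) sVal = rarr s (aS d) sVal + \sum_(l < i)
    monomial_sum n (rarr s k.*2) (rarr s k.*2.+1) (rarr s z) k r t.+1
      (w * fac k t (crd n (rarr s z) l)) (nvar s vaddr + l * n ^ r)%N,
  nvar s1 vaddr = (nvar s vaddr + i * n ^ r)%N &
  (forall i, i != sVal -> rarr s1 (aS d) i = rarr s (aS d) i) /\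
  forall i, (i <= t)%N -> rarr s1 (aP d) i = rarr s (aP d) i /\
                           rarr s1 (aQ d) i = rarr s (aQ d) i].
suff : I (nvar s vn) (den (eval_monomials d k z r.+1 t) s).
  case=> h1 h2 h3 h4 [h5 h6]; rewrite hn in h3 h4; split=> //; first by rewrite h4 expnS.
    by move=> i /h6 [].
  by move=> i /h6 [].
apply: for_ind.
  by split=> //; rewrite ?big_ord0 ?addr0 ?addn0 //=.
move=> i s1 hi hd [h1 h2 h3 h4 [h5 h6]].
have zi : nvar s1 (vdig t) = i := hd.
rewrite [den _ s1]/=; set s2 := set_rarr (set_rarr s1 _ _ _) _ _ _.
have off2 : off s2 s.
  by move=> b hb; rewrite /s2 !rarr_set_neq ?h2 //; rewrite /aP /aQ; lia.
have [p1 q1] := h6 t (leqnn t).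
have z1 : rarr s1 z = rarr s z by apply: h2; lia.
have cP : rarr s2 (aP d) t.+1 = complex.Re (w * fac k t (crd n (rarr s z) i)).
  rewrite /s2 rarr_set_neq ?rarr_set_eq; last by rewrite eq_sym aQP.
  rewrite /w /crd fac_mul; case: ifP => _; cbn [reval neval cell];
  by rewrite z1 p1 q1 h1 zi.
have cQ : rarr s2 (aQ d) t.+1 = complex.Im (w * fac k t (crd n (rarr s z) i)).
  rewrite /s2 rarr_set_eq; set s1' := set_rarr s1 _ _ _.
  have z1' : rarr s1' z = rarr s z by rewrite rarr_set_neq ?z1 //; rewrite /aP; lia.
  have q1' : rarr s1' (aQ d) t = rarr s (aQ d) t by rewrite rarr_set_neq ?q1 ?aQP.
  have p1' : rarr s1' (aP d) t = rarr s (aP d) t by rewrite rarr_set (ltn_eqF (ltnSn t)) andbF.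
  have n1' : nvar s1' vn = n := h1.
  have zi' : nvar s1' (vdig t) = i := zi.
  rewrite /w /crd fac_mul; case: ifP => _; cbn [reval neval cell];
  by rewrite z1' p1' q1' n1' zi'.
have n2 : nvar s2 vn = n by [].
have addr2 : nvar s2 vaddr = nvar s1 vaddr by [].
have S2 j : rarr s2 (aS d) j = rarr s1 (aS d) j.
  by rewrite /s2 !rarr_set_neq // /aS /aP /aQ; lia.
have PQ2 j : (j <= t)%N -> rarr s2 (aP d) j = rarr s1 (aP d) j /\
                            rarr s2 (aQ d) j = rarr s1 (aQ d) j.
  move=> hj; have jt : (j == t.+1) = false by lia.
  by rewrite /s2 !rarr_set jt !andbF.
clearbody s2.
have [e1 e2 e3 e4 e5] := IH t.+1 s2 n2.
set s3 := den _ s2 in e1 e2 e3 e4 e5 *.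
have offA b : (b <= k.*2.+1)%N -> rarr s2 b = rarr s b.
  by move=> hb; apply: off2; rewrite /arr0; lia.
split.
- have := den_nvar_all (x := vn) s2 (eval_monomials_nwrites d k z r t.+1).
  by move=> /(_ isT) e; exact: etrans e n2.
- move=> b hb; rewrite -(off2 b hb).
  by apply: den_rarr_all (eval_monomials_rwrites d k z r t.+1) _; lia.
- rewrite [rarr _ _]/= e1 S2 h3 big_ord_recr /= addrA; congr (_ + _).
  rewrite cP cQ (offA k.*2) // (offA k.*2.+1) // (off2 z); last by lia.
  congr monomial_sum; first by case: (w * _).
  by rewrite addr2 h4.
- by rewrite [nvar _ _]/= e2 addr2 h4 mulSn; lia.
- split=> [j hj|j hj]; first by rewrite [rarr _ _]/= e3 // S2 h5.
  rewrite ![rarr (set_nvar _ _ _) _]/= e4 ?e5; try by lia.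
  by have [-> ->] := PQ2 j hj; exact: h6.
Qed.

End EvalSpec.

Section VectorSpecs.
Variables (R : realType) (n d B : nat) (A : nat -> nat -> R) (sh : R).
Implicit Type s : state R.
Local Notation V := 'rV[R]_(n + n).

Definition vec s (b : nat) : V := \row_t rarr s b t.

Definition entries (x : V) (i : nat) : R := oapp (x 0) 0 (insub i).

(** With [sh] the value of an even form at a unit vector [e], this is
    [p x - p e * |x| ^ d]; with [sh = 0] it is the form itself, in any degree. *)
Definition shifted_form (x : V) : R :=
  form_value n d A (entries x) - sh * dot x x ^+ d./2.

(** What all parts of the program after the initialisation rely on and preserve. *)
Definition env s : Prop :=
  [/\ nvar s vn = n, nvar s vN = (n + n)%N, nvar s vB = B,
      forall b, (b < arr0 d)%N -> rarr s b = A b & rarr s (aS d) sShift = sh].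

Lemma env_den p s : env s -> all (fun x => 3 <= x)%N (nwrites p) ->
  all (fun b => arr0 d <= b)%N (rwrites p) ->
  rarr (den p s) (aS d) sShift = rarr s (aS d) sShift -> env (den p s).
Proof.
move=> [h1 h2 h3 h4 h5] np rp e; split; rewrite ?e ?(den_nvar_all s np) // => b hb.
by rewrite (den_rarr_all s rp) ?h4 //; lia.
Qed.

Lemma entriesE x (t : 'I_(n + n)) : entries x t = x 0 t.
Proof. by rewrite /entries valK. Qed.

Lemma entries_vec s b i : (i < n + n)%N -> entries (vec s b) i = rarr s b i.
Proof. by move=> hi; rewrite /entries insubT /= mxE. Qed.

Lemma monomial_sum_ext (A1 A2 z1 z2 : nat -> R) k r t w c :
  (forall i, (i < n + n)%N -> z1 i = z2 i) ->
  monomial_sum n A1 A2 z1 k r t w c = monomial_sum n A1 A2 z2 k r t w c.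
Proof.
move=> hz; elim: r t w c => //= r IH t w c.
apply: eq_bigr => l _; rewrite IH /crd !hz //; have := ltn_ord l; lia.
Qed.

(** The expression may use the array that is being written, but only at the index
    of the current round, which still has its old value. *)
Lemma vloop_spec b a e s f : b != vt ->
    (forall i s', (i < nvar s b)%N -> nvar s' vt = i ->
       (forall x, x != vt -> nvar s' x = nvar s x) ->
       (forall b', b' != a -> rarr s' b' = rarr s b') ->
       rarr s' a i = rarr s a i -> reval s' e = f i) ->
  forall i, (i < nvar s b)%N -> rarr (den (vloop b a e) s) a i = f i.
Proof.
move=> bt he.
pose I i s' := [/\ forall x, x != vt -> nvar s' x = nvar s x,
  forall b', b' != a -> rarr s' b' = rarr s b' &
  forall j, rarr s' a j = if (j < i)%N then f j else rarr s a j].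
suff [_ _ h] : I (nvar s b) (den (vloop b a e) s) by move=> i hi; rewrite h hi.
apply: for_ind.
  by split=> // x hx; rewrite /= (negbTE hx).
move=> i s' hi ht [h1 h2 h3]; split.
- by move=> x hx; rewrite /= (negbTE hx) h1.
- by move=> b' hb'; rewrite -h2 //; apply: rarr_set_neq.
- move=> j; rewrite [LHS]/= ht eqxx /= ltnS leq_eqVlt; case: eqVneq => [->|ji] /=; last by rewrite h3.
  by apply: he => //; rewrite h3 ltnn.
Qed.

Lemma vloop_vec a e s f : nvar s vN = (n + n)%N ->
    (forall i s', nvar s' vt = i -> (i < n + n)%N ->
       (forall x, x != vt -> nvar s' x = nvar s x) ->
       (forall b', b' != a -> rarr s' b' = rarr s b') ->
       rarr s' a i = rarr s a i -> reval s' e = f i) ->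
  vec (den (vloop vN a e) s) a = \row_t f t.
Proof.
move=> hN he; apply/rowP => t; rewrite !mxE.
by apply: (vloop_spec (f := f)); rewrite ?hN // => i s' hi ht h1 h2 h3; apply: he.
Qed.

Lemma vloop_off b a e s a' : a' != a -> rarr (den (vloop b a e) s) a' = rarr s a'.
Proof. by move=> h; rewrite den_rarr //= inE. Qed.

Lemma vloop_var b a e s x : x != vt -> nvar (den (vloop b a e) s) x = nvar s x.
Proof. by move=> h; rewrite den_nvar //= inE. Qed.

Lemma eval_form_spec K z s : nvar s vn = n -> (K <= d.+1)%N -> (arr0 d + 3 <= z)%N ->
  rarr (den (eval_form d K z) s) (aS d) sVal =
    \sum_(k < K) monomial_sum n (rarr s k.*2) (rarr s k.*2.+1) (rarr s z) k d 0 1 0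
  /\ forall i, i != sVal -> rarr (den (eval_form d K z) s) (aS d) i = rarr s (aS d) i.
Proof.
move=> hn; elim: K => [|K IH] hK hz.
  rewrite big_ord0; split; first exact: rarr_set_eq.
  by move=> i hi; rewrite /= (negbTE hi) andbF.
have {IH}[|//|h1 h2] := IH; first by lia.
have nv : nvar (den (eval_form d K z) s) vn = n.
  by rewrite (den_nvar_all s (eval_form_nwrites d K z)).
have off b : ((b < arr0 d) || (arr0 d + 3 <= b))%N ->
    rarr (den (eval_form d K z) s) b = rarr s b.
  by move=> hb; apply: den_rarr_all (eval_form_rwrites d K z) _; lia.
have -> : den (eval_form d K.+1 z) s = den (eval_block d K z) (den (eval_form d K z) s) by [].
move: (den (eval_form d K z) s) h1 h2 nv off => s1 h1 h2 nv off.
pose s2 := set_nvar (set_rarr (set_rarr s1 (aP d) 0 1) (aQ d) 0 0) vaddr 0.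
have -> : den (eval_block d K z) s1 = den (eval_monomials d K z d 0) s2 by [].
have off2 b : b != aP d -> b != aQ d -> rarr s2 b = rarr s1 b.
  by move=> b1 b2; rewrite -[LHS]/(rarr (set_rarr _ _ _ _) b) !rarr_set_neq.
have P2 : rarr s2 (aP d) 0 = 1.
  rewrite -[LHS]/(rarr (set_rarr _ _ _ _) (aP d) 0) rarr_set_neq ?rarr_set_eq //.
  by rewrite eq_sym aQP.
have Q2 : rarr s2 (aQ d) 0 = 0 by exact: rarr_set_eq.
have n2 : nvar s2 vn = n by [].
have a2 : nvar s2 vaddr = 0%N by [].
clearbody s2.
have [|e1 _ e3 _ _] := @eval_monomials_spec R n d K z d 0 s2 n2 _ hz; first by lia.
have S2 : rarr s2 (aS d) = rarr s1 (aS d) by apply: off2; rewrite eq_sym ?aPS ?aQS.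
split; last by move=> i hi; rewrite e3 // S2 h2.
rewrite e1 S2 h1 big_ord_recr /= P2 Q2 a2; congr (_ + _).
by rewrite !off2 ?off //; move: hK hz; rewrite /aP /aQ /arr0; lia.
Qed.

Lemma sqr_norm_spec z s : nvar s vN = (n + n)%N -> z != aS d ->
  rarr (den (sqr_norm d z) s) (aS d) sSqr = dot (vec s z) (vec s z)
  /\ forall i, i != sSqr -> rarr (den (sqr_norm d z) s) (aS d) i = rarr s (aS d) i.
Proof.
move=> hN hz.
pose I i s' := [/\ rarr s' z = rarr s z,
  rarr s' (aS d) sSqr = \sum_(t < i) rarr s z t * rarr s z t &
  forall i, i != sSqr -> rarr s' (aS d) i = rarr s (aS d) i].
suff [_ h1 h2] : I (n + n)%N (den (sqr_norm d z) s).
  split=> //; rewrite h1; apply: eq_bigr => t _; by rewrite !mxE.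
rewrite -hN; set s0 := set_rarr s (aS d) sSqr 0.
have -> : den (sqr_norm d z) s = den (PFor vt vN (set_sc d sSqr (RAdd (sc d sSqr)
    (RMul (RGet z (NVar vt)) (RGet z (NVar vt)))))) s0 by [].
apply: (@for_ind R I vt vN _ s0).
  split; first exact: rarr_set_neq.
    by rewrite big_ord0; exact: rarr_set_eq.
  by move=> i hi; rewrite /= (negbTE hi) andbF.
move=> i s' _ ht [h1 h2 h3]; split.
- by rewrite -h1; apply: rarr_set_neq.
- by rewrite /= !eqxx /= ht h1 h2 big_ord_recr.
- by move=> j hj; rewrite /= (negbTE hj) andbF h3.
Qed.

Lemma rpow_eval s e h : reval s (rpow e h) = reval s e ^+ h.
Proof. by elim: h => //= h ->; rewrite exprS. Qed.

Lemma eval_shifted_spec z s : env s -> (arr0 d + 3 <= z)%N ->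
  rarr (den (eval_shifted d z) s) (aS d) sVal = shifted_form (vec s z)
  /\ forall i, i != sVal -> i != sSqr ->
       rarr (den (eval_shifted d z) s) (aS d) i = rarr s (aS d) i.
Proof.
move=> [hn hN _ hA hsh] hz.
have zS : z != aS d by rewrite /aS; lia.
have [h1 h2] := eval_form_spec hn (leqnn _) hz.
have nv : nvar (den (eval_form d d.+1 z) s) vN = (n + n)%N.
  by rewrite (den_nvar_all s (eval_form_nwrites d d.+1 z)).
have vz : rarr (den (eval_form d d.+1 z) s) z = rarr s z.
  by apply: den_rarr_all (eval_form_rwrites d d.+1 z) _; lia.
rewrite /eval_shifted; cbn [den]; move: (den (eval_form d d.+1 z) s) h1 h2 nv vz => s1 h1 h2 nv vz.
have [h3 h4] := sqr_norm_spec nv zS.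
have {}vz : vec s1 z = vec s z by apply/rowP => t; rewrite !mxE vz.
move: (den (sqr_norm d z) s1) h3 h4 => s2 h3 h4.
split; last first.
  by move=> i i1 i2; rewrite rarr_set (negbTE i1) andbF h4 // h2.
rewrite rarr_set_eq; cbn [reval]; rewrite rpow_eval.
rewrite -[reval s2 (sc d sVal)]/(rarr s2 (aS d) sVal) -[reval s2 (sc d sShift)]/(rarr s2 (aS d) sShift).
rewrite -[reval s2 (sc d sSqr)]/(rarr s2 (aS d) sSqr) h3 !h4 // h1 h2 // hsh vz; congr (_ - _).
apply: eq_bigr => k _; have hk := ltn_ord k.
rewrite (hA k.*2) ?(hA k.*2.+1); try by rewrite /arr0; lia.
by apply: monomial_sum_ext => i hi; rewrite entries_vec.
Qed.

Lemma eval_shifted_env z s : env s -> (arr0 d + 3 <= z)%N -> env (den (eval_shifted d z) s).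
Proof.
move=> es hz; have [_ h] := eval_shifted_spec es hz; apply: env_den => //; last exact: h.
  by apply: sub_all (eval_shifted_nwrites d z) => x; lia.
by apply: sub_all (eval_shifted_rwrites d z) => x; lia.
Qed.

Lemma normalise_spec b s : nvar s vN = (n + n)%N -> b != aS d ->
  vec (den (normalise d b) s) b = unit (vec s b) /\
  forall i, i != sSqr -> rarr (den (normalise d b) s) (aS d) i = rarr s (aS d) i.
Proof.
move=> hN hb; have [h1 h2] := sqr_norm_spec hN hb.
rewrite /normalise; cbn [den set_sc].
have vb : rarr (den (sqr_norm d b) s) b = rarr s b by apply: den_rarr; rewrite /= !inE (negbTE hb).
have nv : nvar (den (sqr_norm d b) s) vN = (n + n)%N by rewrite den_nvar.
move: (den (sqr_norm d b) s) h1 h2 vb nv => s1 h1 h2 vb nv.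
set s2 := set_rarr s1 _ _ _.
have b2 : rarr s2 b = rarr s b by rewrite /s2 rarr_set_neq.
have n2 : nvar s2 vN = (n + n)%N by [].
have S2 : rarr s2 (aS d) sSqr = nrm (vec s b).
  by rewrite /s2 rarr_set_eq; cbn [reval]; rewrite -[reval _ _]/(rarr s1 (aS d) sSqr) h1.
have S3 i : i != sSqr -> rarr s2 (aS d) i = rarr s (aS d) i.
  by move=> hi; rewrite /s2 rarr_set (negbTE hi) andbF h2.
clearbody s2; split; last by move=> i hi; rewrite vloop_off ?S3 // eq_sym.
rewrite (@vloop_vec _ _ _ (fun i => rarr s b i / nrm (vec s b))) //.
  by apply/rowP => t; rewrite !mxE mulrC.
move=> i s' ht hi h3 h4 h5.
by rewrite /= ht h5 b2 h4 ?S2 // eq_sym.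
Qed.

Lemma copy_vec a b s : nvar s vN = (n + n)%N -> a != b ->
  vec (den (copy vN a b) s) a = vec s b.
Proof.
move=> hN ab; rewrite (@vloop_vec _ _ _ (rarr s b)) //.
by move=> i s' ht hi h3 h4 h5; rewrite /= ht h4 // eq_sym.
Qed.

End VectorSpecs.

(** * Collecting candidates *)

Section PolarSpec.
Variables (R : realType) (n d B : nat) (A : nat -> nat -> R) (sh : R).
Implicit Type s : state R.
Local Notation V := 'rV[R]_(n + n).
Local Notation q := (shifted_form d A sh : V -> R).
Local Notation vec s b := (vec n s b).
Local Notation env := (env n d B A sh).
Local Notation best s := (rarr s (aS d) sBest).

Definition best_ok s : Prop :=
  nrm (vec s (aBest d)) = 1 /\ best s = q (vec s (aBest d)).

(** All that is recorded about a part of the search: the best value never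
    decreases, and it dominates every candidate [z] in [C] after normalisation. *)
Definition improves s s' (C : V -> Prop) : Prop :=
  [/\ env s', best_ok s', best s <= best s' &
      forall z, C z -> z != 0 -> q (unit z) <= best s'].

Lemma vec_eq s s' b : rarr s' b = rarr s b -> vec s' b = vec s b.
Proof. by move=> h; apply/rowP => t; rewrite !mxE h. Qed.

Lemma reval_sc s i : reval s (sc d i) = rarr s (aS d) i.
Proof. by []. Qed.

Lemma set_sc_eq s i e : rarr (den (set_sc d i e) s) (aS d) i = reval s e.
Proof. exact: rarr_set_eq. Qed.

Lemma set_sc_neq s i e j : j != i -> rarr (den (set_sc d i e) s) (aS d) j = rarr s (aS d) j.
Proof. by move=> h; rewrite /= (negbTE h) andbF. Qed.

Lemma set_sc_off s i e b : b != aS d -> rarr (den (set_sc d i e) s) b = rarr s b.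
Proof. exact: rarr_set_neq. Qed.

Lemma env_set_sc s i e : i != sShift -> env s -> env (den (set_sc d i e) s).
Proof.
move=> hi es; apply: env_den => //=; first by rewrite leqnn.
by rewrite eq_sym (negbTE hi) andbF.
Qed.

Lemma env_vloop s b a e : (arr0 d < a)%N -> env s -> env (den (vloop b a e) s).
Proof.
move=> ha es; apply: env_den => //=; first by rewrite andbT ltnW.
by rewrite vloop_off // /aS; lia.
Qed.

Lemma env_sqr_norm s z : z != aS d -> env s -> env (den (sqr_norm d z) s).
Proof.
move=> hz es; have [_ hN _ _ _] := es; have [_ h] := sqr_norm_spec hN hz.
by apply: env_den => //=; [rewrite leqnn|exact: h].
Qed.

Lemma env_normalise s b : (arr0 d < b)%N -> env s -> env (den (normalise d b) s).
Proof.
move=> hb es; have [_ hN _ _ _] := es; have [|_ h] := @normalise_spec R n d b s hN; first by rewrite /aS; lia.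
by apply: env_den => //=; [rewrite /aS; lia|exact: h].
Qed.

Lemma leaf_spec z neg s : env s -> best_ok s -> (arr0 d + 5 <= z)%N ->
  let s' := den (leaf d z neg) s in
  improves s s' (fun y => y = vec s z) /\
  rarr s' (aS d) sPol = rarr s (aS d) sPol + (-1) ^+ neg * q (vec s z).
Proof.
move=> es [bn bv] hz.
rewrite /leaf den_seq.
have zS : z != aS d by rewrite /aS; lia.
have [|v1 f1] := eval_shifted_spec (z := z) es; first by lia.
have e1 : env (den (eval_shifted d z) s) by apply: eval_shifted_env => //; lia.
have off1 b : (arr0 d + 3 <= b)%N -> rarr (den (eval_shifted d z) s) b = rarr s b.
  by move=> hb; apply: den_rarr_all (eval_shifted_rwrites d z) _; lia.
move: (den (eval_shifted d z) s) v1 f1 e1 off1 => s1 v1 f1 e1 off1.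
rewrite den_seq; set s2 := den (set_sc d sPol _) s1.
have e2 : env s2 by apply: env_set_sc.
have P2 : rarr s2 (aS d) sPol = rarr s (aS d) sPol + (-1) ^+ neg * q (vec s z).
  rewrite set_sc_eq; case: (neg); cbn [reval]; rewrite !reval_sc v1 f1 //.
    by rewrite expr1 mulN1r.
  by rewrite expr0 mul1r.
have b2 : best s2 = best s by rewrite set_sc_neq // f1.
have off2 b : (arr0 d + 3 <= b)%N -> rarr s2 b = rarr s b.
  by move=> hb; rewrite set_sc_off ?off1 //; rewrite /aS; lia.
clearbody s2; rewrite den_seq; have [_ hN2 _ _ _] := e2.
have [v3 f3] := sqr_norm_spec hN2 zS.
have e3 : env (den (sqr_norm d z) s2) by apply: env_sqr_norm.
have off3 b : (arr0 d + 3 <= b)%N -> rarr (den (sqr_norm d z) s2) b = rarr s b.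
  by move=> hb; rewrite den_rarr ?off2 //= !inE; rewrite /aS; lia.
move: (den (sqr_norm d z) s2) v3 f3 e3 off3 => s3 v3 f3 e3 off3.
have {}v3 : rarr s3 (aS d) sSqr = dot (vec s z) (vec s z).
  by rewrite v3 (vec_eq (off2 z _)) //; lia.
have b3 : best s3 = best s by rewrite f3.
have P3 : rarr s3 (aS d) sPol = rarr s (aS d) sPol + (-1) ^+ neg * q (vec s z) by rewrite f3.
have ok3 : best_ok s3 by split; rewrite ?b3 (vec_eq (off3 _ _)) // /aBest; lia.
rewrite den_if den_skip; cbn [teval]; rewrite reval_sc v3; cbn [reval].
case: ifP => [z0|nz].
  split=> //; split=> // [|_ -> /negP[]]; first by rewrite b3.
  apply/eqP/nrm0_eq0; rewrite /nrm; apply/eqP; rewrite sqrtr_eq0.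
  exact: z0.
rewrite den_seq; have [_ hN3 _ _ _] := e3.
have aUz : aU d != z by rewrite /aU; lia.
have v4 : vec (den (copy vN (aU d) z) s3) (aU d) = vec s z.
  by rewrite copy_vec // (vec_eq (off3 z _)) //; lia.
have e4 : env (den (copy vN (aU d) z) s3) by apply: env_vloop => //; rewrite /aU; lia.
have off4 b : b != aU d -> rarr (den (copy vN (aU d) z) s3) b = rarr s3 b.
  by move=> hb; rewrite vloop_off.
move: (den (copy vN (aU d) z) s3) v4 e4 off4 => s4 v4 e4 off4.
rewrite den_seq; have [_ hN4 _ _ _] := e4.
have aUS : aU d != aS d by rewrite /aU /aS; lia.
have [v5 f5] := normalise_spec hN4 aUS.
have e5 : env (den (normalise d (aU d)) s4) by apply: env_normalise => //; rewrite /aU; lia.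
have off5 b : b != aU d -> b != aS d -> rarr (den (normalise d (aU d)) s4) b = rarr s3 b.
  by move=> b1 b2'; rewrite den_rarr ?off4 //= !inE (negbTE b1) (negbTE b2').
move: (den (normalise d (aU d)) s4) v5 f5 e5 off5 => s5 v5 f5 e5 off5.
rewrite den_seq; have aUs : aS d != aU d by rewrite eq_sym.
have f5' i : i != sSqr -> rarr s5 (aS d) i = rarr s3 (aS d) i by move=> hi; rewrite f5 // off4.
have aU3 : (arr0 d + 3 <= aU d)%N by rewrite /aU; lia.
have [v6 f6] := eval_shifted_spec e5 aU3.
have e6 := eval_shifted_env e5 aU3.
have off6 b : (arr0 d + 3 <= b)%N -> rarr (den (eval_shifted d (aU d)) s5) b = rarr s5 b.
  by move=> hb; apply: den_rarr_all (eval_shifted_rwrites d (aU d)) _; lia.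
move: (den (eval_shifted d (aU d)) s5) v6 f6 e6 off6 => s6 v6 f6 e6 off6.
have {}v6 : rarr s6 (aS d) sVal = q (unit (vec s z)) by rewrite v6 v5 v4.
have U6 : vec s6 (aU d) = unit (vec s z) by rewrite (vec_eq (off6 _ aU3)) v5 v4.
have b6 : best s6 = best s by rewrite f6 // f5' // b3.
have P6 : rarr s6 (aS d) sPol = rarr s (aS d) sPol + (-1) ^+ neg * q (vec s z).
  by rewrite f6 // f5' // P3.
have B6 : vec s6 (aBest d) = vec s (aBest d).
  apply: vec_eq; rewrite off6 ?off5 ?off3 //; rewrite /aBest /aU /aS; lia.
have ok6 : best_ok s6 by split; rewrite ?b6 B6.
have nz0 : vec s z != 0.
  apply/negP => /eqP z0; move: nz; rewrite z0 (lin0 (dot_lin 0)) mulr0n lexx //.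
rewrite den_if den_skip; cbn [teval]; rewrite !reval_sc v6 b6; case: ifP => [le|nle].
  by split=> //; split=> // [|_ -> _]; rewrite b6.
rewrite den_seq; split; last by rewrite vloop_off ?set_sc_neq // /aS /aBest; lia.
set s7 := den (set_sc d sBest (sc d sVal)) s6.
have e7 : env s7 by apply: env_set_sc.
have b7 : best s7 = q (unit (vec s z)) by rewrite set_sc_eq reval_sc v6.
have U7 : vec s7 (aU d) = unit (vec s z) by rewrite (vec_eq (set_sc_off _ _ _ aUS)).
clearbody s7; have [_ hN7 _ _ _] := e7.
have b8 : best (den (copy vN (aBest d) (aU d)) s7) = q (unit (vec s z)).
  by rewrite vloop_off ?b7 // /aS /aBest; lia.
have B8 : vec (den (copy vN (aBest d) (aU d)) s7) (aBest d) = unit (vec s z).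
  by rewrite copy_vec ?U7 // /aBest /aU; lia.
split.
- by apply: env_vloop => //; rewrite /aBest; lia.
- by split; rewrite ?b8 B8 // nrm_unit.
- by rewrite b8; move: nle => /negbT; rewrite -ltNge => /ltW.
- by move=> _ -> _; rewrite b8.
Qed.

Lemma improves_trans s1 s2 s3 (C1 C2 : V -> Prop) :
  improves s1 s2 C1 -> improves s2 s3 C2 -> improves s1 s3 (fun z => C1 z \/ C2 z).
Proof.
move=> [a1 a2 a3 a4] [b1 b2 b3 b4]; split=> //; first exact: le_trans b3.
by move=> z [/a4 h|/b4 //] z0; apply: le_trans b3; exact: h.
Qed.

Lemma improves_sub s1 s2 (C1 C2 : V -> Prop) :
  (forall z, C2 z -> C1 z) -> improves s1 s2 C1 -> improves s1 s2 C2.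
Proof. by move=> h [a1 a2 a3 a4]; split=> // z /h; exact: a4. Qed.

Lemma improves_eq s0 s1 s2 (C : V -> Prop) :
  best s0 = best s1 -> improves s1 s2 C -> improves s0 s2 C.
Proof. by move=> h [a1 a2 a3 a4]; split=> //; rewrite h. Qed.

Lemma best_ok_eq s s' : rarr s' (aBest d) = rarr s (aBest d) -> best s' = best s ->
  best_ok s -> best_ok s'.
Proof. by move=> h1 h2 [a b]; split; rewrite ?h2 (vec_eq h1). Qed.

Lemma polar_fromS r j neg : polar_from d r.+1 j neg =
  PSeq (vloop vN (aZ d j.+1) (RAdd (RGet (aZ d j) (NVar vt)) (RGet (aX d j) (NVar vt))))
  (PSeq (polar_from d r j.+1 neg)
  (PSeq (vloop vN (aZ d j.+1) (RSub (RGet (aZ d j) (NVar vt)) (RGet (aX d j) (NVar vt))))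
        (polar_from d r j.+1 (~~ neg)))).
Proof. by []. Qed.

Definition arg_vecs s j r : seq V := [seq vec s (aX d i) | i <- iota j r].

Lemma arg_vecs_eq s s' j r : (forall i, (j <= i < j + r)%N -> rarr s' (aX d i) = rarr s (aX d i)) ->
  arg_vecs s' j r = arg_vecs s j r.
Proof. by move=> h; apply/eq_in_map => i; rewrite mem_iota => /h /vec_eq. Qed.

Lemma polar_from_spec r j neg s : (j + r)%N = d -> env s -> best_ok s ->
  let s' := den (polar_from d r j neg) s in
  improves s s' (fun z => z \in signed_sums (arg_vecs s j r) (vec s (aZ d j))) /\ rarr s' (aS d) sPol = rarr s (aS d) sPol +
    (-1) ^+ neg * pol q (arg_vecs s j r) (vec s (aZ d j)).
Proof.
elim: r j neg s => [|r IH] j neg s hj es oks.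
  have [|h1 h2] := leaf_spec neg es oks (z := aZ d j); first by rewrite /aZ; lia.
  by split; [apply: improves_sub h1 => z; rewrite inE => /eqP|exact: h2].
rewrite polar_fromS !den_seq.
have [_ hN _ _ _] := es.
have Zj : (arr0 d < aZ d j.+1)%N by rewrite /aZ; lia.
have args_low s1 s2 : (forall b, (aW d <= b)%N -> rarr s2 b = rarr s1 b) ->
    arg_vecs s2 j.+1 r = arg_vecs s1 j.+1 r.
  by move=> h; apply: arg_vecs_eq => i _; apply: h; rewrite /aW /aX; lia.
set s1 := den (vloop _ _ _) s.
have e1 : env s1 by apply: env_vloop.
have off1 b : b != aZ d j.+1 -> rarr s1 b = rarr s b by move=> hb; rewrite /s1 vloop_off.
have v1 : vec s1 (aZ d j.+1) = vec s (aZ d j) + vec s (aX d j).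
  rewrite /s1 (@vloop_vec _ _ _ _ _ (fun i => rarr s (aZ d j) i + rarr s (aX d j) i)) //.
    by apply/rowP => t; rewrite !mxE.
  by move=> i s' ht hi h3 h4 h5; rewrite /= ht !h4 // /aZ /aX; lia.
clearbody s1.
have ok1 : best_ok s1 by apply: best_ok_eq oks; rewrite off1 // /aBest /aS /aZ; lia.
have [|i2 p2] := IH j.+1 neg s1 _ e1 ok1; first by lia.
have hw2 : all (fun b => (arr0 d <= b < arr0 d + 5) || (aZ d j.+1 < b <= aZ d d))%N
   (rwrites (polar_from d r j.+1 neg)) by apply: polar_from_rwrites; lia.
have off2 b : (aZ d d < b)%N || (b == aZ d j) -> rarr (den (polar_from d r j.+1 neg) s1) b = rarr s b.
  move=> hb; rewrite -[RHS]off1; last by move: hb; rewrite /aZ; lia.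
  by apply: den_rarr_all hw2 _; move: hb; rewrite /aZ; lia.
move: (den (polar_from d r j.+1 neg) s1) i2 p2 off2 => s2 i2 p2 off2.
have [e2 ok2 _ _] := i2; have [_ hN2 _ _ _] := e2.
set s3 := den (vloop _ _ _) s2.
have e3 : env s3 by apply: env_vloop.
have off3 b : b != aZ d j.+1 -> rarr s3 b = rarr s2 b by move=> hb; rewrite /s3 vloop_off.
have v3 : vec s3 (aZ d j.+1) = vec s (aZ d j) - vec s (aX d j).
  rewrite /s3 (@vloop_vec _ _ _ _ _ (fun i => rarr s (aZ d j) i - rarr s (aX d j) i)) //.
    by apply/rowP => t; rewrite !mxE.
  move=> i s' ht hi h3 h4 h5; rewrite /= ht !h4 ?off2 ?eqxx ?orbT //; rewrite /aZ /aX; lia.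
clearbody s3.
have ok3 : best_ok s3 by apply: best_ok_eq ok2; rewrite off3 // /aBest /aS /aZ; lia.
have [|i4 p4] := IH j.+1 (~~ neg) s3 _ e3 ok3; first by lia.
have a1 : arg_vecs s1 j.+1 r = arg_vecs s j.+1 r.
  by apply: args_low => b hb; rewrite off1 //; move: hb; rewrite /aW /aZ; lia.
have a3 : arg_vecs s3 j.+1 r = arg_vecs s j.+1 r.
  by apply: args_low => b hb; rewrite off3 ?off2 //; move: hb; rewrite /aW /aZ; lia.
rewrite a1 v1 in i2 p2; rewrite a3 v3 in i4 p4.
have s01 : rarr s1 (aS d) = rarr s (aS d) by apply: off1; rewrite /aS /aZ; lia.
have s23 : rarr s3 (aS d) = rarr s2 (aS d) by apply: off3; rewrite /aS /aZ; lia.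
split.
  apply: (@improves_eq s s1); first by rewrite s01.
  have i4' : improves s2 _ _ := improves_eq (esym (congr1 (@^~ sBest) s23)) i4.
  apply: improves_sub (improves_trans i2 i4') => z /=.
  by rewrite mem_cat => /orP[]; [left|right].
rewrite p4 s23 p2 s01 /=; case: (neg) => /=; rewrite !(expr0, expr1); ring.
Qed.

Lemma polar_spec s : env s -> best_ok s ->
  let s' := den (polar d) s in
  improves s s' (fun z => z \in signed_sums (arg_vecs s 0 d) 0) /\ rarr s' (aS d) sPol = pol q (arg_vecs s 0 d) 0.
Proof.
move=> es oks; rewrite /polar !den_seq.
set s1 := den (set_sc _ _ _) s.
have e1 : env s1 by apply: env_set_sc.
have P1 : rarr s1 (aS d) sPol = 0 by rewrite set_sc_eq.
have b1 : best s1 = best s by rewrite set_sc_neq.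
have off1 b : b != aS d -> rarr s1 b = rarr s b by move=> hb; rewrite set_sc_off.
clearbody s1; have [_ hN _ _ _] := e1.
set s2 := den (vloop _ _ _) s1.
have e2 : env s2 by apply: env_vloop => //; rewrite /aZ; lia.
have off2 b : b != aZ d 0 -> rarr s2 b = rarr s1 b by move=> hb; rewrite /s2 vloop_off.
have v2 : vec s2 (aZ d 0) = 0.
  rewrite /s2 (@vloop_vec _ _ _ _ _ (fun=> 0)) //.
  by apply/rowP => t; rewrite !mxE.
clearbody s2.
have S2 : rarr s2 (aS d) = rarr s1 (aS d) by rewrite off2 // /aS /aZ; lia.
have ok2 : best_ok s2.
  by apply: best_ok_eq oks; rewrite ?S2 ?b1 // off2 ?off1 // /aBest /aS /aZ; lia.
have [|h1 h2] := @polar_from_spec d 0 false s2 _ e2 ok2; first by [].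
have aE : arg_vecs s2 0 d = arg_vecs s 0 d.
  by apply: arg_vecs_eq => i _; rewrite off2 ?off1 // /aX /aS /aZ; lia.
rewrite aE v2 in h1 h2; split; first by apply: improves_eq h1; rewrite S2.
by rewrite h2 S2 P1 expr0 mul1r add0r.
Qed.

End PolarSpec.

(** * Decoding a test vector *)

Section DecodeSpec.
Variables (R : realType) (n d B : nat) (A : nat -> nat -> R) (sh : R).
Implicit Type s : state R.
Local Notation N := (n + n)%N.
Local Notation V := 'rV[R]_N.
Local Notation q := (shifted_form d A sh : V -> R).
Local Notation vec s b := (vec n s b).
Local Notation env := (env n d B A sh).
Local Notation best s := (rarr s (aS d) sBest).
Local Notation best_ok := (@best_ok R n d A sh).
Local Notation improves := (@improves R n d B A sh).

Lemma den_PN_neq s x e y : y != x -> nvar (den (PN x e) s) y = nvar s y.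
Proof. by move=> h; rewrite /= (negbTE h). Qed.

Lemma den_PN_eq s x e : nvar (den (PN x e) s) x = neval s e.
Proof. by rewrite /= eqxx. Qed.

Definition divide : prog :=
  PFor (vc2 d) vB
    (PIf (NLe (NConst 3) (NVar (vm d)))
       (PSeq (PN (vm d) (NSub (NVar (vm d)) (NConst 3))) (PN (vq d) (NAdd (NVar (vq d)) (NConst 1))))
       PSkip).

(** After [i] rounds [min i (m / 3)] threes have been subtracted. *)
Lemma divide_spec s m : nvar s vB = B -> (m <= B)%N -> nvar s (vm d) = m -> nvar s (vq d) = 0%N ->
  nvar (den divide s) (vm d) = (m %% 3)%N /\ nvar (den divide s) (vq d) = (m %/ 3)%N.
Proof.
move=> hB mB hm hq.
have n1 : (vm d == vc2 d) = false by rewrite /vm /vc2; lia.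
have n2 : (vq d == vc2 d) = false by rewrite /vq /vc2; lia.
have n3 : (vm d == vq d) = false by rewrite /vm /vq; lia.
have n4 : (vq d == vm d) = false by rewrite /vm /vq; lia.
pose I i s' := nvar s' (vm d) = (m - 3 * minn i (m %/ 3))%N /\ nvar s' (vq d) = minn i (m %/ 3).
suff [h1 h2] : I (nvar s vB) (den divide s).
  have := divn_eq m 3; rewrite h1 h2 hB.
  have -> : minn B (m %/ 3) = (m %/ 3)%N by apply/minn_idPr; lia.
  by split=> //; lia.
apply: for_ind.
  by rewrite /I /= n1 n2 hm hq min0n muln0 subn0.
move=> i s' _ _ [h1 h2]; rewrite /I den_if den_skip.
have E : teval s' (NLe (NConst 3) (NVar (vm d))) = (3 <= nvar s' (vm d))%N by [].
rewrite E h1; case: ifP => h; rewrite /= ?n1 ?n2 ?n3 ?n4 ?eqxx ?h1 ?h2.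
  by have := divn_eq m 3; lia.
by have := divn_eq m 3; lia.
Qed.

Lemma vec_set_nvar s x v b : vec (set_nvar s x v) b = vec s b.
Proof. by []. Qed.

Lemma letter_spec j s m p : (0 < N)%N -> nvar s vB = B -> nvar s vN = N -> (m <= B)%N -> (p < N)%N ->
    nvar s (vm d) = m -> nvar s (vpos d) = p ->
  let s' := den (letter d (aX d j)) s in
  (nvar s' (vm d), nvar s' (vpos d), vec s' (aX d j)) =
    read_letter (m, p, vec s (aX d j)).
Proof.
move=> N0 hB hN mB hp hm hpos; rewrite /letter !den_seq.
set s1 := den (PN (vq d) (NConst 0)) s.
have m1 : nvar s1 (vm d) = m by rewrite -hm den_PN_neq // /vm /vq; lia.
have p1 : nvar s1 (vpos d) = p by rewrite -hpos den_PN_neq // /vpos /vq; lia.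
have q1 : nvar s1 (vq d) = 0%N by rewrite den_PN_eq.
have N1 : nvar s1 vN = N by rewrite -hN den_PN_neq.
have B1 : nvar s1 vB = B by rewrite -hB den_PN_neq.
have x1 : rarr s1 (aX d j) = rarr s (aX d j) by [].
clearbody s1.
have [m2 q2] := divide_spec B1 mB m1 q1; rewrite -/divide.
have p2 : nvar (den divide s1) (vpos d) = p.
  by rewrite den_nvar // notin_all /= /vpos /vc2 /vm /vq; lia.
have N2 : nvar (den divide s1) vN = N by rewrite den_nvar.
have x2 : rarr (den divide s1) (aX d j) = rarr s (aX d j) by rewrite den_rarr.
move: (den divide s1) m2 q2 p2 N2 x2 => s2 m2 q2 p2 N2 x2.
set t := PIf _ _ _.
have tq : nvar (den t s2) (vq d) = (m %/ 3)%N.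
  by rewrite den_nvar // notin_all /= /vpos /vq; lia.
have nmq : (vpos d == vm d) = false by rewrite /vpos /vm; lia.
rewrite den_PN_eq den_PN_neq ?nmq // -[neval _ _]/(nvar (den t s2) (vq d)) tq.
suff [-> ->] : nvar (den t s2) (vpos d) = (if (m %% 3 == 0)%N then (p.+1 %% N)%N else p) /\
   vec (den (PN (vm d) (NVar (vq d))) (den t s2)) (aX d j) = if (m %% 3 == 0)%N then vec s (aX d j)
   else if (m %% 3 == 1)%N then vec s (aX d j) + ev R N p else vec s (aX d j) - ev R N p by [].
rewrite -[vec _ _]/(vec (den t s2) (aX d j)) /t !den_if !den_seq !den_if !den_skip.
have E c : teval s2 (NLe (NConst c) (NVar (vm d))) = (c <= m %% 3)%N by rewrite /= m2.
have hr : (m %% 3 < 3)%N by rewrite ltn_mod.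
rewrite !E; case: (m %% 3)%N hr => [|[|[|//]]] _ /=.
- rewrite N2 eqxx p2 addn1; split; last by apply/rowP => i; case: ifP; rewrite !mxE /= x2.
  case: ifP => h; rewrite /= eqxx.
    have -> : p.+1 = N by lia.
    by rewrite modnn.
  by rewrite modn_small //; lia.
- split=> //; apply/rowP => i; rewrite !mxE /= eqxx p2 x2 /=.
  by case: eqP => [->|_]; rewrite ?addr0.
- split=> //; apply/rowP => i; rewrite !mxE /= eqxx p2 x2 /=.
  by case: eqP => [->|_]; rewrite ?subr0.
Qed.

Lemma read_letter_lt (c : nat * nat * V) : (c.1.2 < N)%N ->
  ((read_letter c).1.1 <= c.1.1)%N /\ ((read_letter c).1.2 < N)%N.
Proof.
case: c => [[m p] x] /= hp; split; first exact: leq_div.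
by case: ifP => // _; rewrite ltn_mod; lia.
Qed.

Lemma decode_spec j s : env s -> (nvar s (vP d j) < N)%N -> (nvar s (vM d j) <= B)%N ->
  let s' := den (decode d j) s in
  [/\ env s', vec s' (aX d j) = test_vec R N B (nvar s (vP d j), nvar s (vM d j)) &
      best s' = best s].
Proof.
move=> es hp hm; have [_ hN hB _ _] := es; rewrite /decode 4!den_seq.
set s1 := den (vloop _ _ _) s.
have e1 : env s1 by apply: env_vloop => //; rewrite /aX; lia.
have v1 : vec s1 (aX d j) = 0.
  rewrite /s1 (@vloop_vec _ _ _ _ _ (fun=> 0)) //.
  by apply/rowP => t; rewrite !mxE.
have S1 : rarr s1 (aS d) = rarr s (aS d) by rewrite /s1 vloop_off // /aS /aX; lia.
have nv1 x : x != vt -> nvar s1 x = nvar s x by move=> hx; rewrite /s1 vloop_var.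
clearbody s1.
set p := nvar s (vP d j) in hp *; set m := nvar s (vM d j) in hm *.
set s2 := den (PN (vm d) _) _.
have e2 : env s2.
  by apply: env_den => //; apply: env_den.
have m2 : nvar s2 (vm d) = m.
  have ne : (vM d j == vpos d) = false by rewrite /vM /vpos; lia.
  by rewrite /s2 /= eqxx ne nv1.
have p2 : nvar s2 (vpos d) = p.
  have ne : (vpos d == vm d) = false by rewrite /vm /vpos; lia.
  by rewrite /s2 /= eqxx ne nv1.
have r2 : rarr s2 = rarr s1 by [].
have x2 : vec s2 (aX d j) = 0 by rewrite -v1; apply: vec_eq; rewrite r2.
clearbody s2.
set s3 := den (PFor _ _ _) s2.
have e3 : env s3.
  apply: env_den => //; first by rewrite /= /aX; lia.
  by rewrite den_rarr // notin_all /= /aX /aS; lia.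
have v3 : vec s3 (aX d j) = word_vec R N B p m.
  pose I i s' := [/\ nvar s' vB = B, nvar s' vN = N, (nvar s' (vm d) <= B)%N,
    (nvar s' (vpos d) < N)%N &
    (nvar s' (vm d), nvar s' (vpos d), vec s' (aX d j)) = iter i (@read_letter R N) (m, p, 0)].
  have [_ hN2 hB2 _ _] := e2.
  suff [_ _ _ _ h] : I (nvar s2 vB) s3 by rewrite /word_vec -[B in iter B]hB2 -h.
  have nm : (vm d == vc d) = false by rewrite /vm /vc; lia.
  have np : (vpos d == vc d) = false by rewrite /vpos /vc; lia.
  apply: for_ind; first by split; rewrite /= ?nm ?np ?m2 ?p2 ?vec_set_nvar ?x2.
  move=> i s' _ _ [h1 h2 h3 h4 h5].
  have L := letter_spec j _ h1 h2 h3 h4 erefl erefl.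
  have N0 : (0 < N)%N by lia.
  have {L} := L N0; rewrite h5 => L.
  have B' : nvar (den (letter d (aX d j)) s') vB = B.
    by rewrite den_nvar // notin_all /= /vq /vc2 /vm /vpos.
  have N' : nvar (den (letter d (aX d j)) s') vN = N.
    by rewrite den_nvar // notin_all /= /vq /vc2 /vm /vpos.
  have := @read_letter_lt (nvar s' (vm d), nvar s' (vpos d), vec s' (aX d j)) h4.
  rewrite h5 -L -h5 => -[/= l1 l2].
  by split; rewrite /= ?nm ?np ?vec_set_nvar //; apply: leq_trans l1 h3.
have b3 : rarr s3 (aS d) = rarr s (aS d).
  by rewrite den_rarr ?r2 ?S1 // notin_all /= /aX /aS; lia.
clearbody s3; have [_ hN3 _ _ _] := e3.
have [|h1 h2] := @normalise_spec R n d (aX d j) s3 hN3; first by rewrite /aX /aS; lia.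
split; first by apply: env_normalise => //; rewrite /aX; lia.
  by rewrite h1 v3.
by rewrite h2 // b3.
Qed.

End DecodeSpec.

(** * The search *)

Section SearchSpec.
Variables (R : realType) (n e B : nat) (A : nat -> nat -> R) (sh : R).
Implicit Type s : state R.
Local Notation d := e.+2.
Local Notation N := (n + n)%N.
Local Notation V := 'rV[R]_N.
Local Notation q := (shifted_form d A sh : V -> R).
Local Notation vec s b := (vec n s b).
Local Notation env := (env n d B A sh).
Local Notation best s := (rarr s (aS d) sBest).
Local Notation best_ok := (@best_ok R n d A sh).
Local Notation improves := (@improves R n d B A sh).
Local Notation args s j r := (@arg_vecs R n d s j r).

Lemma env_set_nvar s x v : (3 <= x)%N -> env s -> env (set_nvar s x v).
Proof.
move=> hx [h1 h2 h3 h4 h5]; split=> //=; rewrite ifN_eqC //.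
- by rewrite /vn; lia.
- by rewrite /vN; lia.
- by rewrite /vB; lia.
Qed.

Lemma rarr_set_nvar s x v : rarr (set_nvar s x v) = rarr s.
Proof. by []. Qed.

Lemma improves_set_nvar s s' x v C : (3 <= x)%N ->
  improves s s' C -> improves s (set_nvar s' x v) C.
Proof. by move=> hx [h1 h2 h3 h4]; split=> //; apply: env_set_nvar. Qed.

Lemma improves_refl s : env s -> best_ok s -> improves s s (fun=> False).
Proof. by move=> h1 h2; split. Qed.

(** A loop collects the candidates of all its rounds, because the best value
    never decreases. *)
Lemma for_improves x b p s (C : nat -> V -> Prop) :
    (3 <= x)%N -> x \notin nwrites p -> env s -> best_ok s ->
    (forall i s1, (i < nvar s b)%N -> nvar s1 x = i -> env s1 -> best_ok s1 ->
       (forall y, y \notin nwrites p -> y != x -> nvar s1 y = nvar s y) ->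
       (forall a, a \notin rwrites p -> rarr s1 a = rarr s a) ->
       improves s1 (den p s1) (C i)) ->
  improves s (den (PFor x b p) s) (fun z => exists2 i, (i < nvar s b)%N & C i z).
Proof.
move=> hx xp es oks H.
pose I i s1 := [/\ improves s s1 (fun z => exists2 i', (i' < i)%N & C i' z),
  forall y, y \notin nwrites p -> y != x -> nvar s1 y = nvar s y &
  forall a, a \notin rwrites p -> rarr s1 a = rarr s a].
suff [] : I (nvar s b) (den (PFor x b p) s) by [].
apply: for_ind.
  split=> [|y _ yx|//]; last by rewrite /= (negbTE yx).
  apply: improves_set_nvar => //.
  by apply: improves_sub (improves_refl es oks) => z [].
move=> i s1 hi hx1 [h1 h2 h3]; split.
- apply: improves_set_nvar => //; have [e1 ok1 _ _] := h1.
  apply: improves_sub (improves_trans h1 (H i s1 hi hx1 e1 ok1 h2 h3)) => z [i' hi' hz].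
  by case: (ltngtP i' i) hi' => [l _|l|<- _]; [left; exists i'|lia|right].
- by move=> y yp yx; rewrite /= (negbTE yx) den_nvar ?h2.
- by move=> a ha; rewrite rarr_set_nvar den_rarr ?h3.
Qed.

Lemma basis_vec_spec a x s : nvar s vN = N -> x != vt ->
  vec (den (basis_vec a x) s) a = ev R N (nvar s x).
Proof.
move=> hN hx; rewrite /basis_vec den_seq.
set s1 := den (vloop _ _ _) s.
have v1 : vec s1 a = 0.
  rewrite /s1 (@vloop_vec _ _ _ _ _ (fun=> 0)) //.
  by apply/rowP => t; rewrite !mxE.
have x1 : nvar s1 x = nvar s x by rewrite /s1 vloop_var.
clearbody s1; apply/rowP => t; rewrite !mxE /= eqxx x1 /=.
by case: eqP => //= _; move/rowP/(_ t): v1; rewrite !mxE.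
Qed.

Lemma env_basis_vec a x s : (arr0 d < a)%N -> env s -> env (den (basis_vec a x) s).
Proof.
move=> ha es; apply: env_den => //; first by rewrite /= !(ltnW ha).
by rewrite den_rarr // notin_all /= /aS; lia.
Qed.

Lemma args_last s : args s 0 d = args s 0 e ++ [:: vec s (aX d e); vec s (aX d e.+1)].
Proof. by rewrite /arg_vecs -[in iota 0 _]addn2 iotaD map_cat. Qed.

Lemma hess_apply_spec s : env s -> best_ok s ->
  let s' := den (hess_apply d) s in
  improves s s' (fun=> False) /\
  vec s' (aW d) = unit (hess q (args s 0 e) (vec s (aX d e))).
Proof.
move=> es oks; rewrite /hess_apply den_seq; set loop := PFor _ _ _.
pose I i s1 := [/\ improves s s1 (fun=> False),
  forall a, (aX d 0 <= a <= aX d e)%N -> rarr s1 a = rarr s a &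
  forall t : 'I_N, (t < i)%N -> rarr s1 (aW d) t =
     pol q (args s 0 e ++ [:: vec s (aX d e); evec R t]) 0].
have [_ hN _ _ _] := es.
have [h1 h2 h3] : I (nvar s vN) (den loop s).
  apply: for_ind.
    by split=> //; apply: improves_set_nvar (improves_refl es oks).
  move=> i s1; rewrite hN => hi hx [i1 h2 h3].
  have [e1 ok1 _ _] := i1; have [_ hN1 _ _ _] := e1.
  rewrite 2!den_seq; set s2 := den (basis_vec _ _) s1.
  have e2 : env s2 by apply: env_basis_vec => //; rewrite /aX; lia.
  have v2 : vec s2 (aX d e.+1) = ev R N i.
    by rewrite /s2 basis_vec_spec ?hx // /vj /vt; lia.
  have off2 a : a != aX d e.+1 -> rarr s2 a = rarr s1 a.
    by move=> ha; rewrite /s2 den_rarr // notin_all /= eq_sym ha.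
  have nv2 : nvar s2 (vj d) = i by rewrite -hx /s2 den_nvar // notin_all /= /vj /vt; lia.
  clearbody s2.
  have ok2 : best_ok s2 by apply: best_ok_eq ok1; rewrite off2 // /aBest /aS /aX; lia.
  have [i3 p3] := polar_spec e2 ok2.
  have off3 a : (aW d <= a)%N -> rarr (den (polar d) s2) a = rarr s2 a.
    by move=> ha; apply: den_rarr_all (polar_rwrites d) _; lia.
  have nv3 : nvar (den (polar d) s2) (vj d) = i.
    by rewrite -nv2; apply: den_nvar_all (polar_nwrites d) _; rewrite /vj; lia.
  move: (den (polar d) s2) i3 p3 off3 nv3 => s3 i3 p3 off3 nv3.
  have [e3 ok3 _ _] := i3.
  set s4 := den (PR _ _ _) s3.
  have off4 a : a != aW d -> rarr s4 a = rarr s3 a by exact: rarr_set_neq.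
  have e4 : env s4 by apply: env_den => //; rewrite ?off4 //= /aW /aS /arr0; lia.
  have ok4 : best_ok s4 by apply: best_ok_eq ok3; rewrite off4 // /aBest /aS /aW; lia.
  have W4 t : rarr s4 (aW d) t = if t == i then rarr s3 (aS d) sPol else rarr s1 (aW d) t.
    rewrite /s4 /= eqxx /= nv3; case: ifP => // _; rewrite off3 // off2 //.
    by rewrite /aW /aX; lia.
  have aE : args s2 0 d = args s 0 e ++ [:: vec s (aX d e); ev R N i].
    rewrite args_last v2; congr (_ ++ [:: _; _]).
      apply: arg_vecs_eq => a /andP[_ ha]; rewrite off2 ?h2 // /aX; lia.
    by apply: vec_eq; rewrite off2 ?h2 // /aX; lia.
  split.
  - apply: improves_set_nvar => //.
    have h4 : best s4 = best s3 by rewrite off4 // /aW /aS; lia.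
    have b2 : best s1 = best s2 by rewrite off2 // /aX /aS; lia.
    have := improves_trans i1 (improves_eq b2 i3) => -[_ _ l _].
    by split=> //; rewrite h4.
  - move=> a ha; rewrite rarr_set_nvar -h2 // off4; last by move: ha; rewrite /aX /aW; lia.
    by rewrite off3 ?off2 //; move: ha; rewrite /aX /aW; lia.
  - move=> t; rewrite ltnS leq_eqVlt rarr_set_nvar W4 => /orP[/eqP ti|ti].
      rewrite ti eqxx p3 aE; congr (pol _ (_ ++ [:: _; _])).
      by apply/rowP => t'; rewrite !mxE eqxx /= -ti -val_eqE.
    by rewrite ltn_eqF // h3.
have [e1 ok1 b1 _] := h1; have [_ hN1 _ _ _] := e1.
move: (den loop s) h1 h2 h3 e1 ok1 b1 hN1 => s1 h1 h2 h3 e1 ok1 b1 hN1.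
have wS : aW d != aS d by rewrite /aW /aS; lia.
have [v f] := normalise_spec hN1 wS.
split; last first.
  rewrite v; congr unit; apply/rowP => t; rewrite !mxE h3 // hN; exact: ltn_ord.
split=> //; first by apply: env_normalise => //; rewrite /aW; lia.
  by apply: best_ok_eq ok1; rewrite ?f // den_rarr // notin_all /= /aBest /aW /aS; lia.
by rewrite f.
Qed.

Definition power_candidate (xs : seq V) (t : 'I_N) (k : nat) (z : V) : Prop :=
  z \in signed_sums (xs ++ [:: power_vec q xs t k; unit (hess q xs (power_vec q xs t k))]) 0.

Lemma power_spec s : env s -> best_ok s ->
  improves s (den (power d) s)
    (fun z => exists t : 'I_N, exists2 k, (k < N)%N & power_candidate (args s 0 e) t k z).
Proof.
move=> es oks; have [_ hN _ _ _] := es; rewrite /power.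
set body := PSeq _ _; set xs := args s 0 e.
pose C i z := exists2 t : 'I_N, t = i :> nat & exists2 k, (k < N)%N & power_candidate xs t k z.
suff : improves s (den (PFor (vi d) vN body) s) (fun z => exists2 i, (i < nvar s vN)%N & C i z).
  apply: improves_sub => z [t [k hk hz]]; exists t; first by rewrite hN.
  by exists t => //; exists k.
have rwh := hess_apply_rwrites d; have nwh := hess_apply_nwrites d.
have rwp := polar_rwrites d; have nwp := polar_nwrites d.
apply: for_improves => //.
  by have [] := bounded_for (power_bounded d).
move=> i s1; rewrite hN => hi hx e1 ok1 _ off1.
have a1 : args s1 0 e = xs.
  apply: arg_vecs_eq => a /andP[_ ha]; apply: off1; rewrite /body.
  apply/negP => h; have := power_rwrites d => /allP /(_ (aX d a)).
  by rewrite /power /= in h *; move=> /(_ h); rewrite /aX /aW; lia.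
rewrite /body den_seq; set s2 := den (basis_vec _ _) s1.
have [_ hN1 _ _ _] := e1.
have e2 : env s2 by apply: env_basis_vec => //; rewrite /aX; lia.
have v2 : vec s2 (aX d e) = ev R N i.
  by rewrite /s2 basis_vec_spec ?hx // /vi /vt; lia.
have off2 a : a != aX d e -> rarr s2 a = rarr s1 a.
  by move=> ha; rewrite /s2 den_rarr // notin_all /= eq_sym ha.
clearbody s2.
have ok2 : best_ok s2 by apply: best_ok_eq ok1; rewrite off2 // /aBest /aS /aX; lia.
have b2 : best s1 = best s2 by rewrite off2 // /aX /aS; lia.
apply: (improves_eq b2).
have a2 : args s2 0 e = xs.
  by rewrite -a1; apply: arg_vecs_eq => a ha; rewrite off2 // /aX; lia.
have [_ hN2 _ _ _] := e2.
pose t := Ordinal hi.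
pose I k s3 := [/\ improves s2 s3 (fun z => exists2 k', (k' < k)%N & power_candidate xs t k' z),
  args s3 0 e = xs & vec s3 (aX d e) = power_vec q xs t k].
set loop := PFor (vk d) vN _.
suff [h _ _] : I (nvar s2 vN) (den loop s2).
  apply: improves_sub h => z [t' ti [k hk hz]]; exists k; first by rewrite hN2.
  by have -> : t = t' by apply: val_inj; rewrite /= ti.
apply: for_ind.
  split=> //; last first.
    by rewrite vec_set_nvar v2; apply/rowP => t'; rewrite !mxE eqxx /= -val_eqE.
  apply: improves_set_nvar => //; apply: improves_sub (improves_refl e2 ok2) => z [].
  by [].
move=> k s3 _ _ [i3 a3 v3]; have [e3 ok3 _ _] := i3.
rewrite 3!den_seq.
have [i4 w4] := hess_apply_spec e3 ok3.
have off4 a : (aX d 0 <= a <= aX d e)%N -> rarr (den (hess_apply d) s3) a = rarr s3 a.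
  by move=> ha; apply: den_rarr_all rwh _; move: ha; rewrite /aX /aW; lia.
move: (den (hess_apply d) s3) i4 w4 off4 => s4 i4 w4 off4.
have [e4 ok4 _ _] := i4; have [_ hN4 _ _ _] := e4.
rewrite a3 v3 in w4.
set s5 := den (copy _ _ _) s4.
have e5 : env s5 by apply: env_vloop => //; rewrite /aX; lia.
have off5 a : a != aX d e.+1 -> rarr s5 a = rarr s4 a by move=> ha; rewrite /s5 vloop_off.
have v5 : vec s5 (aX d e.+1) = unit (hess q xs (power_vec q xs t k)).
  by rewrite /s5 copy_vec // /aX /aW; lia.
clearbody s5.
have ok5 : best_ok s5 by apply: best_ok_eq ok4; rewrite off5 // /aBest /aS /aX; lia.
have b5 : best s4 = best s5 by rewrite off5 // /aX /aS; lia.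
have [i6 _] := polar_spec e5 ok5.
have off6 a : (aW d <= a)%N -> rarr (den (polar d) s5) a = rarr s5 a.
  by move=> ha; apply: den_rarr_all (polar_rwrites d) _; lia.
move: (den (polar d) s5) i6 off6 => s6 i6 off6.
have [e6 ok6 _ _] := i6; have [_ hN6 _ _ _] := e6.
have aE : args s5 0 d = xs ++ [:: power_vec q xs t k; unit (hess q xs (power_vec q xs t k))].
  rewrite args_last v5; congr (_ ++ [:: _; _]).
    rewrite -a3; apply: arg_vecs_eq => a /andP[_ ha]; rewrite off5 ?off4 // /aX; lia.
  by rewrite -v3; apply: vec_eq; rewrite off5 ?off4 // /aX; lia.
rewrite aE in i6.
set s7 := den (copy _ _ _) s6.
have e7 : env s7 by apply: env_vloop => //; rewrite /aX; lia.
have off7 a : a != aX d e -> rarr s7 a = rarr s6 a by move=> ha; rewrite /s7 vloop_off.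
have v7 : vec s7 (aX d e) = unit (hess q xs (power_vec q xs t k)).
  rewrite /s7 copy_vec //; last by rewrite /aX /aW; lia.
  by rewrite -w4; apply: vec_eq; rewrite off6 ?off5 // /aX /aW; lia.
clearbody s7.
split.
- apply: improves_set_nvar => //.
  have h := improves_trans (improves_trans i3 i4) (improves_eq b5 i6).
  have b7 : best s7 = best s6 by rewrite off7 // /aX /aS; lia.
  split; rewrite ?b7 //; try by case: h.
    by apply: best_ok_eq ok6; rewrite off7 // /aBest /aS /aX; lia.
  move=> z [k' hk' hz] z0; case: h => _ _ _; apply => //.
  case: (ltngtP k' k) hk' => [l _|l|kk _]; [|lia|].
    by left; left; exists k'.
  by right; rewrite -kk in hz *.
- rewrite -a3; apply: arg_vecs_eq => a /andP[_ ha].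
  by rewrite rarr_set_nvar off7 ?off6 ?off5 ?off4 // /aX /aW; lia.
- by rewrite vec_set_nvar v7.
Qed.

Lemma search_spec r j s : (j + r)%N = e -> env s -> best_ok s ->
  improves s (den (search d r j) s)
    (fun z => exists pms, [/\ size pms = r, all (in_range N B) pms &
       exists t : 'I_N, exists2 k, (k < N)%N &
         power_candidate (args s 0 j ++ map (test_vec R N B) pms) t k z]).
Proof.
elim: r j s => [|r IH] j s hj es oks.
  have je : j = e by lia.
  apply: improves_sub (power_spec es oks) => z [[|pm pms] [sz _ [t [k hk hz]]]] //.
  by exists t, k => //; rewrite cats0 je in hz.
rewrite searchS.
have [_ hN hB _ _] := es.
have nwd := decode_nwrites d j; have nws := search_nwrites d r j.+1.
have := search_bounded d r.+1 j; rewrite searchS => /bounded_for[bP /bounded_for[bM _]].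
set body := PSeq _ _ in bP bM *.
pose C p z := exists2 m, (m < B)%N & exists pms, [/\ size pms = r, all (in_range N B) pms &
       exists t : 'I_N, exists2 k, (k < N)%N &
         power_candidate (args s 0 j ++ test_vec R N B (p, m) :: map (test_vec R N B) pms) t k z].
suff : improves s (den (PFor (vP d j) vN (PFor (vM d j) vB body)) s)
    (fun z => exists2 p, (p < nvar s vN)%N & C p z).
  apply: improves_sub => z [[|[p m] pms] [//= [sz] /andP[/andP[/= hp hm] hall] h]].
  by exists p; [rewrite hN|exists m => //; exists pms].
have rwlow a : (a < j)%N -> aX d a \notin rwrites body.
  move=> ha; have hr : (j + r.+1 <= d.-2)%N by rewrite /=; lia.
  apply/negP; have := search_rwrites hr; rewrite searchS -/body => /allP h /h.
  by rewrite /aX /aW; lia.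
apply: for_improves => //.
move=> p s1; rewrite hN => hp hx e1 ok1 nv1 off1.
have [_ hN1 hB1 _ _] := e1.
pose D m z := exists pms, [/\ size pms = r, all (in_range N B) pms &
       exists t : 'I_N, exists2 k, (k < N)%N &
         power_candidate (args s 0 j ++ test_vec R N B (p, m) :: map (test_vec R N B) pms) t k z].
suff : improves s1 (den (PFor (vM d j) vB body) s1)
    (fun z => exists2 m, (m < nvar s1 vB)%N & D m z).
  by apply: improves_sub => z [m hm h]; exists m; rewrite ?hB1.
apply: for_improves => //.
move=> m s2; rewrite hB1 => hm hx2 e2 ok2 nv2 off2.
rewrite /body den_seq.
have P2 : nvar s2 (vP d j) = p.
  rewrite nv2 ?hx //; last by rewrite /vP /vM; lia.
  have : vP d j \notin vM d j :: nwrites body by exact: bP.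
  by rewrite in_cons negb_or => /andP[].
have [||e3 v3 b3] := decode_spec (j := j) e2; rewrite ?P2 ?hx2 //; first exact: ltnW.
rewrite P2 hx2 in v3.
have off3 a : a != aS d -> a != aX d j -> rarr (den (decode d j) s2) a = rarr s2 a.
  by move=> h1 h2; apply: den_rarr_all (decode_rwrites d j) _; rewrite negb_or h1.
move: (den (decode d j) s2) e3 v3 b3 off3 => s3 e3 v3 b3 off3.
have ok3 : best_ok s3 by apply: best_ok_eq ok2; rewrite ?b3 // off3 // /aBest /aS /aX; lia.
apply: (improves_eq (esym b3)).
have [|h1 h2 h3 h4] := IH j.+1 s3 _ e3 ok3; first by lia.
split=> // z [pms [sz hall [t [k hk hz]]]] z0; apply: h4 => //.
exists pms; split=> //; exists t, k => //.
suff -> : args s3 0 j.+1 = args s 0 j ++ [:: test_vec R N B (p, m)] by rewrite -catA.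
rewrite /arg_vecs -[in iota 0 _]addn1 iotaD map_cat add0n; congr (_ ++ _); last by rewrite /= v3.
apply: arg_vecs_eq => a /andP[_ ha].
rewrite off3 ?off2 ?off1 ?rwlow //; rewrite /aX /aS; lia.
Qed.

End SearchSpec.

(** * Initialisation and output *)

Section MainSpec.
Variables (R : realType) (n e B : nat) (A : nat -> nat -> R).
Implicit Type s : state R.
Local Notation d := e.+2.
Local Notation N := (n + n)%N.
Local Notation V := 'rV[R]_N.
Local Notation vec s b := (vec n s b).
Local Notation best s := (rarr s (aS d) sBest).

Lemma shifted_form0 x : shifted_form d A 0 x = form_value n d A (entries (x : V)).
Proof. by rewrite /shifted_form mul0r subr0. Qed.

Lemma initial_spec (t0 : 'I_N) s : t0 = 0%N :> nat ->
    nvar s vn = n -> nvar s vN = N -> nvar s vB = B ->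
    (forall b, (b < arr0 d)%N -> rarr s b = A b) ->
    (forall b i, (arr0 d <= b)%N -> rarr s b i = 0) ->
  let s' := den (initial d) s in
  let sh := if odd d then 0 else shifted_form d A 0 (evec R t0) in
  [/\ env n d B A sh s', best_ok n d A sh s' &
      best s' = shifted_form d A sh (evec R t0)].
Proof.
move=> ht hn hN hB hA h0; rewrite /initial 2!den_seq.
set s1 := den (PR _ _ _) s.
have off1 b : b != aBest d -> rarr s1 b = rarr s b by exact: rarr_set_neq.
have e1 : env n d B A 0 s1.
  split=> // [b hb|]; first by rewrite off1 ?hA // /aBest; lia.
  by rewrite off1 ?h0 // /aBest /aS; lia.
have v1 : vec s1 (aBest d) = evec R t0.
  apply/rowP => t; rewrite !mxE /= eqxx /= -val_eqE /= ht.
  by case: eqP => // _; rewrite h0 // /aBest; lia.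
clearbody s1.
have hb3 : (arr0 d + 3 <= aBest d)%N by rewrite /aBest; lia.
have [v2 _] := eval_shifted_spec e1 hb3; have e2 := eval_shifted_env e1 hb3.
have off2 : rarr (den (eval_shifted d (aBest d)) s1) (aBest d) = rarr s1 (aBest d).
  by apply: den_rarr_all (eval_shifted_rwrites d _) _; lia.
move: (den (eval_shifted d (aBest d)) s1) v2 e2 off2 => s2 v2 e2 off2.
set sh := if odd d then 0 else _.
rewrite 2!den_seq; set s3 := den (if _ then _ else _) s2.
have e3 : env n d B A sh s3.
  rewrite /s3 /sh; case: (odd d); first exact: e2.
  have [i1 i2 i3 i4 _] := e2; split=> //.
    by move=> b hb; rewrite set_sc_off ?i4 // /aS; lia.
  by rewrite set_sc_eq reval_sc v2 v1.
have v3 : vec s3 (aBest d) = evec R t0.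
  rewrite -v1; apply: vec_eq; rewrite -off2 /s3; case: (odd d) => //.
  by rewrite set_sc_off // /aBest /aS; lia.
clearbody s3.
have [v4 _] := eval_shifted_spec e3 hb3; have e4 := eval_shifted_env e3 hb3.
have off4 : rarr (den (eval_shifted d (aBest d)) s3) (aBest d) = rarr s3 (aBest d).
  by apply: den_rarr_all (eval_shifted_rwrites d _) _; lia.
move: (den (eval_shifted d (aBest d)) s3) v4 e4 off4 => s4 v4 e4 off4.
have v5 : vec (den (set_sc d sBest (sc d sVal)) s4) (aBest d) = evec R t0.
  by rewrite -v3; apply: vec_eq; rewrite set_sc_off ?off4 // /aBest /aS; lia.
have b5 : best (den (set_sc d sBest (sc d sVal)) s4) = shifted_form d A sh (evec R t0).
  by rewrite set_sc_eq reval_sc v4 v3.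
split=> //; first by apply: env_set_sc.
by split; rewrite v5 ?nrm_evec.
Qed.

Lemma write_output_spec s : nvar s vn = n ->
  forall t, (t < n)%N -> rarr (den (write_output d) s) 0 t = rarr s (aBest d) t /\
                         rarr (den (write_output d) s) 1 t = rarr s (aBest d) (n + t).
Proof.
move=> hn t ht; rewrite /write_output den_seq.
set s1 := den (copy _ _ _) s.
have n1 : nvar s1 vn = n by rewrite /s1 vloop_var.
have h1 : rarr s1 0 t = rarr s (aBest d) t.
  rewrite /s1 /copy; apply: (vloop_spec (f := rarr s (aBest d))); rewrite ?hn //.
  by move=> i s' hi hx _ h2 _; rewrite -[LHS]/(rarr s' (aBest d) (nvar s' vt)) hx h2.
have o1 : rarr s1 (aBest d) = rarr s (aBest d) by rewrite /s1 vloop_off.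
clearbody s1; split; first by rewrite vloop_off.
apply: (vloop_spec (f := fun i => rarr s (aBest d) (n + i)%N)); rewrite ?n1 //.
move=> i s' hi hx h1' h2 _.
by rewrite -[LHS]/(rarr s' (aBest d) (nvar s' vn + nvar s' vt)%N) hx h2 ?o1 // h1' ?n1.
Qed.

Lemma main_spec (t0 : 'I_N) s : t0 = 0%N :> nat ->
    nvar s vn = n -> nvar s vN = N -> nvar s vB = B ->
    (forall b, (b < arr0 d)%N -> rarr s b = A b) ->
    (forall b i, (arr0 d <= b)%N -> rarr s b i = 0) ->
  let sh := if odd d then 0 else shifted_form d A 0 (evec R t0) in
  exists x : V,
    [/\ nrm x = 1, shifted_form d A sh (evec R t0) <= shifted_form d A sh x,
        (forall pms (t : 'I_N) k z, size pms = e -> all (in_range N B) pms -> (k < N)%N ->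
           power_candidate e A sh (map (test_vec R N B) pms) t k z -> z != 0 ->
           shifted_form d A sh (unit z) <= shifted_form d A sh x) &
        forall t, (t < n)%N -> rarr (den (main d) s) 0 t = entries x t /\
                              rarr (den (main d) s) 1 t = entries x (n + t)].
Proof.
move=> ht hn hN hB hA h0 sh.
have [] := initial_spec ht hn hN hB hA h0; rewrite -/sh.
rewrite /main 2!den_seq; move: (den (initial d) s) => s1 e1 ok1 b1.
have [e2 [x1 bx] le h] := @search_spec R n e B A sh e 0 s1 erefl e1 ok1.
move: (den (search _ _ _) s1) e2 x1 bx le h => s2 e2 x1 bx le h.
exists (vec s2 (aBest d)); split=> //; first by rewrite -bx -b1.
  move=> pms t k z sz hr hk hc z0; rewrite -bx; apply: h => //.
  by exists pms; split=> //; exists t, k.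
have [hn2 _ _ _ _] := e2.
by move=> t lt; have [-> ->] := write_output_spec hn2 lt; rewrite !entries_vec //; lia.
Qed.

Lemma grow_spec E s : nvar s vN = N ->
  [/\ nvar (den (grow E) s) vB = (243 * N ^ E)%N,
      nvar (den (grow E) s) vN = N, nvar (den (grow E) s) vn = nvar s vn &
      rarr (den (grow E) s) = rarr s].
Proof.
move=> hN; elim: E => [|E [h1 h2 h3 h4]]; first by rewrite /= muln1; split.
have -> : den (grow E.+1) s = den (PSeq (PN vaddr (NConst 0))
    (PSeq (PFor vt vN (PN vaddr (NAdd (NVar vaddr) (NVar vB))))
          (PN vB (NVar vaddr)))) (den (grow E) s) by [].
move: (den (grow E) s) h1 h2 h3 h4 => s1 h1 h2 h3 h4.
rewrite 2!den_seq; set s2 := den (PN vaddr _) s1.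
pose I i s' := [/\ nvar s' vaddr = (i * (243 * N ^ E))%N, nvar s' vB = (243 * N ^ E)%N,
  nvar s' vN = N, nvar s' vn = nvar s vn & rarr s' = rarr s].
have [i1 i2 i3 i4 i5] : I (nvar s2 vN) (den (PFor vt vN (PN vaddr (NAdd (NVar vaddr) (NVar vB)))) s2).
  apply: for_ind; first by split.
  move=> i s' _ _ [j1 j2 j3 j4 j5]; split=> //.
  by rewrite /= j1 j2 mulSn addnC.
move: (den _ s2) i1 i2 i3 i4 i5 => s3 i1 i2 i3 i4 i5.
split=> //.
rewrite den_PN_eq -[neval _ _]/(nvar s3 vaddr) i1 -[nvar s2 vN]/(nvar s1 vN) h2 expnS.
by rewrite mulnCA.
Qed.

End MainSpec.

(** * The conjugate form read from the input *)

Section Radix.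
Variable n : nat.
Implicit Types (s : seq 'I_n).

Lemma radix_foldl m s : foldl (fun (m : nat) (t : 'I_n) => m * n + t)%N m s =
  (m * n ^ size s + radix s)%N.
Proof.
rewrite /radix; elim: s m => [|x s IH] m /=; first by rewrite muln1 addn0.
by rewrite IH (IH (0 * n + x)%N) expnS; lia.
Qed.

Lemma radix_cons x s : radix (x :: s) = (x * n ^ size s + radix s)%N.
Proof. by rewrite {1}/radix /= radix_foldl. Qed.

Lemma radix_lt s : (radix s < n ^ size s)%N.
Proof.
elim: s => // x s IH; rewrite radix_cons /= expnS.
have : (x.+1 * n ^ size s <= n * n ^ size s)%N by rewrite leq_mul2r ltn_ord orbT.
by rewrite mulSn; lia.
Qed.

Lemma radix_inj s1 s2 : size s1 = size s2 -> radix s1 = radix s2 -> s1 = s2.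
Proof.
elim: s1 s2 => [|x s1 IH] [|y s2] //= [sz]; rewrite !radix_cons sz => E.
have h1 := radix_lt s1; have h2 := radix_lt s2; rewrite sz in h1.
have p : (0 < n ^ size s2)%N by lia.
have xy : x = y.
  apply: val_inj; have := congr1 (divn ^~ (n ^ size s2)%N) E.
  by rewrite !divnMDl // !divn_small // !addn0.
by rewrite xy (IH s2) //; move: E; rewrite xy => /addnI.
Qed.

End Radix.

Lemma big_tuple_cat (S : nmodType) (T : finType) (k m : nat) (F : seq T -> S) :
  \sum_(w : (k + m).-tuple T) F w =
  \sum_(i : k.-tuple T) \sum_(j : m.-tuple T) F (i ++ j).
Proof.
elim: k F => [|k IH] F; first by rewrite big_tuple0.
rewrite !big_tuple_cons; apply: eq_bigr => x _ /=.
by rewrite (IH (fun s => F (x :: s))).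
Qed.

Section FormBridge.
Variables (R : realType) (n d : nat).
Local Notation N := (n + n)%N.
Local Notation V := 'rV[R]_N.

Lemma monomial_sum_tuples (A A' z : nat -> R) k r t w c :
  monomial_sum n A A' z k r t w c = complex.Re (\sum_(l : r.-tuple 'I_n)
    Complex (A (c + radix l)%N) (A' (c + radix l)%N) *
    (w * \prod_(i < r) fac k (t + i) (nth 0 (map (fun j : 'I_n => crd n z j) l) i))).
Proof.
elim: r t w c => [|r IH] t w c /=.
  rewrite big_tuple0 big_ord0 mulr1 addn0; case: w => x y /=; ring.
rewrite big_tuple_cons Re_sum; apply: eq_bigr => x _.
rewrite IH; congr complex.Re; apply: eq_bigr => l _.
have -> : radix [tuple of x :: l] = (x * n ^ r + radix l)%N.
  exact: etrans (radix_cons x l) (congr1 (fun m => x * n ^ m + radix l)%N (size_tuple l)).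
rewrite addnA big_ord_recl /= addn0 !mulrA -!mulrA.
congr (_ * (_ * (_ * _))).
by apply: eq_bigr => i _; rewrite /bump /= addnS addSn.
Qed.

Lemma form_value_dform (A : nat -> nat -> R) :
  dform d (fun x : V => form_value n d A (entries x)).
Proof.
exists ('I_d.+1 * d.-tuple 'I_n)%type,
  (fun kl : 'I_d.+1 * d.-tuple 'I_n => Complex (A kl.1.*2 (radix kl.2)) (A kl.1.*2.+1 (radix kl.2))),
  (fun (kl : 'I_d.+1 * d.-tuple 'I_n) t x => fac kl.1 t (nth 0 (map (fun j : 'I_n => crd n (entries x) j) kl.2) t)).
split=> [[k l] t a x y|x] /=.
  have L w1 w2 : fac k t (a%:C%C * w1 + w2) = a%:C%C * fac k t w1 + fac k t w2.
    rewrite /fac; case: ifP => // _; case: w1 w2 => [x1 y1] [x2 y2].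
    by congr Complex; ring.
  rewrite -L; congr fac; have [tl|tl] := ltnP t (size l); last first.
    by rewrite !nth_default ?size_map // mulr0 addr0.
  have x0 : 'I_n by case: (l : seq _) tl => // x0.
  rewrite !(nth_map x0) // /crd; set i := nth x0 l t.
  have e1 z : entries (z : V) i = z 0 (lshift n i) by rewrite -entriesE.
  have e2 z : entries (z : V) (n + i)%N = z 0 (rshift n i) by rewrite -entriesE.
  by rewrite !e1 !e2 !mxE; congr Complex; ring.
rewrite /form_value -(pair_bigA _ (fun (k : 'I_d.+1) (l : d.-tuple 'I_n) =>
   Complex (A k.*2 (radix l)) (A k.*2.+1 (radix l)) *
   \prod_(t < d) fac k t (nth 0 (map (fun j : 'I_n => crd n (entries x) j) l) t))) /=.
rewrite Re_sum; apply: eq_bigr => k _; rewrite monomial_sum_tuples; congr complex.Re.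
by apply: eq_bigr => l _; rewrite add0n mul1r.
Qed.

Lemma sqr_norm_dform h : dform h.*2 (fun x : V => dot x x ^+ h).
Proof.
exists (h.-tuple 'I_N), (fun=> 1), (fun (l : h.-tuple 'I_N) t (x : V) => (nth 0 (map (fun j : 'I_N => x 0 j) l) t./2)%:C%C).
split=> [l t a x y|x].
  have [tl|tl] := ltnP t./2 (size l); last first.
    by rewrite !nth_default ?size_map // rmorph0 mulr0 addr0.
  have x0 : 'I_N by case: (l : seq _) tl => // x0.
  by rewrite !(nth_map x0) // !mxE rmorphD rmorphM.
have -> : dot x x ^+ h = \sum_(l : h.-tuple 'I_N) \prod_(t < h.*2) nth 0 (map (fun j : 'I_N => x 0 j) l) t./2.
  elim: h => [|h IH]; first by rewrite big_tuple0 big_ord0.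
  rewrite big_tuple_cons exprS IH mulr_suml; apply: eq_bigr => j _.
  rewrite mulr_sumr; apply: eq_bigr => l _.
  by rewrite doubleS !big_ord_recl /= mulrA.
rewrite -[LHS]/(complex.Re (_%:C%C)) rmorph_sum; congr complex.Re.
by apply: eq_bigr => l _; rewrite mul1r rmorph_prod.
Qed.

Lemma shifted_form_dform (A : nat -> nat -> R) sh : (odd d -> sh = 0) ->
  dform d (shifted_form d A sh : V -> R).
Proof.
move=> hs; have [od|ev] := boolP (odd d).
  have [I [c [f [l E]]]] := form_value_dform A; exists I, c, f; split=> // x.
  by rewrite /shifted_form hs // mul0r subr0 E.
apply: dform_sub (form_value_dform A) (dform_scale sh _).
by rewrite -[d in dform d]odd_double_half (negbTE ev); exact: sqr_norm_dform.
Qed.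

(** The isometry between R^(2n) and C^n. *)
Definition cplx (x : V) : 'cV[R[i]]_n := \col_t crd n (entries x) t.

Lemma cplx_surj (y : 'cV[R[i]]_n) : exists x, cplx x = y.
Proof.
exists (row_mx (\row_t complex.Re (y t 0)) (\row_t complex.Im (y t 0))).
apply/colP => t; rewrite mxE /crd.
have -> : (t : nat) = lshift n t by [].
have -> : (n + lshift n t)%N = rshift n t by [].
by rewrite !entriesE row_mxEl row_mxEr !mxE; case: (y t 0).
Qed.

Lemma l2norm_cplx x : l2norm (cplx x) = nrm x.
Proof.
rewrite /l2norm /nrm /dot big_split_ord /= -big_split; congr Num.sqrt.
apply: eq_bigr => t _; rewrite mxE /= -!expr2.
have -> : (t : nat) = lshift n t by [].
have -> : (n + lshift n t)%N = rshift n t by [].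
by rewrite !entriesE.
Qed.

(** Words of the same length have different addresses, so each address of a pair of
    nondecreasing words holds one coefficient, and all others hold 0; hence the
    program may sum over all words. *)
Lemma input_arrE (a : coefs R n d) (k : 'I_d.+1) (b : bool) (i : k.-tuple 'I_n) (j : (d - k).-tuple 'I_n) :
  input_arr a (b + k.*2) (radix (i ++ j)) =
  if nondecr i && nondecr j then (if b then complex.Im (a k i j) else complex.Re (a k i j)) else 0.
Proof.
rewrite /input_arr half_bit_double oddD oddb odd_double addbF (big_pred1 k); last first.
  by move=> k'; rewrite /= -val_eqE.
have inj (i' : k.-tuple 'I_n) (j' : (d - k).-tuple 'I_n) :
    radix (i' ++ j') = radix (i ++ j) -> i' = i /\ j' = j.
  move/radix_inj => /(_ _)/eqP; rewrite !size_cat !size_tuple => /(_ erefl).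
  by rewrite eqseq_cat ?size_tuple // => /andP[/eqP h1 /eqP h2]; split; apply: val_inj.
have [ij|nij] := boolP (nondecr i && nondecr j).
  have /andP[ni nj] := ij.
  rewrite (bigD1 i) //= (bigD1 j) ?nj ?eqxx //= big1 ?addr0 => [|j' /andP[/andP[_ /eqP/inj[_ ->]]]]; last by rewrite eqxx.
  rewrite big1 ?addr0 // => i' /andP[_ hi']; rewrite big1 // => j' /andP[_ /eqP /inj[ii _]].
  by rewrite ii eqxx in hi'.
rewrite big1 // => i' ni'; rewrite big1 // => j' /andP[nj' /eqP /inj[ii jj]].
by rewrite -ii -jj ni' nj' in nij.
Qed.

Lemma form_value_conj (a : coefs R n d) (x : V) :
  form_value n d (input_arr a) (entries x) = real_form a (cplx x).
Proof.
rewrite /real_form /conj_form /form_value Re_sum; apply: eq_bigr => k _.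
rewrite monomial_sum_tuples; congr complex.Re.
have hk : (k <= d)%N by rewrite -ltnS.
pose G (l : seq 'I_n) := Complex (input_arr a k.*2 (0 + radix l)) (input_arr a k.*2.+1 (0 + radix l)) *
  (1 * \prod_(i < d) fac k (0 + i) (nth 0 (map (fun j : 'I_n => crd n (entries x) j) l) i)).
have -> : \sum_(l : d.-tuple 'I_n) G l = \sum_(l : (k + (d - k)).-tuple 'I_n) G l.
  by rewrite subnKC.
have term (i : k.-tuple 'I_n) (j : (d - k).-tuple 'I_n) : G (i ++ j) =
    if nondecr i && nondecr j then
      a k i j * Num.conj (\prod_(t <- i) cplx x t 0) * \prod_(t <- j) cplx x t 0
    else 0.
  rewrite /G !add0n mul1r.
  rewrite (input_arrE a false i j) (input_arrE a true i j); case: ifP => _; last by rewrite mul0r.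
  rewrite -mulrA; congr (_ * _); first by case: (a k i j).
  rewrite map_cat; set u := map _ i; set v := map _ j.
  have su : size u = k by rewrite size_map size_tuple.
  have sv : size v = (d - k)%N by rewrite size_map size_tuple.
  have eu : \prod_(t <- i) cplx x t 0 = \prod_(w <- u) w.
    by rewrite big_map; apply: eq_bigr => t _; rewrite mxE.
  have nu : \prod_(w <- u) w = \prod_(0 <= t < k) nth 0 u t by rewrite (big_nth 0) su.
  have nv : \prod_(w <- v) w = \prod_(0 <= t < d - k) nth 0 v t by rewrite (big_nth 0) sv.
  have ew : \prod_(t <- j) cplx x t 0 = \prod_(w <- v) w.
    by rewrite big_map; apply: eq_bigr => t _; rewrite mxE.
  rewrite eu ew nu nv -(big_mkord xpredT (fun t => fac k (0 + t) (nth 0 (u ++ v) t))).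
  rewrite (big_cat_nat (leq0n k) hk) /=; congr (_ * _).
    rewrite rmorph_prod; apply: eq_big_nat => t /andP[_ tk].
    by rewrite /fac add0n tk nth_cat su tk.
  rewrite -{1}[nat_of_ord k]add0n big_addn; apply: eq_big_nat => t _.
  by rewrite /fac add0n nth_cat su ltnNge leq_addl /= addnK.
rewrite big_tuple_cat [RHS]big_mkcond; apply: eq_bigr => i _; case: ifP => ni.
  by rewrite [RHS]big_mkcond; apply: eq_bigr => j _; rewrite term ni.
by rewrite big1 // => j _; rewrite term ni.
Qed.

End FormBridge.

(** * The approximation guarantee *)

(** Replace the arguments of the multilinear form by basis vectors one by one: unit
    vectors have coordinates of absolute value at most 1. *)
Lemma dform_bounded (R : realType) (N d : nat) (q : 'rV[R]_N -> R) : dform d q ->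
  exists C, forall x, nrm x = 1 -> `|q x| <= C.
Proof.
move=> qf.
have H r xs : (size xs + r)%N = d ->
    exists C, forall y, nrm y = 1 -> `|pol q (xs ++ nseq r y) 0| <= C.
  elim: r xs => [|r IH] xs sz; first by exists `|pol q xs 0| => y _; rewrite cats0.
  have [|C hC] := @fin_all_exists 'I_N (fun=> R)
      (fun t c => forall y, nrm y = 1 -> `|pol q (rcons xs (evec R t) ++ nseq r y) 0| <= c).
    by move=> t; apply: IH; rewrite size_rcons -sz addnS.
  exists (\sum_t C t) => y y1; pose f z := pol q (xs ++ z :: nseq r y) 0.
  have lf : lin f.
    by move=> a z1 z2; rewrite /f (dform_pol_lin _ _ _ qf) // size_nseq -addnS.
  rewrite -[pol _ _ _]/(f y) (lin_dot y lf); apply: le_trans (ler_norm_sum _ _ _) _.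
  apply: ler_sum => t _; rewrite normrM mxE -[leRHS]mul1r ler_pM //.
    by have := cauchy_schwarz y (evec R t); rewrite dot_evec y1 nrm_evec mulr1.
  by have := hC t y y1; rewrite cat_rcons.
have [C hC] := H d [::] erefl.
exists C => x x1; apply: le_trans (hC x x1).
rewrite (dform_pol_diag x qf) normrM -[leLHS]mul1r ler_wpM2r // ger0_norm.
  by rewrite -natrX -natrM ler1n muln_gt0 expn_gt0 fact_gt0.
by rewrite mulr_ge0 ?exprn_ge0 ?ler0n.
Qed.

Section Algorithm.
Variables (R : realType) (e E : nat).
Local Notation d := e.+2.

Definition algorithm : prog :=
  PSeq (PN vN (NAdd (NVar vn) (NVar vn))) (PSeq (grow E) (main d)).

Definition main_bounds (b : nat) : {poly nat} :=
  if b == vn then 'X else if b == vN then 'X + 'X else 243%:P * ('X + 'X) ^+ E.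

Definition running_time : {poly nat} :=
  1%:P + 1%:P + (1%:P + cost (fun=> 'X + 'X) (grow E) + cost main_bounds (main d)).

Lemma hornerX_nat (p : {poly nat}) (k n : nat) : (p ^+ k).[n] = (p.[n] ^ k)%N.
Proof. by elim: k => [|k IH]; rewrite ?hornerC // exprS hornerM IH expnS. Qed.

Lemma algorithm_runs (n : nat) (s : state R) : nvar s vn = n ->
  runs (compile algorithm) s (den algorithm s) running_time.[n].
Proof.
move=> hn.
have sumE (c1 c2 : {poly nat}) : (1%:P + 1%:P + (1%:P + c1 + c2)).[n] =
    (1 + 1 + (1 + c1.[n] + c2.[n]))%N by rewrite !hornerD !hornerC.
rewrite /running_time sumE.
set s1 := den (PN vN (NAdd (NVar vn) (NVar vn))) s.
have n1 : nvar s1 vn = n by [].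
have N1 : nvar s1 vN = (n + n)%N by rewrite /s1 den_PN_eq -hn.
have [B2 N2 n2 _] := @grow_spec R n E s1 N1.
have run1 : runs (compile (grow E)) s1 (den (grow E) s1) (cost (fun=> 'X + 'X) (grow E)).[n].
  apply: runs_compile (grow_bounded E) _ => b /eqP->.
  by rewrite N1 hornerD hornerX.
have run2 : runs (compile (main d)) (den (grow E) s1) (den (main d) (den (grow E) s1))
    (cost main_bounds (main d)).[n].
  apply: runs_compile (main_bounded d) _ => b hb.
  have [->|[->|->]] : b = vn \/ b = vN \/ b = vB by move: hb; rewrite /bound_var /vn /vN /vB; lia.
  - by rewrite /main_bounds hornerX n2 n1.
  - by rewrite /main_bounds /= hornerD hornerX N2.
  - by rewrite /main_bounds /= hornerM hornerC hornerX_nat hornerD hornerX B2.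
have run0 : runs (compile (PN vN (NAdd (NVar vn) (NVar vn)))) s s1 1 by exact: runs_step.
rewrite /algorithm 2!den_seq.
have cE p1 p2 : compile (PSeq p1 p2) = Seq (compile p1) (compile p2) by [].
rewrite 2!cE; exact: runs_seq run0 (runs_seq run1 run2).
Qed.

Lemma algorithm_output (n : nat) (t0 : 'I_(n + n)) (a : coefs R n d) (w : seq bool) :
  t0 = 0%N :> nat ->
  let cf := run (compile algorithm) running_time.[n] (input a w) in
  let A := input_arr a in
  let sh := if odd d then 0 else real_form a (cplx (evec R t0)) in
  let q x := shifted_form d A sh (x : 'rV[R]_(n + n)) in
  halted cf /\
  exists x, [/\ output n cf = cplx x, nrm x = 1, q (evec R t0) <= q x &
    forall pms (t : 'I_(n + n)) k z, size pms = e ->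
      all (in_range (n + n) (243 * (n + n) ^ E)) pms -> (k < n + n)%N ->
      power_candidate e A sh (map (test_vec R (n + n) (243 * (n + n) ^ E)) pms) t k z -> z != 0 ->
      q (unit z) <= q x].
Proof.
move=> ht cf A sh q.
have cfE : cf = ([::], den algorithm (input a w)).
  by apply: run_halt; apply: algorithm_runs.
split; first by rewrite cfE.
set s := input a w.
set s1 := den (PN vN (NAdd (NVar vn) (NVar vn))) s.
have N1 : nvar s1 vN = (n + n)%N by rewrite /s1 den_PN_eq.
have [B2 N2 n2 r2] := @grow_spec R n E s1 N1.
have A2 b : (b < arr0 d)%N -> rarr (den (grow E) s1) b = A b by rewrite r2.
have Z2 b i : (arr0 d <= b)%N -> rarr (den (grow E) s1) b i = 0.
  move=> hb; rewrite r2 -[LHS]/(input_arr a b i) /input_arr big_pred0 // => k.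
  by have := ltn_ord k; move: hb; rewrite /arr0 => hb hk; apply/negP => /eqP; lia.
have [x [x1 hx hc ho]] := main_spec ht n2 N2 B2 A2 Z2.
have shE : (if odd d then 0 else shifted_form d A 0 (evec R t0)) = sh.
  by rewrite /sh shifted_form0 form_value_conj.
rewrite shE in hx hc.
exists x; split=> //.
by apply/colP => t; rewrite cfE !mxE; have [-> ->] := ho t (ltn_ord t).
Qed.

Variable gamma : R.
Hypotheses (gamma_gt0 : 0 < gamma) (E_large : 10 * gamma <= E%:R).

Definition net_ratio (n : nat) : R := gamma * ln ((2 * n)%:R : R) / (2 * n)%:R.

(** The candidate [u] provided by [search_point] depends on [y], but the best value
    dominates all candidates.  The signed sums come in pairs of opposite vectors,
    so for odd degree it also dominates [- q u]. *)
Lemma algorithm_quality (n : nat) (t0 : 'I_(n + n)) (a : coefs R n d) (w : seq bool) :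
  (0 < n)%N -> 0 < net_ratio n < 1 -> t0 = 0%N :> nat ->
  let cf := run (compile algorithm) running_time.[n] (input a w) in
  let sh := if odd d then 0 else real_form a (cplx (evec R t0)) in
  let q x := shifted_form d (input_arr a) sh (x : 'rV[R]_(n + n)) in
  let rho := d`!%:R / d%:R ^+ d * (Num.sqrt (net_ratio n / 2) ^+ e / 2) in
  exists x, [/\ output n cf = cplx x, nrm x = 1, q (evec R t0) <= q x &
    forall y, nrm y = 1 -> q y != 0 ->
      exists u, [/\ nrm u = 1, rho * `|q y| <= `|q u|, q u <= q x &
                    odd d -> - q u <= q x]].
Proof.
move=> n0 /andP[r0 r1] ht cf sh q rho.
have [_ [x [xo x1 hx hc]]] := algorithm_output a w ht.
exists x; split=> // y y1 qy.
have qf : dform d q.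
  by apply: shifted_form_dform; rewrite /sh => ->.
have beta0 : 0 < Num.sqrt (net_ratio n / 2) by rewrite sqrtr_gt0 divr_gt0.
have net (b : 'rV[R]_(n + n)) := @test_family_quality R gamma n E gamma_gt0 n0 E_large r1 b.
have BE : (243 * (2 * n) ^ E = 243 * (n + n) ^ E)%N by rewrite mul2n addnn.
rewrite BE in net.
have [pms [t [k [z [[sz hr hk z0 hz] hq]]]]] := search_point qf beta0 net y1 qy.
exists (unit z); split; [exact: nrm_unit|exact: hq|exact: (hc pms t k)|].
move=> od; have -> : - q (unit z) = q (unit (- z)).
  rewrite /unit nrmN scalerN -scaleN1r (dformZ (-1) _ qf) -signr_odd od expr1.
  by rewrite mulN1r.
apply: (hc pms t k) => //; last by rewrite oppr_eq0.
by move: hz; cbv zeta; rewrite signed_sumsN oppr0.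
Qed.

End Algorithm.

Lemma fact_le_exp (d : nat) : (d`! <= d ^ d)%N.
Proof.
have H k : (k <= d -> k`! <= d ^ k)%N.
  elim: k => // k IH hk; rewrite factS expnS leq_mul // IH //; exact: ltnW.
exact: H.
Qed.

Lemma ratio_bounds (R : realType) (d : nat) (c b : R) : 1 <= c -> 0 < b <= 1 -> (0 < d)%N ->
  0 < d`!%:R / (c * d%:R) ^+ d * b <= 1.
Proof.
move=> c1 /andP[b0 b1] d0.
have c0 : 0 < c by apply: lt_le_trans c1.
have dd : 0 < (c * d%:R) ^+ d by rewrite exprn_gt0 // mulr_gt0 ?ltr0n.
rewrite mulr_gt0 ?divr_gt0 ?ltr0n ?fact_gt0 //=.
rewrite -[leRHS]mulr1 ler_pM ?divr_ge0 ?ler0n ?(ltW dd) ?(ltW b0) //.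
rewrite ler_pdivrMr // mul1r exprMn; apply: le_trans (_ : d%:R ^+ d <= _).
  by rewrite -natrX ler_nat fact_le_exp.
by rewrite -[leLHS]mul1r ler_wpM2r ?exprn_ge0 ?ler0n // exprn_ege1.
Qed.

Lemma coin_prob_true (R : realType) (T : nat) (P : T.-tuple bool -> Prop) :
  (forall w, P w) -> coin_prob R P = 1.
Proof.
move=> hP; rewrite /coin_prob (eq_card (B := predT)); last first.
  by move=> w; rewrite !inE; apply/asboolP.
by rewrite card_tuple card_bool natrX divff // expf_neq0 // pnatr_eq0.
Qed.

Theorem theorem6p5 (R : realType) (d : nat) (gamma : R)
    (d_ge2 : (2 <= d)%N) (gamma_gt0 : 0 < gamma) :
  let dom := fun n : nat =>
    (0 < n)%N /\ gamma < (2 * n)%:R / ln ((2 * n)%:R : R) in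
  let base := fun n : nat =>
    (gamma * ln ((2 * n)%:R : R) / (2 * n)%:R) `^ ((d%:R - 2) / 2) in
  (~~ odd d ->
     GS_admits_rel_approx d dom
       (fun n => d`!%:R / (2 * d%:R) ^+ d * base n)) /\
  (odd d ->
     GS_admits_approx d dom
       (fun n => d`!%:R / (Num.sqrt 2 * d%:R) ^+ d * base n)).
Proof.
case: d d_ge2 => [//|[//|e]] _ dom base; set d := e.+2.
pose E := (Num.trunc (10 * gamma)).+1.
have hE : 10 * gamma <= E%:R by rewrite ltW // truncnS_gt.
have ratio n : dom n -> 0 < net_ratio gamma n < 1.
  move=> [n0 hg]; have N2 : 2 <= (2 * n)%:R :> R by rewrite ler_nat; lia.
  have lN : 0 < ln ((2 * n)%:R : R) by rewrite ln_gt0 //; lra.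
  have N0 : 0 < (2 * n)%:R :> R by lra.
  by rewrite /net_ratio divr_gt0 ?mulr_gt0 //= ltr_pdivrMr // mul1r -ltr_pdivlMr.
have baseE n : dom n -> base n = Num.sqrt (net_ratio gamma n) ^+ e.
  move=> /ratio/andP[/ltW r0 _]; rewrite /base -/(net_ratio gamma n).
  have -> : (d%:R - 2) / 2 = 2^-1 * e%:R :> R by rewrite /d -natr1 -natr1; field.
  by rewrite powRrM powR12_sqrt // powR_mulrn // sqrtr_ge0.
have base01 n : dom n -> 0 < base n <= 1.
  move=> dn; rewrite baseE //; have /andP[r0 r1] := ratio n dn.
  rewrite exprn_gt0 ?sqrtr_gt0 //= exprn_ile1 ?sqrtr_ge0 //.
  by rewrite -sqrtr1 ler_sqrt // ltW.
have s2 : 1 <= Num.sqrt (2 : R) by rewrite -[leLHS]sqrtr1 ler_sqrt // ler1n.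
have s22 : Num.sqrt (2 : R) <= 2.
  by rewrite -[leRHS]ger0_norm // -sqrtr_sqr ler_sqrt //; lra.
have s2K : Num.sqrt (2 : R) ^+ 2 = 2 by rewrite sqr_sqrtr.
have rhoE n : dom n -> d`!%:R / d%:R ^+ d * (Num.sqrt (net_ratio gamma n / 2) ^+ e / 2) =
    d`!%:R / (Num.sqrt 2 * d%:R) ^+ d * base n.
  move=> dn; rewrite baseE //; have /andP[r0 r1] := ratio n dn.
  rewrite (sqrtrM _ (ltW r0)) sqrtrV // !exprMn exprVn.
  have -> : Num.sqrt 2 ^+ d = 2 * Num.sqrt 2 ^+ e :> R by rewrite /d 2!exprS mulrA -expr2 s2K.
  have D0 : d%:R ^+ d != 0 :> R by rewrite expf_neq0 // pnatr_eq0.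
  have S0 : Num.sqrt 2 ^+ e != 0 :> R by rewrite expf_neq0 // gt_eqF //; lra.
  move: (d%:R ^+ d : R) (Num.sqrt (2 : R) ^+ e) (Num.sqrt (net_ratio gamma n) ^+ e) (d`!%:R : R) D0 S0 => x1 x2 x3 x4 h1 h2.
  by field; rewrite h1 h2.
have sphereP n (z : 'cV[R[i]]_n) : csphere R n z -> exists2 y, nrm y = 1 & z = cplx y.
  by have [y <-] := cplx_surj z; rewrite /csphere /= l2norm_cplx => y1; exists y.
have valP n (a : coefs R n d) y : nrm y = 1 ->
    [set real_form a z | z in csphere R n]%classic (real_form a (cplx y)).
  by move=> y1; exists (cplx y) => //; rewrite /csphere /= l2norm_cplx.
have bound n (a : coefs R n d) : exists C, forall z, csphere R n z -> `|real_form a z| <= C.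
  have [C hC] := dform_bounded (form_value_dform n d (input_arr a)).
  by exists C => z /sphereP[y y1 ->]; rewrite -form_value_conj; exact: hC.
split=> [ev|od].
  split=> [n dn|eps eps0]; first by apply: ratio_bounds (base01 n dn) _; rewrite // ler1n.
  exists (compile (algorithm e E)), (running_time e E) => n a dn _ T.
  have N0 : (0 < n + n)%N by have [n0 _] := dn; lia.
  pose t0 := Ordinal N0.
  split=> [w|]; first by have [] := algorithm_output E a w (erefl : t0 = 0%N :> nat).
  rewrite coin_prob_true => [|w]; first by lra.
  have [x [-> x1 qx hq]] :=
    algorithm_quality gamma_gt0 hE a w dn.1 (ratio n dn) (erefl : t0 = 0%N :> nat).
  rewrite rhoE // (negbTE ev) in qx hq *.
  set sh := real_form a _ in qx hq.
  have qE y : nrm y = 1 -> shifted_form d (input_arr a) sh y = real_form a (cplx y) - sh.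
    move=> y1; rewrite /shifted_form form_value_conj.
    by rewrite -nrm_sqr y1 !expr1n mulr1.
  have p0 : real_form a (cplx (evec R t0)) = sh by [].
  rewrite !qE ?nrm_evec // p0 subrr in qx.
  set rho := _ * base n; set rho' := _ / _ * base n in hq.
  (* [2 (sqrt 2) ^ d <= 2 ^ d] holds because [d] is at least 2. *)
  have rr : 2 * rho <= rho'.
    have /andP[/ltW b0 _] := base01 n dn.
    rewrite /rho /rho' mulrA ler_wpM2r // mulrCA ler_wpM2l ?ler0n //.
    have d0 : 0 < d%:R :> R by rewrite ltr0n.
    rewrite ler_pdivrMr ?exprn_gt0 ?mulr_gt0 // ler_pdivlMl ?exprn_gt0 ?mulr_gt0 //; last by lra.
    rewrite !exprMn [leRHS]mulrC mulrAC [leRHS]mulrC ler_wpM2r ?exprn_ge0 ?ler0n //.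
    rewrite /d 2!exprS (mulrA (Num.sqrt 2)) -expr2 s2K 2!exprS.
    have : Num.sqrt 2 ^+ e <= 2 ^+ e :> R by rewrite lerXn2r // nnegrE; lra.
    nra.
  have /andP[rho0 _] : 0 < rho <= 1 by apply: ratio_bounds (base01 n dn) _; rewrite // ler1n.
  have [C hC] := bound n a.
  have lb : has_lbound [set real_form a z | z in csphere R n]%classic.
    exists (- C) => _ [z hz <-]; have := hC z hz; rewrite ler_norml => /andP[//].
  pose m := vmin (csphere R n) (real_form a); pose D := real_form a (cplx x) - m.
  have mle y : nrm y = 1 -> m <= real_form a (cplx y) by move=> y1; apply: ge_inf (valP _ a y y1).
  (* A large negative value of the shifted form at a candidate [u] means that the
     minimum [m] is far below [sh], which the output does not fall below. *)
  have key y : nrm y = 1 -> 2 * rho * `|real_form a (cplx y) - sh| <= D.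
    move=> y1; have mx := mle _ x1; have ms : m <= sh := mle _ (nrm_evec R t0).
    have [q0|q0] := eqVneq (real_form a (cplx y) - sh) 0.
      by rewrite q0 normr0 mulr0 /D; lra.
    have [|u [u1 hu hux _]] := hq y y1; first by rewrite qE.
    rewrite !qE // in hu hux; have mu := mle _ u1.
    apply: le_trans (_ : rho' * `|real_form a (cplx y) - sh| <= _); first exact: ler_wpM2r.
    apply: le_trans hu _; rewrite ler_norml /D; apply/andP; split; lra.
  have near y : nrm y = 1 -> `|real_form a (cplx y) - sh| <= D / (2 * rho).
    have rho2 : 0 < 2 * rho by lra.
    by move=> y1; rewrite (ler_pdivlMr _ _ rho2) mulrC key.
  split; first by rewrite /csphere /= l2norm_cplx.
  have nonempty : ([set real_form a z | z in csphere R n] !=set0)%classic.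
    by exists (real_form a (cplx x)); exact: valP.
  have up : vmax (csphere R n) (real_form a) <= sh + D / (2 * rho).
    apply: ge_sup => // _ [z /sphereP[y y1 ->] <-].
    by have := near y y1; rewrite ler_norml => /andP[_ h]; lra.
  have down : sh - D / (2 * rho) <= m.
    apply: lb_le_inf => // _ [z /sphereP[y y1 ->] <-].
    by have := near y y1; rewrite ler_norml => /andP[h _]; lra.
  rewrite -/m -/D mulrC -ler_pdivlMr //.
  have -> : D / rho = D / (2 * rho) + D / (2 * rho) by field; rewrite gt_eqF.
  lra.
split.
- move=> n dn; exact: ratio_bounds (base01 n dn) _.
- move=> n a dn _.
  have N0 : (0 < n + n)%N by have [n0 _] := dn; lia.
  have [C hC] := bound n a.
  have ub : has_ubound [set real_form a z | z in csphere R n]%classic.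
    exists C => _ [z hz <-]; exact: le_trans (ler_norm _) (hC z hz).
  pose y := evec R (Ordinal N0); have y1 : nrm y = 1 := nrm_evec R _.
  have h1 : real_form a (cplx y) <= vmax (csphere R n) (real_form a).
    exact: ub_le_sup ub _ (valP _ a y y1).
  have h2 : real_form a (cplx (- y)) <= vmax (csphere R n) (real_form a).
    by apply: ub_le_sup ub _ (valP _ a _ _); rewrite nrmN.
  have : real_form a (cplx (- y)) = - real_form a (cplx y).
    rewrite -!form_value_conj -scaleN1r (dformZ _ _ (form_value_dform n d (input_arr a))).
    by rewrite -signr_odd od expr1 mulN1r.
  lra.
- move=> eps eps0.
  exists (compile (algorithm e E)), (running_time e E) => n a dn _ T.
  have N0 : (0 < n + n)%N by have [n0 _] := dn; lia.
  pose t0 := Ordinal N0.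
  split=> [w|]; first by have [] := algorithm_output E a w (erefl : t0 = 0%N :> nat).
  rewrite coin_prob_true => [|w]; first by lra.
  have [x [-> x1 qx hq]] :=
    algorithm_quality gamma_gt0 hE a w dn.1 (ratio n dn) (erefl : t0 = 0%N :> nat).
  rewrite rhoE // od in qx hq *.
  set rho := _ * base n in hq *.
  have /andP[rho0 _] : 0 < rho <= 1 by exact: ratio_bounds (base01 n dn) _.
  have qE y : shifted_form d (input_arr a) 0 y = real_form a (cplx y).
    by rewrite shifted_form0 form_value_conj.
  have key y : nrm y = 1 -> real_form a (cplx y) != 0 ->
      rho * `|real_form a (cplx y)| <= real_form a (cplx x).
    move=> y1 y0; have [|u [u1 hu hux hux']] := hq y y1; first by rewrite qE.
    rewrite !qE in hu hux hux'; apply: le_trans hu _.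
    by rewrite ler_norml hux andbT lerNl hux'.
  (* If it were negative, its absolute value would be a lower bound for it. *)
  have px : 0 <= real_form a (cplx x).
    have [->//|x0] := eqVneq (real_form a (cplx x)) 0.
    by apply: le_trans (key x x1 x0); rewrite mulr_ge0 // ltW.
  split; first by rewrite /csphere /= l2norm_cplx.
  rewrite mulrC -ler_pdivlMr //; apply: ge_sup.
    by exists (real_form a (cplx x)); exact: valP.
  move=> _ [z /sphereP[y y1 ->] <-]; rewrite ler_pdivlMr // mulrC.
  have [->|y0] := eqVneq (real_form a (cplx y)) 0; first by rewrite mulr0.
  by apply: le_trans (key y y1 y0); rewrite ler_wpM2l ?ler_norm // ltW.
Qed.
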